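(* Let $D$ be a $2$-dimensional regular local ring and let $\mathcal{V}$ be a downset of $Q^*(D)$ that is a Noetherian space in the Zariski topology. Then for every Zariski open subset $\mathcal{U}$ of $\mathcal{V}$, the ring $\mathcal{O}_{\mathcal{U}}$ is a Noetherian normal domain.
   Context: $F$ is the quotient field of $D$. $L(D)$ is the set of local rings $R$ with $D\subseteq R\subseteq F$ and $\mathfrak{m}_R\cap D=\mathfrak{m}_D$; its Zariski topology has basis the sets $\{R\in L(D):x_1,\dots,x_n\in R\}$, $x_i\in F$, and subsets carry the subspace topology. $Q(D)$ is the set of $2$-dimensional regular local rings $\alpha$ with $D\subseteq\alpha\subseteq F$, and $Q^*(D)$ is the union of $Q(D)$ and all valuation rings in $L(D)$. A downset of $Q^*(D)$ is a subset $\mathcal{V}$ such that $\alpha\in Q^*(D)$, $\alpha\subseteq\beta\in\mathcal{V}$ imply $\alpha\in\mathcal{V}$. For $\mathcal{U}\subseteq Q^*(D)$, $\mathcal{O}_{\mathcal{U}}$ is the intersection of the rings in $\mathcal{U}$, with $\mathcal{O}_{\emptyset}=F$. *)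

(* Defs.v *)
From mathcomp Require Import all_boot all_order all_algebra.
Set Implicit Arguments. Unset Strict Implicit. Unset Printing Implicit Defensive.
Import GRing.Theory.
Local Open Scope ring_scope.

Section Defs.
Variable F : fieldType.


Definition is_subring (R : F -> Prop) : Prop :=
  R 0 /\ R 1 /\ (forall x y, R x -> R y -> R (x - y)) /\
  (forall x y, R x -> R y -> R (x * y)).

Definition quotient_field_of (D : F -> Prop) : Prop :=
  forall x : F, exists a b, D a /\ D b /\ b != 0 /\ x = a / b.

Definition is_ideal (R I : F -> Prop) : Prop :=
  (forall x, I x -> R x) /\ I 0 /\
  (forall x y, I x -> I y -> I (x + y)) /\
  (forall r x, R r -> I x -> I (r * x)).

Definition fin_gen_ideal (R I : F -> Prop) : Prop :=
  exists s : seq F, (forall i, (i < size s)%N -> I s`_i) /\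
    forall x, I x -> exists r : 'I_(size s) -> F,
      (forall i, R (r i)) /\ x = \sum_(i < size s) r i * s`_i.

Definition noetherian_ring (R : F -> Prop) : Prop :=
  forall I, is_ideal R I -> fin_gen_ideal R I.

Definition is_prime_ideal (R P : F -> Prop) : Prop :=
  is_ideal R P /\ ~ P 1 /\ (forall a b, R a -> R b -> P (a * b) -> P a \/ P b).

Definition strict_incl (A B : F -> Prop) : Prop :=
  (forall x, A x -> B x) /\ exists x, B x /\ ~ A x.

Definition prime_chain (R : F -> Prop) (n : nat) (P : nat -> F -> Prop) : Prop :=
  (forall i, (i <= n)%N -> is_prime_ideal R (P i)) /\
  (forall i, (i < n)%N -> strict_incl (P i) (P i.+1)).

Definition krull_dim_eq (R : F -> Prop) (n : nat) : Prop :=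
  (exists P, prime_chain R n P) /\ ~ (exists P, prime_chain R n.+1 P).

Definition max_ideal (R : F -> Prop) : F -> Prop :=
  fun x => R x /\ ~ (x != 0 /\ R x^-1).

Definition is_local_ring (R : F -> Prop) : Prop :=
  is_subring R /\ is_ideal R (max_ideal R).

Definition is_regular_local_2 (R : F -> Prop) : Prop :=
  is_local_ring R /\ noetherian_ring R /\ krull_dim_eq R 2 /\
  exists a b, R a /\ R b /\
    forall x, max_ideal R x <-> exists r s, R r /\ R s /\ x = r * a + s * b.

Definition is_valuation_ring (R : F -> Prop) : Prop :=
  is_subring R /\ forall x, x != 0 -> R x \/ R x^-1.

Definition incl (A B : F -> Prop) : Prop := forall x, A x -> B x.

Definition LD (D : F -> Prop) (R : F -> Prop) : Prop :=
  is_local_ring R /\ incl D R /\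
  forall x, (max_ideal R x /\ D x) <-> max_ideal D x.

Definition QD (D : F -> Prop) (R : F -> Prop) : Prop :=
  is_regular_local_2 R /\ incl D R.

Definition QstarD (D : F -> Prop) (R : F -> Prop) : Prop :=
  QD D R \/ (is_valuation_ring R /\ LD D R).

Definition is_downset (D : F -> Prop) (V : (F -> Prop) -> Prop) : Prop :=
  (forall b, V b -> QstarD D b) /\
  forall a b, QstarD D a -> incl a b -> V b -> V a.

(* Zariski topology: basic open sets {R | x_1,...,x_n in R}; open subsets
   of a subspace V of the space of subrings. *)
Definition zariski_open_in (V U : (F -> Prop) -> Prop) : Prop :=
  (forall R, U R -> V R) /\
  forall R, U R -> exists xs : seq F, (forall x, x \in xs -> R x) /\
    forall S, V S -> (forall x, x \in xs -> S x) -> U S.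

Definition noetherian_space (V : (F -> Prop) -> Prop) : Prop :=
  forall U : nat -> (F -> Prop) -> Prop,
    (forall n, zariski_open_in V (U n)) ->
    (forall n R, U n R -> U n.+1 R) ->
    exists N, forall n, (N <= n)%N -> forall R, U n R <-> U N R.

(* O_U : intersection of the rings in U (equal to F if U is empty) *)
Definition OU (U : (F -> Prop) -> Prop) : F -> Prop :=
  fun x => forall R, U R -> R x.

Definition is_normal (R : F -> Prop) : Prop :=
  forall x : F,
    (exists a b, R a /\ R b /\ b != 0 /\ x = a / b) ->
    (exists p : {poly F}, p \is monic /\ (forall i, R p`_i) /\ root p x) ->
    R x.

Definition noetherian_normal_domain (R : F -> Prop) : Prop :=
  is_subring R /\ noetherian_ring R /\ is_normal R.

End Defs.

(* Main.v *)
(** The rings of [Q(D)] form a tree: if [R] lies properly inside [S], both two-dimensional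
    regular local with the same fraction field, then [S] contains a quadratic transform of [R],
    and there is no infinite chain of quadratic transforms inside [S]. A valuation ring in [U]
    may be omitted from the intersection: the finitely many elements that define a neighbourhood
    of it lie in a regular ring contained in it, and that ring belongs to [U]. So [O_U] is the
    intersection of the rings [T] in [U] that are reached from [D] by passing only through rings
    outside [U]. The Noetherian hypothesis leaves finitely many rings to pass through: an
    infinite branch, or infinitely many points on one exceptional curve, would yield rings
    [R_n] in [V] and elements [h_n] of [R_n] with [h_i] outside [R_j] for [i < j]. Hence only
    finitely many exceptional prime divisors occur among the localisations of the rings [T] at
    height-one primes, and [O_U] is an intersection of discrete valuation rings with finite
    character. It is Noetherian by the argument of Mori and Nishimura, because its residue rings
    at the centers of these valuations are Noetherian by a Krull-Akizuki count of lengths over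
    [D]. *)

Require Import Defs.
From Stdlib Require List.
From mathcomp Require Import all_boot all_order all_algebra.
From mathcomp Require Import boolp.
From mathcomp Require Import ring zify.
Set Implicit Arguments. Unset Strict Implicit. Unset Printing Implicit Defensive.
Import GRing.Theory.
Local Open Scope ring_scope.

(** * Subrings and ideals *)

(** All rings are predicates on [F], so localisations, points of blow-ups and valuation rings are
    compared by inclusion alone. Dimension 2 enters through [rlr]: one parameter is prime and does
    not divide the other; factoriality is derived from this. Whenever one ring has to be kept out of
    another, the witness is an element of the first whose inverse is a nonunit of the second.
    Openness of [U] serves twice: it replaces a valuation ring by a regular ring below it, and it
    keeps the rings above bad points out of the order valuation ring. The last step meets an
    obstacle. An exceptional divisor is centered at the maximal ideal of [D], while its residue
    field has transcendence degree one over that of [D]; so [D] provides no one-dimensional ring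
    below the residue ring of [O_U] to which the usual Krull-Akizuki theorem would apply. The
    substitute is the family of modules of polynomials in [t = y / x] of bounded degree: their
    length over [D] grows at most linearly with the degree, with slope a bound for the degree of the
    residue field extension. This is why finiteness of the residue fields over [D] is carried along
    the tree. *)

Section Subrings.
Variable F : fieldType.
Implicit Types (R I J P : F -> Prop) (x y z : F).

Lemma sr0 R : is_subring R -> R 0. Proof. by case. Qed.
Lemma sr1 R : is_subring R -> R 1. Proof. by case=> _ []. Qed.
Lemma srB R : is_subring R -> forall x y, R x -> R y -> R (x - y).
Proof. by case=> _ [_ []]. Qed.
Lemma srM R : is_subring R -> forall x y, R x -> R y -> R (x * y).
Proof. by case=> _ [_ []]. Qed.
Lemma srN R : is_subring R -> forall x, R x -> R (- x).
Proof. by move=> h x hx; rewrite -[- x]add0r; apply: srB => //; apply: sr0. Qed.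
Lemma srD R : is_subring R -> forall x y, R x -> R y -> R (x + y).
Proof. by move=> h x y hx hy; rewrite -[y]opprK; apply: srB => //; apply: srN. Qed.
Lemma srX R : is_subring R -> forall x n, R x -> R (x ^+ n).
Proof.
move=> h x n hx; elim: n => [|n IH]; first by rewrite expr0; apply: sr1.
by rewrite exprS; apply: srM.
Qed.
Lemma sr_sum R : is_subring R -> forall (T : Type) (r : seq T) (p : pred T) (f : T -> F),
  (forall i, p i -> R (f i)) -> R (\sum_(i <- r | p i) f i).
Proof. by move=> h T r p f H; apply: big_ind => //; [apply: sr0 | apply: srD]. Qed.
End Subrings.

Ltac sr := repeat first
  [ assumption
  | match goal with
    | H : is_subring ?R |- ?R 0 => apply: (sr0 H)
    | H : is_subring ?R |- ?R 1 => apply: (sr1 H)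
    | H : is_subring ?R |- ?R (_ - _) => apply: (srB H)
    | H : is_subring ?R |- ?R (_ + _) => apply: (srD H)
    | H : is_subring ?R |- ?R (_ * _) => apply: (srM H)
    | H : is_subring ?R |- ?R (- _) => apply: (srN H)
    | H : is_subring ?R |- ?R (_ ^+ _) => apply: (srX H)
    end ].

Section Ideals.
Variable F : fieldType.
Implicit Types (R I J P : F -> Prop) (x y z : F).

(* [z] itself is not required to lie in [R]. *)
Definition isunit R z : Prop := z != 0 /\ R z^-1.
(** As a predicate in its last argument, [divides R a] is the principal module [aR]; it serves as
    the principal ideal when [a] lies in [R]. *)
Definition divides R a b : Prop := exists2 c, R c & b = c * a.

Lemma idR R I : is_ideal R I -> forall x, I x -> R x. Proof. by case. Qed.
Lemma id0 R I : is_ideal R I -> I 0. Proof. by case=> _ []. Qed.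
Lemma idD R I : is_ideal R I -> forall x y, I x -> I y -> I (x + y).
Proof. by case=> _ [_ []]. Qed.
Lemma idM R I : is_ideal R I -> forall r x, R r -> I x -> I (r * x).
Proof. by case=> _ [_ []]. Qed.
Lemma idMr R I : is_ideal R I -> forall r x, R r -> I x -> I (x * r).
Proof. by move=> h r x hr hx; rewrite mulrC; apply: idM h _ _ hr hx. Qed.
Lemma idN R I : is_subring R -> is_ideal R I -> forall x, I x -> I (- x).
Proof.
move=> hR h x hx; rewrite -mulN1r; apply: (idM h) => //; sr.
Qed.
Lemma idB R I : is_subring R -> is_ideal R I -> forall x y, I x -> I y -> I (x - y).
Proof. by move=> hR h x y hx hy; apply: (idD h) => //; apply: (idN hR h). Qed.
Lemma id_sum R I : is_ideal R I -> forall (T : Type) (r : seq T) (p : pred T) (f : T -> F),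
  (forall i, p i -> I (f i)) -> I (\sum_(i <- r | p i) f i).
Proof. by move=> h T r p f H; apply: big_ind => //; [apply: (id0 h) | apply: (idD h)]. Qed.

Lemma id_exp R P : is_prime_ideal R P -> is_subring R ->
  forall x n, R x -> P (x ^+ n) -> P x.
Proof.
move=> [hi [h1 hp]] hR x; elim=> [|n IH] hx; first by rewrite expr0.
by rewrite exprS => /(hp _ _ hx (srX hR n hx)) [] // /IH; apply.
Qed.

Lemma divides_refl R a : is_subring R -> divides R a a.
Proof. by move=> h; exists 1; [sr | rewrite mul1r]. Qed.
Lemma divides_trans R a b c : is_subring R -> divides R a b -> divides R b c -> divides R a c.
Proof. by move=> h [u hu ->] [v hv ->]; exists (v * u); [sr | rewrite mulrA]. Qed.

Lemma divides_ideal R a : is_subring R -> R a -> is_ideal R (divides R a).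
Proof.
move=> h ha; split; first by move=> x [c hc ->]; sr.
split; first by exists 0; [sr | rewrite mul0r].
split; first by move=> x y [c hc ->] [d hd ->]; exists (c + d); [sr | rewrite mulrDl].
by move=> r x hr [c hc ->]; exists (r * c); [sr | rewrite mulrA].
Qed.

Definition idealadd R I a : F -> Prop := fun z => exists2 i, I i & exists2 r, R r & z = i + r * a.

Lemma idealadd_ideal R I a : is_subring R -> is_ideal R I -> R a -> is_ideal R (idealadd R I a).
Proof.
move=> h hI ha; split.
  by move=> x [i hi [r hr ->]]; apply: (srD h); [apply: (idR hI) | sr].
split; first by exists 0; [apply: (id0 hI) | exists 0; [sr | rewrite mul0r addr0]].
split.
  move=> x y [i hi [r hr ->]] [j hj [s hs ->]]; exists (i + j); first exact: (idD hI).
  by exists (r + s); [sr | ring].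
move=> c x hc [i hi [r hr ->]]; exists (c * i); first exact: (idM hI).
by exists (c * r); [sr | ring].
Qed.
Lemma idealadd_l R I a : is_subring R -> forall z, I z -> idealadd R I a z.
Proof. by move=> h z hz; exists z => //; exists 0; [sr | rewrite mul0r addr0]. Qed.
Lemma idealadd_r R I a : is_subring R -> is_ideal R I -> idealadd R I a a.
Proof. by move=> h hI; exists 0; [apply: (id0 hI) | exists 1; [sr | rewrite mul1r add0r]]. Qed.
Lemma zero_ideal R : is_subring R -> is_ideal R (fun z => z = 0).
Proof.
move=> h; split; first by move=> x ->; sr.
split=> //; split; first by move=> x y -> ->; rewrite addr0.
by move=> r x _ ->; rewrite mulr0.
Qed.

Lemma noeth_acc R (I : nat -> F -> Prop) : noetherian_ring R ->
  (forall n, is_ideal R (I n)) -> (forall n, incl (I n) (I n.+1)) ->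
  exists N, forall n, incl (I n) (I N).
Proof.
move=> hN hI hinc.
have mono n m : (n <= m)%N -> incl (I n) (I m).
  move=> /subnK <-; elim: (m - n)%N => [|k IH] x hx //.
  by rewrite addSn; apply/hinc/IH.
have hU : is_ideal R (fun z => exists n, I n z).
  split; first by move=> x [n hx]; apply: (idR (hI n)).
  split; first by exists 0%N; apply: (id0 (hI 0%N)).
  split.
    move=> x y [n hx] [m hy]; exists (maxn n m).
    by apply: (idD (hI _)); [apply: (mono n) | apply: (mono m)] => //;
       rewrite ?leq_maxl ?leq_maxr.
  by move=> r x hr [n hx]; exists n; apply: (idM (hI n)).
have [s [hs hgen]] := hN _ hU.
have [N hNs] : exists N, forall i, (i < size s)%N -> I N s`_i.
  have: forall k, (k <= size s)%N -> exists N, forall i, (i < k)%N -> I N s`_i.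
    elim=> [|k IH] hk; first by exists 0%N.
    have [N hNk] := IH (ltnW hk); have [m hm] := hs _ hk.
    exists (maxn N m) => i; rewrite ltnS leq_eqVlt => /orP [/eqP ->|hi].
      by apply: (mono m) => //; rewrite leq_maxr.
    by apply: (mono N); [rewrite leq_maxl | apply: hNk].
  by move/(_ _ (leqnn _)).
exists N => n z hz; have [r [hr ->]] := hgen z (ex_intro _ n hz).
by apply: (id_sum (hI N)) => i _; apply: (idM (hI N)) => //; apply: hNs.
Qed.

Lemma noeth_max R (Fam : (F -> Prop) -> Prop) : noetherian_ring R ->
  (forall I, Fam I -> is_ideal R I) -> (exists I, Fam I) ->
  exists I, Fam I /\ forall J, Fam J -> incl I J -> incl J I.
Proof.
move=> hN hid [I0 hI0]; apply: contrapT => hno.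
have hnext (u : {I | Fam I}) : exists v : {I | Fam I},
    incl (sval u) (sval v) /\ ~ incl (sval v) (sval u).
  case: u => I hI /=; apply: contrapT => hn; apply: hno; exists I; split=> // J hJ hIJ.
  by apply: contrapT => hJI; apply: hn; exists (exist _ J hJ).
have [f hf] := choice hnext.
pose g n := iter n f (exist _ I0 hI0).
have [N hNN] := noeth_acc hN (fun n => hid _ (svalP (g n))) (fun n => (hf (g n)).1).
by case: (hf (g N)) => _; apply; apply: (hNN N.+1).
Qed.

(** An ideal maximal among those that contain [I] and miss all powers of [x] is prime. With [x = 1]
    this gives a prime ideal above any proper ideal. *)
Lemma prime_avoiding R I x : is_subring R -> noetherian_ring R -> is_ideal R I -> R x ->
  (forall n, ~ I (x ^+ n)) -> exists P, [/\ is_prime_ideal R P, incl I P & ~ P x].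
Proof.
move=> hR hN hI hx hIx.
have [|P [[hPi hIP hPx] hmax]] := @noeth_max R
  (fun J => [/\ is_ideal R J, incl I J & forall n, ~ J (x ^+ n)]) hN (fun J h => let: And3 a _ _ := h in a).
  by exists I; split.
exists P; split=> //; last by move=> h; apply: (hPx 1%N); rewrite expr1.
split=> //; split; first by move=> h; apply: (hPx 0%N); rewrite expr0.
move=> a b ha hb hab; apply: contrapT => /not_orP [hna hnb].
have key c : R c -> ~ P c -> exists n, idealadd R P c (x ^+ n).
  move=> hc hnc; apply: contrapT => hn; apply: hnc.
  apply: (hmax (idealadd R P c)); last exact: idealadd_r.
    split; first exact: idealadd_ideal.
      by move=> z /hIP hz; apply: idealadd_l.
    by move=> n h; apply: hn; exists n.
  by move=> z hz; apply: idealadd_l.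
have [n [i hi [r hr e1]]] := key a ha hna; have [m [j hj [s hs e2]]] := key b hb hnb.
apply: (hPx (n + m)%N); rewrite exprD e1 e2.
have -> : (i + r * a) * (j + s * b) = (j + s * b) * i + ((r * a) * j + (r * s) * (a * b)) by ring.
have hjR := idR hPi hj.
apply: (idD hPi); first by apply: (idM hPi) => //; sr.
by apply: (idD hPi); apply: (idM hPi) => //; sr.
Qed.

Lemma loc_sub R : is_local_ring R -> is_subring R. Proof. by case. Qed.
Lemma loc_id R : is_local_ring R -> is_ideal R (max_ideal R). Proof. by case. Qed.
Lemma maxP R z : R z -> max_ideal R z \/ isunit R z.
Proof. by move=> hz; case: (pselect (isunit R z)) => h; [right | left]. Qed.
Lemma max_isunit R z : max_ideal R z -> ~ isunit R z. Proof. by case. Qed.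
Lemma isunit1 R : is_subring R -> isunit R 1.
Proof. by move=> h; split; [exact: oner_neq0 | rewrite invr1; sr]. Qed.
Lemma max1 R : is_subring R -> ~ max_ideal R 1.
Proof. by move=> h [_]; apply; apply: isunit1. Qed.
Lemma isunitM R u v : is_subring R -> isunit R u -> isunit R v -> isunit R (u * v).
Proof. by move=> h [u0 hu] [v0 hv]; split; [rewrite mulf_neq0 | rewrite invfM; sr]. Qed.
Lemma isunitX R u n : is_subring R -> isunit R u -> isunit R (u ^+ n).
Proof. by move=> h [u0 hu]; split; [rewrite expf_neq0 | rewrite -exprVn; sr]. Qed.
Lemma isunitV R u : R u -> isunit R u -> isunit R u^-1.
Proof. by move=> h [u0 hu]; split; [rewrite invr_neq0 | rewrite invrK]. Qed.
Lemma isunit_divides R a u : is_subring R -> isunit R u -> R a -> divides R u a.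
Proof. by move=> h [u0 hu] ha; exists (a / u); [sr | rewrite divfK]. Qed.
Lemma isunitMl R a b : is_subring R -> R a -> R b -> isunit R (a * b) -> isunit R a.
Proof.
move=> h ha hb [n0]; move: n0; rewrite mulf_eq0 => /norP [a0 b0] hab.
split=> //; have -> : a^-1 = b * (a * b)^-1 by rewrite invfM mulrC -mulrA mulVf ?mulr1.
sr.
Qed.
Lemma max_prime R : is_local_ring R -> is_prime_ideal R (max_ideal R).
Proof.
move=> hL; have hR := loc_sub hL; split; first exact: loc_id.
split; first exact: max1.
move=> a b ha hb [_ hab]; case: (maxP ha) => [|ua]; first by left.
case: (maxP hb) => [|ub]; first by right.
by case: hab; apply: isunitM.
Qed.
Lemma isunit_addm R u z : is_local_ring R -> R u -> isunit R u -> max_ideal R z -> isunit R (u + z).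
Proof.
move=> hL hu iu hz; have hR := loc_sub hL; have hi := loc_id hL.
have hzR := idR hi hz.
case: (maxP (srD hR hu hzR)) => // h.
have : max_ideal R u by rewrite -[u](addrK z); apply: (idB hR hi).
by case.
Qed.
Lemma local_of_sum R : is_subring R ->
  (forall x y, max_ideal R x -> max_ideal R y -> max_ideal R (x + y)) -> is_local_ring R.
Proof.
move=> hR hadd; split=> //; split; first by move=> x [].
split; first by split; [sr | rewrite eqxx; case].
split=> // r x hr [hx hnx]; split; first by sr.
by rewrite mulrC => /(isunitMl hR hx hr).
Qed.

(* Write [z = y^n b_n] modulo [I] and let [(I : y^k)] be stable: then [c_n = y^k b_n] satisfies
   [c_n = y c_(n+1)] modulo [I], and the chain of ideals [I + (c_n)] stops. *)
Lemma krull_inter R I y z : is_local_ring R -> noetherian_ring R -> is_ideal R I ->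
  max_ideal R y -> R z -> (forall n, exists2 b, R b & I (z - y ^+ n * b)) -> I z.
Proof.
move=> hL hN hI hy hz hb; have hR := loc_sub hL; have hyR := idR (loc_id hL) hy.
have hb' n : exists c, R c /\ I (z - y ^+ n * c) by have [c ? ?] := hb n; exists c.
have [b hbP] := choice hb'.
have hbR n := (hbP n).1; have hbI n := (hbP n).2.
pose C n w := R w /\ I (y ^+ n * w).
have [k hk] : exists k, forall n, incl (C n) (C k).
  apply: (noeth_acc hN) => n.
    split; first by move=> w [].
    split; first by split; [sr | rewrite mulr0; apply: (id0 hI)].
    split; first by move=> v w [h1 h2] [h3 h4]; split; [sr | rewrite mulrDr; apply: (idD hI)].
    by move=> r w hr [h1 h2]; split; [sr | rewrite mulrCA; apply: (idM hI)].
  by move=> w [h1 h2]; split=> //; rewrite exprS -mulrA; apply: (idM hI).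
have hstep n : I (y ^+ k * (b n - y * b n.+1)).
  have : C n (b n - y * b n.+1).
    split; first by move: (hbR n) (hbR n.+1) => ? ?; sr.
    have -> : y ^+ n * (b n - y * b n.+1) = (z - y ^+ n.+1 * b n.+1) - (z - y ^+ n * b n).
      by rewrite exprS; ring.
    exact: (idB hR hI).
  by case/hk.
have [N hNN] : exists N, forall n, incl (idealadd R I (y ^+ k * b n)) (idealadd R I (y ^+ k * b N)).
  apply: (noeth_acc hN) => n; first by apply: idealadd_ideal => //; move: (hbR n) => ?; sr.
  move=> w [i hi [r hr ->]]; exists (i + r * (y ^+ k * (b n - y * b n.+1))).
    by apply: (idD hI) => //; apply: (idM hI).
  by exists (r * y); [sr | ring].
have hN1 : I (y ^+ k * b N.+1).
  have [i hi [r hr e]] := hNN N.+1 _ (idealadd_r _ hR hI).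
  have hu : isunit R (1 + - (r * y)).
    apply: isunit_addm => //; [sr | exact: isunit1 | ].
    by apply: (idN hR (loc_id hL)); apply: (idM (loc_id hL)).
  rewrite -[_ * _](mulKf hu.1); apply: (idM hI); first by case: hu.
  have -> : (1 - r * y) * (y ^+ k * b N.+1) = i + r * (y ^+ k * (b N - y * b N.+1)).
    have e' : i = y ^+ k * b N.+1 - r * (y ^+ k * b N) by rewrite {1}e addrK.
    by rewrite e'; ring.
  by apply: (idD hI) => //; apply: (idM hI).
have hcN : I (y ^+ k * b N).
  have -> : y ^+ k * b N = y ^+ k * (b N - y * b N.+1) + y * (y ^+ k * b N.+1) by ring.
  by apply: (idD hI) => //; apply: (idM hI).
have hkz : I (y ^+ k * b k).
  have [i hi [r hr ->]] := hNN k _ (idealadd_r _ hR hI).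
  by apply: (idD hI) => //; apply: (idM hI).
by have := idD hI (hbI k) hkz; rewrite subrK.
Qed.
End Ideals.

(** * Two-dimensional regular local rings *)

Section RegularLocal.
Variable F : fieldType.
Implicit Types (R I J P V S : F -> Prop) (x y z a b c q : F).

Definition genby R x y := forall z, max_ideal R z <-> exists r s, R r /\ R s /\ z = r * x + s * y.
Definition primein R q := [/\ R q, q != 0, ~ isunit R q &
  forall a b, R a -> R b -> divides R q (a * b) -> divides R q a \/ divides R q b].
Definition pre2 R x y := [/\ is_local_ring R, noetherian_ring R, R x, R y & genby R x y].
(* [x, y] are regular parameters of [R]; the last two conditions express that the dimension is 2
   (see [rlr_of_reg] and [reg_of_rlr]). *)
Definition rlr R x y := [/\ pre2 R x y, primein R x & ~ divides R x y].

Lemma pre2_sym R x y : pre2 R x y -> pre2 R y x.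
Proof.
case=> hL hN hx hy hg; split=> // z; split.
  by move/hg=> [r [s [hr [hs ->]]]]; exists s, r; rewrite addrC.
by move=> [r [s [hr [hs ->]]]]; apply/hg; exists s, r; rewrite addrC.
Qed.
Lemma pre2_x R x y : pre2 R x y -> max_ideal R x.
Proof.
case=> hL hN hx hy hg; have hR := loc_sub hL; apply/hg; exists 1, 0.
by split; [sr | split; [sr | ring]].
Qed.

(** Modulo [x] the maximal ideal is generated by [y], so a nonzero residue class is a unit times a
    power of [y]; a class divisible by all powers of [y] vanishes by Krull's intersection
    theorem. *)
Lemma mod_x R x y z : pre2 R x y -> R z ->
  divides R x z \/ exists k u c, [/\ R u, isunit R u, R c & z = u * y ^+ k + x * c].
Proof.
move=> hp hz; case: (hp) => hL hN hx hy hg; have hR := loc_sub hL.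
have hI := divides_ideal hR hx.
case: (pselect (forall n, exists2 b, R b & divides R x (z - y ^+ n * b))) => hn.
  by left; apply: (krull_inter hL hN hI (pre2_x (pre2_sym hp)) hz hn).
right; pose Q n := `[< ~ exists2 b, R b & divides R x (z - y ^+ n * b) >].
have /ex_minnP [n hQ hmin] : exists n, Q n.
  by move/existsNP: hn => [n hn]; exists n; apply/asboolP.
case: n hQ hmin => [|n] /asboolP hQ hmin.
  by case: hQ; exists z => //; exists 0; [sr | rewrite expr0; ring].
have [b hb [c hc e]] : exists2 b, R b & divides R x (z - y ^+ n * b).
  by apply: contrapT => h; have /(_ (asboolT h)) := hmin n; rewrite ltnn.
exists n, b, c; split=> //; last by rewrite [x * c]mulrC -e; ring.
case: (maxP hb) => // /hg [r [s [hr [hs eb]]]]; case: hQ; exists s => //.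
exists (c + y ^+ n * r); first by sr.
by rewrite mulrDl -e eb exprS; ring.
Qed.

(* A generator is an element of [P] of least [y]-order modulo [x]; since [x] is not in [P], every
   element of [P] is a multiple of it modulo [x P], so Krull's theorem applies. *)
Lemma prime_principal R x y P : pre2 R x y -> is_prime_ideal R P ->
  (exists2 z, P z & z != 0) -> ~ P x -> exists2 f, P f & forall z, P z -> divides R f z.
Proof.
move=> hp [hPi [hP1 hPp]] [w hw w0] hPx; case: (hp) => hL hN hx hy hg.
have hR := loc_sub hL; have hxm := pre2_x hp.
pose Q k := `[< exists u c, [/\ R u, isunit R u, R c & P (u * y ^+ k + x * c)] >].
have hex : exists k, Q k.
  apply: contrapT => hno.
  have hall z : P z -> exists2 c, P c & z = x * c.
    move=> hz; case: (mod_x hp (idR hPi hz)) => [[c hc e]|[k [u [c [h1 h2 h3 e]]]]].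
      exists c; last by rewrite mulrC.
      by move: hz; rewrite e => /(hPp _ _ hc hx) [].
    by case: hno; exists k; apply/asboolP; exists u, c; rewrite -e.
  have hall2 n : exists2 c, P c & w = x ^+ n * c.
    elim: n => [|n [c hc e]]; first by exists w => //; rewrite expr0 mul1r.
    by have [d hd e2] := hall c hc; exists d => //; rewrite e e2 exprSr mulrA.
  have : w = 0.
    apply: (krull_inter hL hN (zero_ideal hR) hxm (idR hPi hw)) => n.
    by have [c hc ->] := hall2 n; exists c; [apply: (idR hPi) | rewrite subrr].
  by move/eqP; rewrite (negbTE w0).
have [k /asboolP [u [c [hu iu hc hf]]] hmin] := ex_minnP hex.
set f := u * y ^+ k + x * c in hf; exists f => //.
have step z : P z -> exists r z', [/\ R r, P z' & z - r * f = x * z'].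
  move=> hz; case: (mod_x hp (idR hPi hz)) => [[d hd e]|[l [v [d [h1 h2 h3 e]]]]].
    exists 0, d; split; [sr | | by rewrite mul0r subr0 mulrC].
    by move: hz; rewrite e => /(hPp _ _ hd hx) [].
  have hkl : (k <= l)%N by apply: hmin; apply/asboolP; exists v, d; rewrite -e.
  pose r := v / u * y ^+ (l - k).
  have hr : R r by case: iu => _ ?; rewrite /r; sr.
  exists r, (d - r * c); split=> //; last first.
    have e3 : v * y ^+ l = r * (u * y ^+ k).
      rewrite /r -{1}(subnK hkl) exprD; field; exact: iu.1.
    by rewrite e /f e3; ring.
  have: P (x * (d - r * c)).
    have -> : x * (d - r * c) = z - r * f.
      have e3 : v * y ^+ l = r * (u * y ^+ k).
        rewrite /r -{1}(subnK hkl) exprD; field; exact: iu.1.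
      by rewrite e /f e3; ring.
    by apply: (idB hR hPi) => //; apply: (idM hPi).
  by move/(hPp _ _ hx); case=> //; sr.
move=> z hz; have hfR := idR hPi hf.
apply: (krull_inter hL hN (divides_ideal hR hfR) hxm (idR hPi hz)) => n.
have: exists2 b, P b & divides R f (z - x ^+ n * b).
  elim: n => [|n [b hb [d hd e]]].
    by exists z => //; exists 0; [sr | rewrite expr0; ring].
  have [r [z' [hr hz' e']]] := step b hb; exists z' => //.
  exists (d + x ^+ n * r); first by sr.
  have -> : z - x ^+ n.+1 * z' = (z - x ^+ n * b) + x ^+ n * (b - x * z') by rewrite exprS; ring.
  by rewrite e -e'; ring.
by case=> b hb h; exists b => //; apply: (idR hPi).
Qed.

Lemma primein_of_prime R P f : is_prime_ideal R P -> is_subring R -> P f -> f != 0 ->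
  (forall z, P z -> divides R f z) -> primein R f.
Proof.
move=> [hPi [hP1 hPp]] hR hf f0 hg; split=> //; first exact: (idR hPi).
  by move=> [_ hfi]; apply: hP1; rewrite -(mulVf f0); apply: (idM hPi).
move=> a b ha hb [c hc e].
have: P (a * b) by rewrite e; apply: (idM hPi).
by case/(hPp _ _ ha hb) => /hg; [left | right].
Qed.

Lemma primein_prime R q : is_subring R -> primein R q -> is_prime_ideal R (divides R q).
Proof.
move=> hR [hq q0 hu hp]; split; first exact: divides_ideal.
split=> // -[c hc e]; apply: hu; split=> //.
by have -> : q^-1 = c by rewrite -[c](mulfK q0) -e mul1r.
Qed.

Lemma primein_exp R q a n : is_subring R -> primein R q -> R a -> divides R q (a ^+ n) -> divides R q a.
Proof. by move=> hR hq ha; apply: (id_exp (primein_prime hR hq)). Qed.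

Lemma primein_max R q : primein R q -> max_ideal R q.
Proof. by case=> hq q0 hu _; split. Qed.

(** Since [f] does not divide [w], it divides the cofactor [a], and factors [f] can be cancelled
    until the nonunit [w] divides 1. This replaces unique factorisation before that is available. *)
Lemma primein_nopow R f w k a : is_subring R -> primein R f -> R w -> ~ divides R f w -> ~ isunit R w ->
  R a -> f ^+ k <> w * a.
Proof.
move=> hR [hf f0 hu hp] hw hfw hwu; elim: k a => [|k IH] a ha e.
  apply: hwu; have w0 : w != 0.
    by apply/eqP => w0; move/eqP: e; rewrite expr0 w0 mul0r oner_eq0.
  split=> //; have -> // : w^-1 = a.
  by apply: (mulfI w0); rewrite -e mulfV.
have [//|[c hc ec]] : divides R f w \/ divides R f a.
  by apply: hp => //; exists (f ^+ k); [sr | rewrite -exprSr].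
apply: (IH c) => //; apply: (mulIf f0); by rewrite -exprSr e ec mulrA.
Qed.

Lemma pow_mod_x R x r s y k : is_subring R -> R x -> R r -> R s -> R y ->
  exists2 a, R a & (r * x + s * y) ^+ k = x * a + s ^+ k * y ^+ k.
Proof.
move=> hR hx hr hs hy; elim: k => [|k [a ha e]].
  by exists 0; [sr | rewrite !expr0; ring].
exists (r * (x * a + s ^+ k * y ^+ k) + s * y * a); first by sr.
by rewrite !exprS e; ring.
Qed.

(** The prime [f] forces the dimension to be 2. If [x] divided [y^k], then [f^k], expanded in terms
    of [x] and [y], would be a multiple of [x], against [primein_nopow]. So no power of [y] vanishes
    modulo [x], and by [mod_x] the residue ring at [x] is a domain. *)
Lemma pre2_rlr R x y f : pre2 R x y -> primein R f -> ~ divides R f x -> rlr R x y.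
Proof.
move=> hp hf hfx; case: (hp) => hL hN hx hy hg; have hR := loc_sub hL.
have hyk k : ~ divides R x (y ^+ k).
  move=> [c hc e]; have /hg [r [s [hr [hs ef]]]] := primein_max hf.
  have [a ha ea] := pow_mod_x k hR hx hr hs hy.
  apply: (@primein_nopow R f x k (a + s ^+ k * c)) => //; last by rewrite ef ea e; ring.
    by have [] := pre2_x hp.
  by sr.
have x0 : x != 0 by apply/eqP => x0; apply: hfx; rewrite x0; exists 0; [sr | rewrite mul0r].
split=> //; last by rewrite -[y]expr1.
split=> //; first by have [] := pre2_x hp.
move=> a b ha hb hab; apply: contrapT => /not_orP [hna hnb].
case: (mod_x hp ha) => // -[k [u [c [hu iu hc ea]]]].
case: (mod_x hp hb) => // -[l [v [d [hv iv hd eb]]]].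
apply: (hyk (k + l)%N); case: hab => g hgR eg.
have [uv0 huv] := isunitM hR iu iv.
exists ((g - (u * y ^+ k * d + c * v * y ^+ l + x * c * d)) / (u * v)); first by sr.
have e2 : (g - (u * y ^+ k * d + c * v * y ^+ l + x * c * d)) * x = u * v * y ^+ (k + l).
  by rewrite mulrBl -eg ea eb exprD; ring.
by rewrite mulrAC e2 mulrAC mulfV // mul1r.
Qed.

Lemma rlr_sym R x y : rlr R x y -> rlr R y x.
Proof. by case=> hp hx hxy; apply: (pre2_rlr (pre2_sym hp) hx hxy). Qed.

(** The middle prime of a chain of length 2 is nonzero and misses one of the two parameters, hence
    is principal; its generator is a prime element that does not divide that parameter. The order of
    the parameters depends on which one is missed. *)
Lemma rlr_of_reg R : is_regular_local_2 R -> exists x y, rlr R x y.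
Proof.
move=> [hL [hN [[[P [hP hinc]] _] [x [y [hx [hy hg]]]]]]].
have hp : pre2 R x y by split.
have hR := loc_sub hL.
have [hi [z [hz hnz]]] := hinc 0%N isT; have [hi2 [w [hw hnw]]] := hinc 1%N isT.
have [hP1 hP2] := (hP 1%N isT, hP 2%N isT).
have hz0 : exists2 z, P 1%N z & z != 0.
  exists z => //; apply/eqP => z0; apply: hnz; rewrite z0; apply: (id0 (hP 0%N isT).1).
have hwm : max_ideal R w.
  split; first exact: (idR hP2.1).
  move=> [w0 hwi]; apply: hP2.2.1; rewrite -(mulVf w0); exact: (idM hP2.1).
case: (pselect (P 1%N x)) => hx1; last first.
  have [f hf hgen] := prime_principal hp hP1 hz0 hx1.
  exists x, y; apply: (pre2_rlr hp (f := f)).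
    apply: (primein_of_prime hP1) => //; apply/eqP => f0.
    by case: hz0 => z' /hgen [c _ ->]; rewrite f0 mulr0 eqxx.
  by move=> [c hc e]; apply: hx1; rewrite e; apply: (idM hP1.1).
have hy1 : ~ P 1%N y.
  move=> hy1; apply: hnw; have /hg [r [s [hr [hs ->]]]] := hwm.
  by apply: (idD hP1.1); apply: (idM hP1.1).
have [f hf hgen] := prime_principal (pre2_sym hp) hP1 hz0 hy1.
exists y, x; apply: (pre2_rlr (pre2_sym hp) (f := f)).
  apply: (primein_of_prime hP1) => //; apply/eqP => f0.
  by case: hz0 => z' /hgen [c _ ->]; rewrite f0 mulr0 eqxx.
by move=> [c hc e]; apply: hy1; rewrite e; apply: (idM hP1.1).
Qed.

Lemma rlr_principal R x y P : rlr R x y -> is_prime_ideal R P ->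
  (exists2 z, P z & z != 0) -> ~ (P x /\ P y) ->
  exists2 q, primein R q & forall z, P z <-> divides R q z.
Proof.
move=> [hp _ _] hP hz hxy; case: (hp) => hL _ _ _ _; have hR := loc_sub hL.
have [f hf hgen] : exists2 f, P f & forall z, P z -> divides R f z.
  case: (pselect (P x)) => hx; last exact: (prime_principal hp hP hz hx).
  apply: (prime_principal (pre2_sym hp) hP hz) => hy; by apply: hxy.
exists f; last first.
  by move=> z; split=> [/hgen //|[c hc ->]]; apply: (idM hP.1).
apply: (primein_of_prime hP) => //; apply/eqP => f0.
by case: hz => z' /hgen [c _ ->]; rewrite f0 mulr0 eqxx.
Qed.

(** The chain is [0], [xR], the maximal ideal. A longer one would contain two consecutive nonzero
    nonmaximal primes; both are generated by prime elements, one dividing the other, and so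
    coincide. *)
Lemma reg_of_rlr R x y : rlr R x y -> is_regular_local_2 R.
Proof.
move=> h; case: (h) => hp hx hxy; case: (hp) => hL hN hxR hyR hg; have hR := loc_sub hL.
split=> //; split=> //; split; last by exists x, y.
have hM := max_prime hL.
split.
  exists (fun n => match n with 0%N => fun z => z = 0 | 1%N => divides R x | _ => max_ideal R end); split.
    case=> [|[|[|//]]] _ //; last exact: primein_prime.
    split; first exact: zero_ideal.
    split; first by apply/eqP; rewrite oner_eq0.
    by move=> a b _ _ /eqP; rewrite mulf_eq0 => /orP [] /eqP; [left | right].
  case=> [|[|//]] _.
    split; first by move=> z ->; exists 0; [sr | rewrite mul0r].
    by exists x; split; [apply: divides_refl | apply/eqP; case: hx].
  split; first by move=> z [c hc ->]; apply: (idM hM.1) => //; apply: pre2_x hp.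
  by exists y; split=> //; apply: pre2_x (pre2_sym hp).
move=> [P [hP hinc]].
have [hi [z [hz hnz]]] := hinc 0%N isT; have [hi2 [w [hw hnw]]] := hinc 1%N isT.
have [hi3 [v [hv hnv]]] := hinc 2%N isT.
have [hP1 hP2 hP3] := And3 (hP 1%N isT) (hP 2%N isT) (hP 3%N isT).
have hvm : max_ideal R v.
  split; first exact: (idR hP3.1).
  move=> [w0 hwi]; apply: hP3.2.1; rewrite -(mulVf w0); exact: (idM hP3.1).
have n2 : ~ (P 2%N x /\ P 2%N y).
  move=> [h1 h2]; apply: hnv; have /hg [r [s [hr [hs ->]]]] := hvm.
  by apply: (idD hP2.1); apply: (idM hP2.1).
have z0 : z != 0 by apply/eqP => z0; apply: hnz; rewrite z0; apply: (id0 (hP 0%N isT).1).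
have [|f hf hf'] := rlr_principal h hP1 _ (fun e => n2 (conj (hi2 _ e.1) (hi2 _ e.2))).
  by exists z.
have [|g hgp hg'] := rlr_principal h hP2 _ n2; first by exists z => //; apply: hi2.
have [c hc e] : divides R g f by apply/hg'/hi2/hf'/divides_refl.
case: (hf) => hfR f0 hfu hfp; case: (hgp) => hgR g0 hgu _.
case: (hfp c g hc hgR); first by rewrite -e; apply: divides_refl.
  move=> [d hd ed]; apply: hgu; split=> //.
  have -> // : g^-1 = d.
  apply: (mulIf f0); apply: (mulfI g0); rewrite mulVKf //.
  by rewrite {1}e ed mulrC.
move=> /hf' h1; apply: hnw; move/hg': hw => [d hd ->]; exact: (idM hP1.1).
Qed.

(** Noetherian induction on principal ideals: passing to a proper divisor of [a] strictly enlarges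
    [aR]. The factorisation arguments below are inductions of this kind. *)
Lemma div_ind R (Q : F -> Prop) : is_subring R -> noetherian_ring R ->
  (forall a, R a -> a != 0 -> (forall b q, R b -> R q -> ~ isunit R q -> a = q * b -> Q b) -> Q a) ->
  forall a, R a -> a != 0 -> Q a.
Proof.
move=> hR hN H a ha a0; apply: contrapT => hQ.
have [||I [[b [hb b0 hQb eI]] hmax]] := @noeth_max _ R
  (fun I => exists a, [/\ R a, a != 0, ~ Q a & I = divides R a]) hN.
- by move=> I [b [hb _ _ ->]]; apply: divides_ideal.
- by exists (divides R a), a.
apply: hQb; apply: H => // c q hc hq hqu e; apply: contrapT => hQc.
have c0 : c != 0 by apply: contraNneq b0 => c0; rewrite e c0 mulr0.
have : I c.
  apply: (hmax (divides R c)); last exact: divides_refl.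
    by exists c.
  by rewrite eI => z [d hd ->]; exists (d * q); [sr | rewrite e mulrA].
rewrite eI => [[d hd ed]]; apply: hqu.
have e1 : d * q = 1 by apply: (mulIf c0); rewrite -mulrA -e -ed mul1r.
have q0 : q != 0 by apply/eqP => q0; move/eqP: e1; rewrite q0 mulr0 eq_sym oner_eq0.
split=> //; have -> // : q^-1 = d by rewrite -[d](mulfK q0) e1 mul1r.
Qed.
End RegularLocal.

(** * Factoriality and discrete valuations *)

Section Factorial.
Variable F : fieldType.
Implicit Types (R I J P V S : F -> Prop) (x y z a b c q : F).

Lemma rlr_loc R x y : rlr R x y -> is_local_ring R. Proof. by case=> [[]]. Qed.
Lemma rlr_sub R x y : rlr R x y -> is_subring R. Proof. by move/rlr_loc/loc_sub. Qed.
Lemma rlr_noeth R x y : rlr R x y -> noetherian_ring R. Proof. by case=> [[]]. Qed.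
Lemma rlr_gen R x y : rlr R x y -> genby R x y. Proof. by case=> [[]]. Qed.
Lemma rlr_x R x y : rlr R x y -> R x. Proof. by case=> [[]]. Qed.
Lemma rlr_mx R x y : rlr R x y -> max_ideal R x. Proof. by case=> /pre2_x. Qed.
Lemma rlr_primein R x y : rlr R x y -> primein R x. Proof. by case. Qed.
Lemma rlr_x0 R x y : rlr R x y -> x != 0. Proof. by move/rlr_primein => []. Qed.

(** A prime ideal that contains [a] and misses a parameter is principal, and its generator divides
    [a]. If instead [a] divides a power of [x], the prime [x] itself divides [a]. *)
Lemma prime_divisor R x y a : rlr R x y -> R a -> a != 0 -> ~ isunit R a ->
  exists2 q, primein R q & divides R q a.
Proof.
move=> h ha a0 hau; have hR := rlr_sub h; have hN := rlr_noeth h.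
have hI := divides_ideal hR ha.
have key w : R w -> (w = x \/ w = y) -> (forall n, ~ divides R a (w ^+ n)) ->
    exists2 q, primein R q & divides R q a.
  move=> hw hwxy hn; have [P [hP hIP hPw]] := prime_avoiding hR hN hI hw hn.
  have haP : P a by apply/hIP/divides_refl.
  have [|| q hq hq'] := rlr_principal h hP; first by exists a.
    by move=> [h1 h2]; case: hwxy => e; apply: hPw; rewrite e.
  by exists q => //; apply/hq'.
have hs := rlr_sym h.
case: (pselect (forall n, ~ divides R a (x ^+ n))) => [|/existsNP [n /contrapT [b hb e]]].
  by apply: key; [apply: rlr_x h | left].
case: (pselect (forall n, ~ divides R a (y ^+ n))) => [|/existsNP [m /contrapT [c hc e']]].
  by apply: key; [apply: rlr_x hs | right].
exists x; first exact: rlr_primein h.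
apply: contrapT => hxa.
by apply: (@primein_nopow _ R x a n b) => //; [apply: rlr_primein h | rewrite e mulrC].
Qed.

Definition coprimein R a b := forall q, primein R q -> divides R q a -> divides R q b -> False.

Lemma coprime_rep R x y a b : rlr R x y -> R a -> R b -> a != 0 ->
  exists d a' b', [/\ [/\ R d, R a' & R b'], a = d * a', b = d * b' & coprimein R a' b'].
Proof.
move=> h ha hb a0; have hR := rlr_sub h; move: a ha a0 b hb.
apply: (div_ind hR (rlr_noeth h)) => a ha a0 IH b hb.
case: (pselect (coprimein R a b)) => hc.
  by exists 1, a, b; split; rewrite ?mul1r //; split=> //; sr.
have [q [hq [a1 ha1 ea] [b1 hb1 eb]]] : exists q, [/\ primein R q, divides R q a & divides R q b].
  by apply: contrapT => hn; apply: hc => q h1 h2 h3; apply: hn; exists q.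
case: (hq) => hqR q0 hqu _.
have [|d [a' [b' [[h1 h2 h3] e1 e2 h4]]]] := IH a1 q ha1 hqR hqu _ b1 hb1.
  by rewrite mulrC.
exists (d * q), a', b'; split=> //; first by split=> //; sr.
  by rewrite ea e1 mulrAC.
by rewrite eb e2 mulrAC.
Qed.

Lemma coprime_divides R x y a b c : rlr R x y -> R a -> R b -> R c -> a != 0 -> coprimein R a b ->
  divides R a (c * b) -> divides R a c.
Proof.
move=> h ha hb hc a0; have hR := rlr_sub h; move: a ha a0 c hc.
apply: (div_ind hR (rlr_noeth h)) => a ha a0 IH c hc hcop hd.
case: (pselect (isunit R a)) => hau; first exact: isunit_divides.
have [q hq [a1 ha1 ea]] := prime_divisor h ha a0 hau.
case: (hq) => hqR q0 hqu hqp; case: hd => e he ee.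
case: (hqp c b hc hb); first by exists (e * a1); [sr | rewrite ee ea; ring].
  move=> [c1 hc1 ec].
  have [|||d hd ed] := IH a1 q ha1 hqR hqu _ c1 hc1; first by rewrite mulrC.
  - by move=> p hp [g hg' eg] h2; apply: (hcop p) => //; exists (g * q); [sr | rewrite ea eg mulrAC].
  - exists e => //; apply: (mulIf q0); by rewrite mulrAC -ec ee ea mulrA.
  by exists d => //; rewrite ec ea ed mulrA.
by move=> hqb; case: (hcop q hq) => //; exists a1.
Qed.

(** A nonmaximal prime above [(f, g)] would be generated by a common prime factor. So the maximal
    ideal is the only prime above [(f, g)], and its elements are nilpotent modulo [(f, g)]. *)
Lemma coprime_pow R x y f g z : rlr R x y -> R f -> R g -> f != 0 -> coprimein R f g ->
  max_ideal R z -> exists N r s, [/\ R r, R s & z ^+ N = r * f + s * g].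
Proof.
move=> h hf hg f0 hc hz; have hR := rlr_sub h.
have hI : is_ideal R (idealadd R (divides R f) g) by apply: idealadd_ideal => //; apply: divides_ideal.
apply: contrapT => hn.
have [|P [hP hIP hPz]] := prime_avoiding hR (rlr_noeth h) hI (idR (loc_id (rlr_loc h)) hz).
  by move=> n [i [r hr ->] [s hs e]]; apply: hn; exists n, r, s.
have hPf : P f by apply/hIP/idealadd_l => //; apply: divides_refl.
have hPg : P g by apply/hIP/idealadd_r => //; apply: divides_ideal.
have [|| q hq hq'] := rlr_principal h hP; first by exists f.
  move=> [h1 h2]; apply: hPz; have /(rlr_gen h) [r [s [hr [hs ->]]]] := hz.
  by apply: (idD hP.1); apply: (idM hP.1).
by apply: (hc q) => //; apply/hq'.
Qed.

Lemma rlr_normal R x y : rlr R x y -> is_normal R.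
Proof.
move=> h z [a [b [ha [hb [b0 ez]]]]] [p [pm [pR pz]]]; have hR := rlr_sub h.
have [d [b' [a' [[hd hb' ha'] eb ea hc]]]] := coprime_rep h hb ha b0.
have d0 : d != 0 by apply: contraNneq b0 => d0; rewrite eb d0 mul0r.
have b'0 : b' != 0 by apply: contraNneq b0 => d1; rewrite eb d1 mulr0.
have {ez} ez : z = a' / b' by rewrite ez ea eb -mulf_div mulfV ?mul1r.
case: (pselect (isunit R b')) => [[_ hi]|hu]; first by rewrite ez; sr.
have [q hq hqb] := prime_divisor h hb' b'0 hu.
exfalso; apply: (hc q) => //.
set n := (size p).-1.
apply: (@primein_exp _ R q a' n hR hq ha').
have: p.[z] * b' ^+ n = 0 by move/rootP: pz => ->; rewrite mul0r.
have sp : size p = n.+1.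
  by rewrite /n prednK // lt0n size_poly_eq0 monic_neq0.
rewrite horner_coef sp big_ord_recr /= mulrDl.
have -> : p`_n = 1 by move/monicP: pm; rewrite /lead_coef.
rewrite mul1r ez -exprMn divfK // => /eqP; rewrite addrC addr_eq0 => /eqP ->.
have hI := divides_ideal hR (let: And4 a _ _ _ := hq in a).
apply: (idN hR hI); rewrite big_distrl /=; apply: (id_sum hI) => i _.
have -> : p`_i * (a' / b') ^+ i * b' ^+ n = (p`_i * a' ^+ i * b' ^+ (n - i).-1) * b'.
  have hi := ltn_ord i.
  have -> : b' ^+ n = b' ^+ (n - i).-1 * b' * b' ^+ i.
    by rewrite -exprSr prednK ?subn_gt0 // -exprD subnK // ltnW.
  by rewrite expr_div_n; field; rewrite expf_neq0.
by apply: (idM hI) => //; move: (pR i) => ?; sr.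
Qed.

(** * Localisation at a prime element, discrete valuation rings and centers *)

Definition locp R q : F -> Prop := fun z => exists a b, [/\ R a, R b, ~ divides R q b & z = a / b].

Lemma ndv_neq0 R q b : is_subring R -> ~ divides R q b -> b != 0.
Proof. by move=> hR h; apply/eqP => b0; apply: h; rewrite b0; exists 0; [sr | rewrite mul0r]. Qed.

Lemma locp_incl R q : is_subring R -> primein R q -> incl R (locp R q).
Proof.
move=> hR hq z hz; exists z, 1; split=> //; [sr | | by rewrite divr1].
by have [_ []] := primein_prime hR hq.
Qed.

Lemma locp_subring R q : is_subring R -> primein R q -> is_subring (locp R q).
Proof.
move=> hR hq; have hi := locp_incl hR hq; case: (hq) => _ _ _ hp.
split; first by apply: hi; sr.
split; first by apply: hi; sr.
have hnd b d : R b -> R d -> ~ divides R q b -> ~ divides R q d -> ~ divides R q (b * d).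
  by move=> hb hd n1 n2 /(hp _ _ hb hd) [].
split=> z w [a [b [ha hb nb ->]]] [c [d [hc hd nd ->]]].
  exists (a * d - c * b), (b * d); split; [sr | sr | exact: hnd |].
  have b0 := ndv_neq0 hR nb; have d0 := ndv_neq0 hR nd.
  by field; rewrite b0 d0.
exists (a * c), (b * d); split; [sr | sr | exact: hnd |].
have b0 := ndv_neq0 hR nb; have d0 := ndv_neq0 hR nd.
by field; rewrite b0 d0.
Qed.

(** A discrete valuation ring with uniformiser [p], without a valuation map: the exponent is a
    natural number and the final disjunction gives its sign. *)
Definition dvr V p := [/\ is_subring V, V p, p != 0, ~ V p^-1 &
  forall z, z != 0 -> exists u n, [/\ V u, isunit V u & z = u * p ^+ n \/ z = u / p ^+ n]].

Lemma dvr_sub V p : dvr V p -> is_subring V. Proof. by case. Qed.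

Lemma dvr_val V p z : dvr V p -> z != 0 -> V z \/ V z^-1.
Proof.
case=> hV hp p0 _ h /h [u [n [hu [u0 hui] [->|->]]]]; [left; sr | right].
by rewrite invfM invrK; sr.
Qed.

Lemma dvr_maxP V p z : dvr V p -> max_ideal V z <-> divides V p z.
Proof.
case=> hV hp p0 hpi h; split.
  move=> [hz hn]; case: (eqVneq z 0) => [->|z0]; first by exists 0; [sr | rewrite mul0r].
  have [u [n [hu [u0 hui] e]]] := h z z0.
  case: n e => [|n] e.
    case: hn; split=> //; by case: e => ->; rewrite expr0 ?mulr1 ?divr1.
  case: e => e; first by exists (u * p ^+ n); [sr | rewrite e exprSr mulrA].
  case: hpi; have -> : p^-1 = z * u^-1 * p ^+ n.
    by rewrite e exprS; field; rewrite p0 u0 expf_neq0.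
  sr.
move=> [c hc ->]; split; first by sr.
move=> [n0 hi]; apply: hpi; move: n0; rewrite mulf_eq0 => /norP [c0 _].
have -> : p^-1 = c * (c * p)^-1 by rewrite invfM mulrA mulfV ?mul1r.
sr.
Qed.

Lemma dvr_loc V p : dvr V p -> is_local_ring V.
Proof.
move=> h; have hV := dvr_sub h; apply: local_of_sum => // x y /(dvr_maxP _ h) hx /(dvr_maxP _ h) hy.
by apply/(dvr_maxP _ h); apply: (idD (divides_ideal hV _)) => //; case: h.
Qed.

(** A discrete valuation ring is a maximal proper subring of its field: any element of negative
    value yields the inverse of the uniformiser. *)
Lemma dvr_over V p S : dvr V p -> is_subring S -> incl V S -> ~ S p^-1 -> incl S V.
Proof.
move=> hd hS hVS hn z hz; case: (eqVneq z 0) => [->|z0]; first by have hV := dvr_sub hd; sr.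
case: (hd) => hV hp p0 _ /(_ z z0) [u [n [hu [u0 hui] [->|e]]]]; first by sr.
case: n e => [|n] e; first by rewrite e expr0 divr1.
case: hn; have -> : p^-1 = z * u^-1 * p ^+ n.
  by rewrite e exprS; field; rewrite p0 u0 expf_neq0.
have := hVS _ hui; have := hVS _ hp => ? ?; sr.
Qed.

Lemma incl_eq (A B : F -> Prop) : incl A B -> incl B A -> A = B.
Proof. by move=> h1 h2; apply/funext => z; apply/propext; split; [apply: h1 | apply: h2]. Qed.

Lemma primein_split R q a : is_subring R -> noetherian_ring R -> primein R q -> R a -> a != 0 ->
  exists n a', [/\ R a', ~ divides R q a' & a = a' * q ^+ n].
Proof.
move=> hR hN hq; move: a; apply: (div_ind hR hN) => a ha a0 IH.
case: (pselect (divides R q a)) => [[b hb e]|hd]; last first.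
  by exists 0%N, a; split=> //; rewrite expr0 mulr1.
case: (hq) => hqR q0 hqu _.
have [|n [a' [h1 h2 h3]]] := IH b q hb hqR hqu; first by rewrite mulrC.
by exists n.+1, a'; split=> //; rewrite e h3 exprSr mulrA.
Qed.

Lemma locp_isunit R q b : R 1 -> ~ divides R q b -> R b -> b != 0 -> isunit (locp R q) b.
Proof. by move=> h1 hb hbR b0; split=> //; exists 1, b; split=> //; rewrite mul1r. Qed.

Lemma locp_dvr R q : is_subring R -> noetherian_ring R -> quotient_field_of R -> primein R q ->
  dvr (locp R q) q.
Proof.
move=> hR hN hF hq; have hV := locp_subring hR hq; have hi := locp_incl hR hq.
case: (hq) => hqR q0 hqu hqp; split=> //; first exact: hi.
  move=> [a [b [ha hb hnb e]]]; apply: hnb; exists a => //.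
  have b0 : b != 0 by apply/eqP => b0; move: e; rewrite b0 invr0 mulr0 => /eqP; rewrite invr_eq0 (negbTE q0).
  by apply: (mulIf (invr_neq0 b0)); rewrite mulfV // mulrAC -e mulVf.
move=> z z0; have [a [b [ha [hb [b0 e]]]]] := hF z.
have a0 : a != 0 by apply: contraNneq z0 => a0; rewrite e a0 mul0r.
have [n [a' [ha' na ea]]] := primein_split hR hN hq ha a0.
have [m [b' [hb' nb eb]]] := primein_split hR hN hq hb b0.
have a'0 := ndv_neq0 hR na; have b'0 := ndv_neq0 hR nb.
have hu : locp R q (a' / b') by exists a', b'.
have iu : isunit (locp R q) (a' / b').
  by split; [rewrite mulf_neq0 ?invr_neq0 | exists b', a'; split=> //; rewrite invf_div].
have qn k : q ^+ k != 0 by rewrite expf_neq0.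
case: (leqP m n) => hmn.
  exists (a' / b'), (n - m)%N; split=> //; left.
  rewrite e ea eb -{1}(subnK hmn) exprD; field; by rewrite b'0 qn.
exists (a' / b'), (m - n)%N; split=> //; right.
rewrite e ea eb -{1}(subnK (ltnW hmn)) exprD; field; by rewrite b'0 !qn.
Qed.

Lemma locp_max R q a : is_subring R -> primein R q -> R a -> max_ideal (locp R q) a <-> divides R q a.
Proof.
move=> hR hq ha; have hi := locp_incl hR hq; split.
  move=> [_ hn]; apply: contrapT => hd; apply: hn; have a0 := ndv_neq0 hR hd.
  by apply: locp_isunit => //; sr.
move=> hd; split; first exact: hi.
move=> [a0 [c [d [hc hdd hnd e]]]]; apply: hnd; case: hd => g hg eg.
have d0 : d != 0 by apply/eqP => d0; move: e; rewrite d0 invr0 mulr0 => /eqP; rewrite invr_eq0 (negbTE a0).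
exists (c * g); first by sr.
rewrite -mulrA -eg; apply: (mulIf (invr_neq0 d0)); by rewrite mulfV // mulrAC -e mulVf.
Qed.

Lemma locp_inter R x y z : rlr R x y -> quotient_field_of R ->
  (forall q, primein R q -> locp R q z) -> R z.
Proof.
move=> h hF hall; have hR := rlr_sub h.
have [a [b [ha [hb [b0 e]]]]] := hF z.
have [d [b' [a' [[hd hb' ha'] eb ea hc]]]] := coprime_rep h hb ha b0.
have d0 : d != 0 by apply: contraNneq b0 => d0; rewrite eb d0 mul0r.
have b'0 : b' != 0 by apply: contraNneq b0 => d1; rewrite eb d1 mulr0.
have {e} e : z = a' / b' by rewrite e ea eb -mulf_div mulfV ?mul1r.
case: (pselect (isunit R b')) => [[_ hi]|hu]; first by rewrite e; sr.
have [q hq hqb] := prime_divisor h hb' b'0 hu.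
exfalso; apply: (hc q) => //.
have [c [g [hcR hgR hng e2]]] := hall q hq; have g0 := ndv_neq0 hR hng.
case: (hq) => _ _ _ hqp; case: (hqp a' g ha' hgR) => //.
have -> : a' * g = c * b'.
  have: z * (b' * g) = a' * g by rewrite e mulrA divfK.
  by rewrite e2 => <-; rewrite [b' * g]mulrC mulrA divfK.
by apply: (idM (divides_ideal hR _)) => //; case: hq.
Qed.

Lemma val_not_rlr R x y : rlr R x y -> (forall z, z != 0 -> R z \/ R z^-1) -> False.
Proof.
move=> h hv; have hs := rlr_sym h; have x0 := rlr_x0 h; have y0 := rlr_x0 hs.
case: (hv (y / x)); first by rewrite mulf_neq0 ?invr_neq0.
  by move=> hh; case: h => _ _; apply; exists (y / x) => //; rewrite divfK.
by rewrite invf_div => hh; case: hs => _ _; apply; exists (x / y) => //; rewrite divfK.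
Qed.

Lemma center_prime R S : is_subring R -> is_local_ring S -> incl R S ->
  is_prime_ideal R (fun z => R z /\ max_ideal S z).
Proof.
move=> hR hL hi; have hm := loc_id hL; have hS := loc_sub hL; split.
  split; first by move=> z [].
  split; first by split; [sr | apply: (id0 hm)].
  split; first by move=> a b [? ?] [? ?]; split; [sr | apply: (idD hm)].
  by move=> r a hr [? ?]; split; [sr | apply: (idM hm) => //; apply: hi].
split; first by case=> _; apply: max1.
by move=> a b ha hb [_ /((max_prime hL).2.2 _ _ (hi _ ha) (hi _ hb))] [] ?; [left | right].
Qed.

Lemma frac_incl R S : quotient_field_of R -> incl R S -> quotient_field_of S.
Proof.
move=> hF hi z; have [a [b [ha [hb h]]]] := hF z; exists a, b.
by split; [exact: hi | split; [exact: hi |]].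
Qed.

(** The center of [S] on [R] is a prime ideal, nonzero because it contains the numerator of [w], and
    not the maximal ideal; hence it is principal, and elements of [R] outside it are units of
    [S]. *)
Lemma center_locp R x y S : rlr R x y -> quotient_field_of R -> is_local_ring S -> incl R S ->
  (exists2 w, w != 0 & max_ideal S w) -> ~ (max_ideal S x /\ max_ideal S y) ->
  exists2 q, primein R q & max_ideal S q /\ incl (locp R q) S.
Proof.
move=> h hF hL hi [w w0 hw] hxy; have hR := rlr_sub h; have hS := loc_sub hL.
have hP := center_prime hR hL hi.
have [|| q hq hq'] := rlr_principal h hP.
- have [a [b [ha [hb [b0 e]]]]] := hF w.
  have a0 : a != 0 by apply: contraNneq w0 => a0; rewrite e a0 mul0r.
  exists a => //; split=> //; have -> : a = b * w by rewrite e mulrCA mulfV ?mulr1.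
  by apply: (idM (loc_id hL)) => //; apply: hi.
- by move=> [[_ ?] [_ ?]]; apply: hxy.
exists q => //; split; first by have /hq' [] := divides_refl q hR.
move=> z [a [b [ha hb hnb ->]]]; apply: (srM hS); first exact: hi.
case: (maxP (hi _ hb)) => [hm|[_ //]].
by case: hnb; apply/hq'.
Qed.

(** Otherwise [S] would contain a discrete valuation ring of the field and be a valuation ring
    itself, which [val_not_rlr] excludes. *)
Lemma rlr_dominated R x y S u v : rlr R x y -> quotient_field_of R -> rlr S u v -> incl R S ->
  max_ideal S x /\ max_ideal S y.
Proof.
move=> h hF hS hi; apply: contrapT => hn.
have [|q hq [hqm hqS]] := center_locp h hF (rlr_loc hS) hi _ hn.
  by exists u; [apply: rlr_x0 hS | apply: rlr_mx hS].
have hd := locp_dvr (rlr_sub h) (rlr_noeth h) hF hq.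
by apply: (val_not_rlr hS) => z z0; case: (dvr_val hd z0) => /hqS; [left | right].
Qed.

Lemma dominated_max R x y S : rlr R x y -> is_local_ring S -> incl R S ->
  max_ideal S x /\ max_ideal S y -> forall z, max_ideal R z -> max_ideal S z.
Proof.
move=> h hL hi [hx hy] z /(rlr_gen h) [r [s [hr [hs ->]]]].
by apply: (idD (loc_id hL)); apply: (idM (loc_id hL)) => //; apply: hi.
Qed.

Lemma locp_center R x y V p : rlr R x y -> quotient_field_of R -> dvr V p -> incl R V ->
  ~ (max_ideal V x /\ max_ideal V y) -> exists2 q, primein R q & V = locp R q.
Proof.
move=> h hF hd hi hn; have hL := dvr_loc hd.
have [|q hq [hqm hqV]] := center_locp h hF hL hi _ hn.
  by exists p; [case: hd | apply/(dvr_maxP _ hd); apply: divides_refl; apply: dvr_sub hd].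
exists q => //; apply: incl_eq => //.
apply: (dvr_over (locp_dvr (rlr_sub h) (rlr_noeth h) hF hq) (dvr_sub hd) hqV) => hqi.
by case: hqm => _; apply; split=> //; case: hq.
Qed.
End Factorial.

(** * Polynomials over a local ring *)

Section Polynomials.
Variable F : fieldType.
Implicit Types (R I J P V S B : F -> Prop) (x y z a b c q t : F) (f g h : {poly F}).

Definition polyover R f := forall i, R f`_i.
Definition inmax R f := forall i, max_ideal R f`_i.
Definition adjoin R t : F -> Prop := fun z => exists2 f, polyover R f & z = f.[t].

Lemma polyoverC R c : is_subring R -> R c -> polyover R c%:P.
Proof. by move=> hR hc i; rewrite coefC; case: eqP => _; sr. Qed.
Lemma polyoverX R : is_subring R -> polyover R 'X.
Proof. by move=> hR i; rewrite coefX; case: eqP => _ /=; rewrite ?mulr1n ?mulr0n; sr. Qed.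
Lemma polyoverD R f g : is_subring R -> polyover R f -> polyover R g -> polyover R (f + g).
Proof. by move=> hR hf hg i; rewrite coefD; apply: (srD hR). Qed.
Lemma polyoverB R f g : is_subring R -> polyover R f -> polyover R g -> polyover R (f - g).
Proof. by move=> hR hf hg i; rewrite coefB; apply: (srB hR). Qed.
Lemma polyoverM R f g : is_subring R -> polyover R f -> polyover R g -> polyover R (f * g).
Proof. by move=> hR hf hg i; rewrite coefM; apply: (sr_sum hR) => j _; apply: (srM hR). Qed.
Lemma polyoverXn R n : is_subring R -> polyover R 'X^n.
Proof. by move=> hR i; rewrite coefXn; case: eqP => _ /=; rewrite ?mulr1n ?mulr0n; sr. Qed.
Lemma polyoverS R S f : incl R S -> polyover R f -> polyover S f.
Proof. by move=> h hf i; apply: h. Qed.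
Lemma polyover_horner R f t : is_subring R -> polyover R f -> R t -> R f.[t].
Proof.
move=> hR hf ht; rewrite horner_coef; apply: (sr_sum hR) => i _.
by move: (hf i) => ?; sr.
Qed.

Lemma adjoin_subring R t : is_subring R -> is_subring (adjoin R t).
Proof.
move=> hR; split; first by exists 0%:P; [apply: polyoverC => //; sr | rewrite hornerC].
split; first by exists 1%:P; [apply: polyoverC => //; sr | rewrite hornerC].
split=> u v [f hf ->] [g hg ->].
  by exists (f - g); [apply: polyoverB | rewrite hornerD hornerN].
by exists (f * g); [apply: polyoverM | rewrite hornerM].
Qed.
Lemma adjoin_incl R t : is_subring R -> incl R (adjoin R t).
Proof. by move=> hR z hz; exists z%:P; [apply: polyoverC | rewrite hornerC]. Qed.
Lemma adjoin_t R t : is_subring R -> adjoin R t t.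
Proof. by move=> hR; exists 'X; [apply: polyoverX | rewrite hornerX]. Qed.
Lemma adjoin_min R t S : is_subring S -> incl R S -> S t -> incl (adjoin R t) S.
Proof. by move=> hS hi ht z [f hf ->]; apply: polyover_horner => //; apply: polyoverS hf. Qed.

Lemma not_inmaxP R f : polyover R f -> ~ inmax R f -> exists i, isunit R f`_i.
Proof. by move=> hf /existsNP [i hi]; exists i; case: (maxP (hf i)). Qed.
Lemma isunit_nallm R f i : isunit R f`_i -> ~ inmax R f.
Proof. by move=> h1 h2; case: (h2 i). Qed.

(** All other terms of the convolution lie in the maximal ideal. It is applied to the lowest and to
    the highest unit coefficients. *)
Lemma coefM_unit R f g i j : is_local_ring R -> polyover R f -> polyover R g ->
  isunit R f`_i -> isunit R g`_j ->
  (forall k, (k <= i + j)%N -> k != i -> max_ideal R (f`_k) \/ max_ideal R (g`_(i + j - k))) ->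
  isunit R (f * g)`_(i + j).
Proof.
move=> hL hf hg hi hj hk; have hR := loc_sub hL; have hm := loc_id hL.
rewrite coefM.
have hlt : (i < (i + j).+1)%N by rewrite ltnS leq_addr.
rewrite (bigD1 (Ordinal hlt)) //= addKn; apply: isunit_addm => //.
- by move: (hf i) (hg j) => ? ?; sr.
- exact: isunitM.
apply: (id_sum hm) => k hki.
have hki' : (k : nat) != i by move: hki; rewrite -val_eqE.
have hkl : (k <= i + j)%N by have := ltn_ord k; rewrite ltnS.
by case: (hk k hkl hki') => h; [apply: (idMr hm) | apply: (idM hm)].
Qed.

Lemma gauss R f g : is_local_ring R -> polyover R f -> polyover R g ->
  ~ inmax R f -> ~ inmax R g -> ~ inmax R (f * g).
Proof.
move=> hL hf hg nf ng.
have mn h : polyover R h -> ~ inmax R h -> exists i, isunit R h`_i /\ forall k, (k < i)%N -> max_ideal R h`_k.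
  move=> hh /(not_inmaxP hh) [i hi].
  have /ex_minnP [j /asboolP hj hmin] : exists i, `[< isunit R h`_i >] by exists i; apply/asboolP.
  exists j; split=> // k hk; case: (maxP (hh k)) => // hu.
  by have := hmin k (asboolT hu); rewrite leqNgt hk.
have [i [hi hi']] := mn f hf nf; have [j [hj hj']] := mn g hg ng.
apply: (@isunit_nallm R _ (i + j)%N); apply: coefM_unit => // k hk hki.
case: (ltnP k i) => hlt; first by left; apply: hi'.
by right; apply: hj'; lia.
Qed.

Lemma top_unit R (k : {poly F}) : polyover R k -> ~ inmax R k ->
  exists i, isunit R k`_i /\ forall j, (i < j)%N -> max_ideal R k`_j.
Proof.
move=> hk /(not_inmaxP hk) [i hi].
have hb j : `[< isunit R k`_j >] -> (j <= size k)%N.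
  move=> /asboolP [k0 _]; rewrite leqNgt; apply/negP => hj.
  by move: k0; rewrite nth_default ?eqxx // ltnW.
have [|j /asboolP hj hmax] := ex_maxnP _ hb; first by exists i; apply/asboolP.
exists j; split=> // l hl; case: (maxP (hk l)) => // hu.
by have := hmax l (asboolT hu); rewrite leqNgt hl.
Qed.

Lemma inmaxD R f g : is_local_ring R -> inmax R f -> inmax R g -> inmax R (f + g).
Proof. by move=> hL hf hg i; rewrite coefD; apply: (idD (loc_id hL)). Qed.
Lemma inmaxB R f g : is_local_ring R -> inmax R f -> inmax R g -> inmax R (f - g).
Proof.
by move=> hL hf hg i; rewrite coefB; apply: (idB (loc_sub hL) (loc_id hL)).
Qed.
Lemma inmaxM R f g : is_local_ring R -> inmax R f -> polyover R g -> inmax R (f * g).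
Proof.
move=> hL hf hg i; rewrite coefM; apply: (id_sum (loc_id hL)) => j _.
exact: (idMr (loc_id hL)).
Qed.
Lemma inmaxC R c : is_local_ring R -> max_ideal R c -> inmax R c%:P.
Proof. by move=> hL hc i; rewrite coefC; case: eqP => _ //; apply: (id0 (loc_id hL)). Qed.
Lemma inmax0 R : is_local_ring R -> inmax R 0.
Proof. by move=> hL i; rewrite coef0; apply: (id0 (loc_id hL)). Qed.
Lemma inmax1 R : is_local_ring R -> ~ inmax R 1.
Proof. by move=> hL /(_ 0%N); rewrite coef1 /=; apply: max1; apply: loc_sub. Qed.

(** The quotient [y / x] satisfies no polynomial relation over the residue field. Clearing
    denominators shows that [x] divides the leading coefficient of [h]; a multiple of [x T - y],
    which vanishes at [y / x] and has coefficients in the maximal ideal, then removes the leading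
    term. *)
Lemma key_root R x y h : is_local_ring R -> max_ideal R x -> max_ideal R y -> x != 0 ->
  (forall n c, R c -> divides R x (c * y ^+ n) -> divides R x c) ->
  polyover R h -> h.[y / x] = 0 -> inmax R h.
Proof.
move=> hL hx hy x0 hreg; have hR := loc_sub hL; have hm := loc_id hL.
have [hxR hyR] := (idR hm hx, idR hm hy).
have [n] := ubnP (size h); elim: n h => // n IH h hn hh hr.
case: (eqVneq h 0) => [->|h0]; first exact: inmax0.
have sh : (0 < size h)%N by rewrite lt0n size_poly_eq0.
set k := (size h).-1; have ek : size h = k.+1 by rewrite /k prednK.
case: (posnP k) => [k0|kpos].
  move: hr; rewrite [h]size1_polyC ?ek ?k0 // hornerC => e.
  by rewrite e; apply: inmax0.
have [d hd ed] : divides R x h`_k.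
  apply: (hreg k) => //.
  have e1 : h.[y / x] * x ^+ k = 0 by rewrite hr mul0r.
  move: e1; rewrite horner_coef ek big_ord_recr /= mulrDl.
  rewrite -[h`_k * _ * _]mulrA -exprMn divfK // => /eqP; rewrite addrC addr_eq0 => /eqP ->.
  have hI := divides_ideal hR hxR.
  apply: (idN hR hI); rewrite big_distrl /=; apply: (id_sum hI) => i _.
  have hi := ltn_ord i.
  have -> : h`_i * (y / x) ^+ i * x ^+ k = (h`_i * y ^+ i * x ^+ (k - i).-1) * x.
    have -> : x ^+ k = x ^+ (k - i).-1 * x * x ^+ i.
      by rewrite -exprSr prednK ?subn_gt0 // -exprD subnK // ltnW.
    by rewrite expr_div_n; field; rewrite expf_neq0.
  by move: (hh i) => ?; apply: (idM hI); [sr | apply: divides_refl].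
pose e : {poly F} := d%:P * 'X^(k.-1) * (x%:P * 'X - y%:P).
have he : polyover R e.
  by do !apply: polyoverM => //; [apply: polyoverC | apply: polyoverXn | apply: polyoverB => //;
    [apply: polyoverM => //; [apply: polyoverC | apply: polyoverX] | apply: polyoverC]].
have he0 : e.[y / x] = 0.
  have e1 : x * (y / x) = y by rewrite mulrC divfK.
  by rewrite /e hornerM hornerD hornerN [(x%:P * _).[_]]hornerM !hornerC hornerX e1 subrr mulr0.
have hem : inmax R e.
  rewrite /e mulrC; apply: inmaxM => //; last by apply: polyoverM => //; [apply: polyoverC | apply: polyoverXn].
  apply: inmaxB => //; last exact: inmaxC.
  by apply: inmaxM => //; [apply: inmaxC | apply: polyoverX].
have ecoef i : (k <= i)%N -> e`_i = h`_i.
  move=> hi; rewrite /e mulrBr coefB -mulrA -[_ * y%:P]mulrA.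
  rewrite coefCM coefCM ['X^_ * (x%:P * _)]mulrCA coefCM -exprSr prednK // coefXn.
  rewrite ['X^_ * _]mulrC coefCM coefXn.
  have -> : (i == k.-1) = false by lia.
  rewrite mulr0n mulr0 mulr0 subr0.
  case: eqP => [->|ne]; first by rewrite mulr1 -ed.
  by rewrite mulr0n !mulr0 nth_default // ek; lia.
rewrite -[h](subrK e).
apply: inmaxD => //; apply: IH; last by rewrite hornerD hornerN hr he0 subrr.
  have : (size (h - e)%R <= k)%N by apply/leq_sizeP => i hi; rewrite coefB ecoef // subrr.
  by move=> hs; apply: leq_ltn_trans hs _; rewrite -ltnS -ek.
exact: polyoverB.
Qed.

(** * The chart [R[y / x]] of the blow-up *)

Section Chart.
Variables (R : F -> Prop) (x y : F).
Hypothesis h : rlr R x y.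
Let t := y / x.
Let B := adjoin R t.
Let hL := rlr_loc h.
Let hR := rlr_sub h.
Let hB : is_subring B := adjoin_subring t hR.

(** The exceptional curve of the chart is an affine line: [R[t]] modulo [x] is the polynomial ring
    in [t] over the residue field of [R]. *)
Lemma adjoin_x f : polyover R f -> divides B x f.[t] <-> inmax R f.
Proof.
move=> hf; have x0 := rlr_x0 h; split.
  move=> [c [g hg ->] e].
  have hh : inmax R (f - g * x%:P).
    apply: (@key_root R x y) => //.
    - exact: rlr_mx h.
    - exact: rlr_mx (rlr_sym h).
    - case: (h) => [[_ _ hxR hyR _] hxp hxy] n c' hc hd.
      have [_ _ _ /(_ c' (y ^+ n) hc)] := hxp; case=> //; first by sr.
      by move/(primein_exp hR hxp hyR).
    - by apply: polyoverB => //; apply: polyoverM => //; apply: polyoverC => //; apply: rlr_x h.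
    - by rewrite hornerD hornerN hornerM hornerC e subrr.
  have -> : f = (f - g * x%:P) + x%:P * g by rewrite [x%:P * g]mulrC subrK.
  by apply: inmaxD => //; apply: inmaxM => //; apply: inmaxC => //; apply: rlr_mx h.
move=> hm; have hxB : B x by apply: adjoin_incl => //; apply: rlr_x h.
have hI := divides_ideal hB hxB.
rewrite horner_coef; apply: (id_sum hI) => i _; apply: (idMr hI).
  by apply: (srX hB); apply: adjoin_t.
have /(rlr_gen h) [r [s [hr [hs ->]]]] := hm i.
exists (r + s * t); last by rewrite mulrDl -mulrA divfK.
have := adjoin_incl t hR hr; have := adjoin_incl t hR hs; have := adjoin_t t hR; rewrite -/B => ? ? ?; sr.
Qed.

Lemma adjoin_m z : max_ideal R z -> divides B x z.
Proof.
move=> hz; rewrite -(hornerC z t); apply/adjoin_x; last exact: inmaxC.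
by apply: polyoverC => //; case: hz.
Qed.

Lemma adjoin_primein : primein B x.
Proof.
have x0 := rlr_x0 h; split=> //; first by apply: adjoin_incl => //; apply: rlr_x h.
  move=> [_ hi]; apply: (inmax1 hL); apply/adjoin_x; first by apply: polyoverC => //; sr.
  by rewrite hornerC; exists x^-1 => //; rewrite mulVf.
move=> a b [f hf ->] [g hg ->]; rewrite -hornerM => /adjoin_x hfg.
have {}hfg : inmax R (f * g) by apply: hfg; apply: polyoverM.
apply: contrapT => /not_orP [nf ng].
by apply: (gauss hL hf hg) => // hm; [apply: nf | apply: ng]; apply/adjoin_x.
Qed.
End Chart.
End Polynomials.

(** * The Hilbert basis theorem and localisation *)

Section Localisation.
Variable F : fieldType.
Implicit Types (R I J P V S B N : F -> Prop) (x y z a b c q t : F) (f g h : {poly F}).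

(** The module generated by [s] on top of [N]. With [N = 0] this describes finitely generated
    ideals; a general [N] describes finite generation modulo [N]. *)
Fixpoint span B N (s : seq F) : F -> Prop :=
  if s is a :: s' then idealadd B (span B N s') a else N.

Lemma span_ideal B N s : is_subring B -> is_ideal B N -> (forall a, a \in s -> B a) ->
  is_ideal B (span B N s).
Proof.
move=> hB hN; elim: s => [|a s IH] hs //=; apply: idealadd_ideal => //.
  by apply: IH => b hb; apply: hs; rewrite in_cons hb orbT.
by apply: hs; rewrite mem_head.
Qed.

Lemma span_sum B s z : is_subring B -> span B (fun z => z = 0) s z ->
  exists r : nat -> F, (forall i, B (r i)) /\ z = \sum_(i < size s) r i * s`_i.
Proof.
move=> hB; elim: s z => [|a s IH] z /=.
  by move=> ->; exists (fun => 0); split; [move=> _; sr | rewrite big_ord0].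
move=> [i /IH [r [hr ->]] [c hc ->]].
exists (fun k => if k is k'.+1 then r k' else c); split; first by case.
by rewrite big_ord_recl /= addrC.
Qed.

Lemma fg_of_span B I s : is_subring B -> (forall a, a \in s -> I a) ->
  (forall z, I z -> span B (fun z => z = 0) s z) -> fin_gen_ideal B I.
Proof.
move=> hB hs hI; exists s; split; first by move=> i hi; apply: hs; apply: mem_nth.
by move=> z /hI /(span_sum hB) [r [hr e]]; exists (fun i => r i).
Qed.

Section Hilbert.
Variables (R : F -> Prop) (t : F) (I : F -> Prop).
Hypotheses (hR : is_subring R) (hI : is_ideal (adjoin R t) I).
Let B := adjoin R t.
Let hB : is_subring B := adjoin_subring t hR.
Let J f := polyover R f /\ I f.[t].
Let SP (s : seq {poly F}) := span B (fun z => z = 0) [seq f.[t] | f : {poly F} <- s].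

Let SPid s : (forall g, g \in s -> J g) -> is_ideal B (SP s).
Proof.
move=> hs; apply: span_ideal => //; first exact: zero_ideal.
by move=> a /mapP [g /hs [hg _] ->]; exists g.
Qed.

(** Multiplication by powers of the variable brings all members of [s] to the degree [d - 1], where
    a combination of their leading coefficients is the coefficient of the same combination of the
    polynomials. *)
Let lead_lift (s : seq {poly F}) d c : (forall g, g \in s -> J g) ->
  (forall g, g \in s -> (0 < size g <= d)%N) ->
  span R (fun z => z = 0) (map lead_coef s) c ->
  exists g, [/\ J g, SP s g.[t], (size g <= d)%N & g`_d.-1 = c].
Proof.
elim: s c => [|f s IH] c hs hd /=.
  move=> ->; exists 0; split; rewrite ?size_poly0 ?coef0 //; last by rewrite /SP /= horner0.
  by split; [move=> i; rewrite coef0; sr | rewrite horner0; apply: (id0 hI)].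
move=> [i hi [r hr ->]].
have [||g [[hg1 hg2] hg3 hg4 hg5]] := IH i _ _ hi.
- by move=> g hg; apply: hs; rewrite in_cons hg orbT.
- by move=> g hg; apply: hd; rewrite in_cons hg orbT.
have [hf1 hf2] := hs f (mem_head _ _); have /andP [sf1 sf2] := hd f (mem_head _ _).
pose e : {poly F} := r%:P * 'X^(d - size f).
have he : polyover R e by apply: polyoverM => //; [apply: polyoverC | apply: polyoverXn].
have heB : B e.[t] by exists e.
exists (g + e * f); split.
- split; first by apply: polyoverD => //; apply: polyoverM.
  by rewrite hornerD hornerM; apply: (idD hI) => //; apply: (idM hI).
- rewrite /SP /=; exists g.[t] => //; exists e.[t] => //.
  by rewrite hornerD hornerM.
- apply: leq_trans (size_polyD _ _) _; rewrite geq_max hg4 /=.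
  rewrite /e -mulrA; apply: leq_trans (size_polyMleq _ _) _.
  apply: (@leq_trans (1 + size ('X^(d - size f) * f)%R).-1).
    by have := size_polyC_leq1 r; lia.
  rewrite add1n /= size_monicM ?monicXn ?size_polyXn //.
    by move: sf1 sf2; set m := size f; clearbody m => h1 h2; lia.
  by rewrite -size_poly_gt0.
- rewrite coefD hg5 /e -mulrA coefCM coefXnM lead_coefE.
  have -> : (d.-1 < d - size f)%N = false by lia.
  by congr (_ + _ * f`__); lia.
Qed.

(** Hilbert's argument. Since [t] lies in [F] and may satisfy relations over [R], the degree is that
    of a representing polynomial: at each stage one of least size outside the ideal generated so far
    is adjoined, and the ideals of leading coefficients must stop growing. *)
Lemma hilbert_fg : noetherian_ring R -> fin_gen_ideal B I.
Proof.
move=> hN; apply: contrapT => nfg.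
have hstep s : exists f, (forall g, g \in s -> J g) ->
    [/\ J f, ~ SP s f.[t] & forall g, J g -> ~ SP s g.[t] -> (size f <= size g)%N].
  case: (pselect (forall g, g \in s -> J g)) => hs; last by exists 0.
  have [f [hf hfs]] : exists f, J f /\ ~ SP s f.[t].
    apply: contrapT => hn; apply: nfg; apply: (fg_of_span (s := map (horner^~ t) s) hB).
      by move=> a /mapP [g /hs [_ hg] ->].
    move=> z hz; have [f hf ez] := idR hI hz; rewrite ez.
    by apply: contrapT => hns; apply: hn; exists f; split=> //; split=> //; rewrite -ez.
  have /ex_minnP [n /asboolP [f' [hf' hfs' e]] hmin] :
      exists n, `[< exists f, [/\ J f, ~ SP s f.[t] & size f = n] >].
    by exists (size f); apply/asboolP; exists f.
  exists f' => _; split=> // g hg hgs; rewrite e; apply: hmin; apply/asboolP; by exists g.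
have [nx hnx] := choice hstep.
pose sq := fix sq n := if n is n'.+1 then nx (sq n') :: sq n' else [::].
have hJ n g : g \in sq n -> J g.
  elim: n g => [|n IH] g //=; rewrite in_cons => /orP [/eqP ->|]; last exact: IH.
  by have [] := hnx (sq n) IH.
have nx_pos n : (0 < size (nx (sq n)))%N.
  have [_ hn _] := hnx (sq n) (@hJ n).
  rewrite lt0n size_poly_eq0; apply/eqP => e; apply: hn; rewrite e horner0.
  by apply: (id0 (SPid (@hJ n))).
have hsz n g : g \in sq n -> (0 < size g <= size (nx (sq n)))%N.
  elim: n g => [|n IH] g //=.
  have hle : (size (nx (sq n)) <= size (nx (sq n.+1)))%N.
    have [_ _ hmin] := hnx (sq n) (@hJ n); have [h1 h2 _] := hnx (sq n.+1) (@hJ n.+1).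
    apply: hmin => // h3; apply: h2; rewrite /SP /=; exact: idealadd_l.
  rewrite in_cons => /orP [/eqP ->|/IH /andP [-> h1]]; first by rewrite nx_pos.
  exact: leq_trans h1 hle.
have hid n : is_ideal R (span R (fun z => z = 0) (map lead_coef (sq n))).
  apply: span_ideal => //; first exact: zero_ideal.
  by move=> a /mapP [g /hJ [hg _] ->]; apply: hg.
have [N hNN] := noeth_acc hN hid (fun n z hz => idealadd_l _ hR hz).
have hl : span R (fun z => z = 0) (map lead_coef (sq N)) (lead_coef (nx (sq N))).
  by apply: (hNN N.+1) => /=; apply: idealadd_r.
have [g [hgJ hgS sg eg]] := lead_lift (@hJ N) (@hsz N) hl.
have [hfJ hfS hmin] := hnx (sq N) (@hJ N); set f := nx (sq N) in hfJ hfS hmin sg eg.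
have : (size f <= size (f - g)%R)%N.
  apply: hmin.
    by case: hfJ hgJ => ? ? [? ?]; split; [apply: polyoverB | rewrite hornerD hornerN; apply: (idB hB hI)].
  move=> hs; apply: hfS; rewrite -(subrK g f) hornerD; exact: (idD (SPid (@hJ N))).
rewrite leqNgt => /negP; apply.
have fp : (0 < size f)%N by apply: nx_pos.
have : (size (f - g)%R <= (size f).-1)%N.
  apply/leq_sizeP => j hj; rewrite coefB.
  case: (ltnP (size f).-1 j) => hj2.
    have hfj : (size f <= j)%N by rewrite -(prednK fp).
    by rewrite !nth_default ?subrr //; apply: leq_trans sg hfj.
  have -> : j = (size f).-1 by apply/eqP; rewrite eqn_leq hj2.
  by rewrite eg subrr.
by move=> h; apply: leq_ltn_trans h _; rewrite prednK.
Qed.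
End Hilbert.

Lemma noeth_adjoin R t : is_subring R -> noetherian_ring R -> noetherian_ring (adjoin R t).
Proof. by move=> hR hN I hI; apply: hilbert_fg. Qed.

Definition locat B P : F -> Prop := fun z => exists a b, [/\ B a, B b, ~ P b & z = a / b].

Section Frc.
Variables (B P : F -> Prop).
Hypotheses (hB : is_subring B) (hP : is_prime_ideal B P).

Lemma nP_neq0 b : ~ P b -> b != 0.
Proof. by move=> h; apply/eqP => b0; apply: h; rewrite b0; apply: (id0 hP.1). Qed.

Lemma locat_incl : incl B (locat B P).
Proof. by move=> z hz; exists z, 1; split=> //; [sr | exact: hP.2.1 | rewrite divr1]. Qed.

Lemma nP_mul b d : B b -> B d -> ~ P b -> ~ P d -> ~ P (b * d).
Proof. by move=> hb hd h1 h2 /(hP.2.2 _ _ hb hd) []. Qed.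

Lemma locat_subring : is_subring (locat B P).
Proof.
split; first by apply: locat_incl; sr.
split; first by apply: locat_incl; sr.
split=> z w [a [b [ha hb nb ->]]] [c [d [hc hd nd ->]]];
  have b0 := nP_neq0 nb; have d0 := nP_neq0 nd.
  exists (a * d - c * b), (b * d); split; [sr | sr | exact: nP_mul |].
  by field; rewrite b0 d0.
exists (a * c), (b * d); split; [sr | sr | exact: nP_mul |].
by field; rewrite b0 d0.
Qed.

Lemma locat_inv b : B b -> ~ P b -> isunit (locat B P) b.
Proof. by move=> hb nb; split; [apply: nP_neq0 | exists 1, b; split=> //; [sr | rewrite mul1r]]. Qed.

Lemma locat_max a b : B a -> B b -> ~ P b -> max_ideal (locat B P) (a / b) <-> P a.
Proof.
move=> ha hb nb; have b0 := nP_neq0 nb; split.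
  move=> [_ hn]; apply: contrapT => na; apply: hn; have a0 := nP_neq0 na.
  by split; [rewrite mulf_neq0 ?invr_neq0 | exists b, a; rewrite invf_div].
move=> pa; split; first by exists a, b.
move=> [n0 [c [d [hc hd nd e]]]]; apply: (nP_mul hb hd nb nd).
have d0 := nP_neq0 nd.
have a0 : a != 0 by move: n0; rewrite mulf_eq0 => /norP [].
have -> : b * d = c * a; last exact: (idM hP.1).
by move: e; rewrite invf_div => /eqP; rewrite eqr_div // => /eqP.
Qed.

Lemma locat_max1 a : B a -> max_ideal (locat B P) a <-> P a.
Proof. by move=> ha; have := locat_max ha (sr1 hB) hP.2.1; rewrite divr1. Qed.

Lemma locat_local : is_local_ring (locat B P).
Proof.
have hS := locat_subring; apply: local_of_sum => // z w hz hw.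
case: (hz) (hw) => [[a [b [ha hb nb e1]]] _] [[c [d [hc hd nd e2]]] _].
have b0 := nP_neq0 nb; have d0 := nP_neq0 nd.
have pa : P a by apply/(locat_max ha hb nb); rewrite -e1.
have pc : P c by apply/(locat_max hc hd nd); rewrite -e2.
have -> : z + w = (a * d + c * b) / (b * d) by rewrite e1 e2; field; rewrite b0 d0.
apply/locat_max; [sr | sr | exact: nP_mul |].
by apply: (idD hP.1); apply: (idMr hP.1).
Qed.

Lemma locat_noeth : noetherian_ring B -> noetherian_ring (locat B P).
Proof.
move=> hN I hI.
have [|s [hs hgen]] := hN (fun z => B z /\ I z).
  split; first by move=> z [].
  split; first by split; [sr | apply: (id0 hI)].
  split; first by move=> z w [? ?] [? ?]; split; [sr | apply: (idD hI)].
  by move=> r z hr [? ?]; split; [sr | apply: (idM hI) => //; apply: locat_incl].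
exists s; split; first by move=> i /hs [].
move=> z hz; have [a [b [ha hb nb e]]] := idR hI hz; have b0 := nP_neq0 nb.
have [|r [hr er]] := hgen a.
  split=> //; have -> : a = b * z by rewrite e mulrCA mulfV ?mulr1.
  by apply: (idM hI) => //; apply: locat_incl.
exists (fun i => r i / b); split; first by move=> i; exists (r i), b.
rewrite e er big_distrl /=; apply: eq_bigr => i _; by rewrite mulrAC.
Qed.
End Frc.
End Localisation.

(** * Points of the blow-up *)

Section Points.
Variable F : fieldType.
Implicit Types (P Q S : F -> Prop) (z a b c : F) (f g : {poly F}).

(** A closed point of the exceptional curve in the chart. By [adjoin_x], the polynomial [f]
    expresses that the prime [P] is strictly larger than the ideal generated by [x]. *)
Definition point (R : F -> Prop) (x y : F) P := [/\ is_prime_ideal (adjoin R (y / x)) P, P x &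
  exists f, [/\ polyover R f, ~ inmax R f & P f.[y / x]]].
(** A lift of the minimal polynomial of the closed point, up to a unit; [P] is generated by [x] and
    [f(y / x)], see [pointeq_gen]. *)
Definition pointeq (R : F -> Prop) (x y : F) P f := [/\ polyover R f, isunit R (lead_coef f), P f.[y / x] &
  forall g, polyover R g -> P g.[y / x] -> (size g < size f)%N -> inmax R g].

Variables (R : F -> Prop) (x y : F).
Hypothesis h : rlr R x y.
Let t := y / x.
Let B := adjoin R t.
Let hL := rlr_loc h.
Let hR := rlr_sub h.
Let hB : is_subring B := adjoin_subring t hR.

Lemma point_inmax P f : is_prime_ideal B P -> P x -> polyover R f -> inmax R f -> P f.[t].
Proof. by move=> hP hx hf /(adjoin_x h hf) [c hc ->]; apply: (idM hP.1). Qed.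

(** Among the polynomials of least size that vanish at the point and not modulo the maximal ideal,
    the leading coefficient is a unit, since otherwise the leading term could be dropped. *)
Lemma point_gen_ex P : point R x y P -> exists f, pointeq R x y P f.
Proof.
case=> hP hx [f [hf nf pf]].
have /ex_minnP [n /asboolP [f' [hf' nf' pf' e]] hmin] :
    exists n, `[< exists f, [/\ polyover R f, ~ inmax R f, P f.[t] & size f = n] >].
  by exists (size f); apply/asboolP; exists f.
exists f'; split=> //; last first.
  move=> g hg pg hs; apply: contrapT => ng.
  have : (n <= size g)%N by apply: hmin; apply/asboolP; exists g.
  by rewrite leqNgt -e hs.
have f0 : f' != 0 by apply/eqP => f0; apply: nf'; rewrite f0; apply: inmax0.
have sf : (0 < size f')%N by rewrite size_poly_gt0.
case: (maxP (hf' (size f').-1)) => // hm; exfalso.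
pose e' : {poly F} := (lead_coef f')%:P * 'X^((size f').-1).
have he : polyover R e' by apply: polyoverM => //; [apply: polyoverC => //; apply: hf' | apply: polyoverXn].
have hea : inmax R e' by apply: inmaxM => //; [apply: inmaxC | apply: polyoverXn].
have : (n <= size (f' - e')%R)%N.
  apply: hmin; apply/asboolP; exists (f' - e'); split=> //; first exact: polyoverB.
    by move=> ha; apply: nf'; rewrite -(subrK e' f'); apply: inmaxD.
  by rewrite hornerD hornerN; apply: (idB hB hP.1) => //; apply: point_inmax.
have : (size (f' - e')%R <= (size f').-1)%N.
  apply/leq_sizeP => j hj; rewrite coefB /e' coefCM coefXn.
  case: eqP => [->|ne]; first by rewrite mulr1 subrr.
  rewrite mulr0 subr0 nth_default // -(prednK sf) ltn_neqAle hj andbT.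
  by apply/eqP => e2; apply: ne; rewrite -e2.
by move=> h1 h2; have := leq_trans h2 h1; rewrite -e leqNgt prednK ?leqnn.
Qed.

Lemma polyover_div f g : polyover R f -> isunit R (lead_coef f) -> polyover R g ->
  exists q r, [/\ polyover R q, polyover R r, g = q * f + r & (size r < size f)%N].
Proof.
move=> hf [l0 hl]; have f0 : f != 0 by rewrite -lead_coef_eq0.
have sf : (0 < size f)%N by rewrite size_poly_gt0.
have [n] := ubnP (size g); elim: n g => // n IH g hn hg.
case: (ltnP (size g) (size f)) => hs.
  exists 0, g; split=> //; last by rewrite mul0r add0r.
  by move=> i; rewrite coef0; sr.
pose k := (size g - size f)%N.
pose e : {poly F} := (lead_coef g / lead_coef f)%:P * 'X^k.
have he : polyover R e.
  apply: polyoverM => //; last exact: polyoverXn.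
  by apply: polyoverC => //; move: (hg (size g).-1) => ?; rewrite /lead_coef in hl *; sr.
have [||q [r [hq hr eq sr]]] := IH (g - e * f).
- apply: (@leq_ltn_trans (size g).-1); last first.
    by rewrite prednK // (leq_trans sf).
  apply/leq_sizeP => j hj; rewrite coefB /e -mulrA coefCM coefXnM.
  have -> : (j < k)%N = false.
    by apply/negbTE; rewrite -leqNgt; apply: leq_trans hj; rewrite /k; move: sf hs;
       set a := size f; set b := size g; clearbody a b; lia.
  case: (ltnP (size g).-1 j) => hj2.
    rewrite !nth_default ?mulr0 ?subrr //; rewrite /k; move: sf hs hj2;
      set a := size f; set b := size g; clearbody a b; lia.
  have -> : j = (size g).-1 by apply/eqP; rewrite eqn_leq hj hj2.
  have -> : ((size g).-1 - k)%N = (size f).-1.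
    rewrite /k; move: sf hs; set a := size f; set b := size g; clearbody a b; lia.
  by rewrite -!lead_coefE divfK // subrr.
- by apply: polyoverB => //; apply: polyoverM.
exists (q + e), r; split=> //; first exact: polyoverD.
by rewrite mulrDl addrAC -eq subrK.
Qed.

Lemma pointeq_gen P f : is_prime_ideal B P -> P x -> pointeq R x y P f ->
  forall g, polyover R g -> P g.[t] -> exists q r, [/\ polyover R q, polyover R r, inmax R r, g = q * f + r & (size r < size f)%N].
Proof.
move=> hP hx [hf hl pf hmin] g hg pg.
have [q [r [hq hr e sr]]] := polyover_div hf hl hg.
exists q, r; split=> //; apply: hmin => //.
have -> : r = g - q * f by rewrite e addrC addKr.
rewrite hornerD hornerN hornerM; apply: (idB hB hP.1) => //.
by apply: (idM hP.1) => //; exists q.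
Qed.

Lemma pointeq_nallm P f : pointeq R x y P f -> ~ inmax R f.
Proof. by case=> hf hl _ _; apply: (@isunit_nallm _ R f (size f).-1). Qed.

Lemma pointeq_size P f : is_prime_ideal B P -> pointeq R x y P f -> (1 < size f)%N.
Proof.
move=> hP [hf hl pf _]; rewrite ltnNge; apply/negP => hs.
have ef := size1_polyC hs.
have [c0 hc] : isunit R f`_0 by move: hl; rewrite ef lead_coefC coefC.
apply: hP.2.1; rewrite -(mulVf c0); apply: (idM hP.1); first exact: adjoin_incl.
by rewrite -(hornerC f`_0 t) -ef.
Qed.

(** Modulo the maximal ideal of [R], the equation [f] of [P] is a multiple [q g] of the equation of
    [Q]. As [q] has smaller degree than [f], it does not vanish at [P]; so [g] does, and [g] and [x]
    generate [Q]. *)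
Lemma point_max P Q : point R x y P -> point R x y Q -> incl P Q -> incl Q P.
Proof.
move=> hp hq hPQ; have [f hf] := point_gen_ex hp; have [g hg] := point_gen_ex hq.
case: (hp) (hq) => hP hPx _ [hQ hQx _].
case: (hf) (hg) => hf1 hf2 hf3 hf4 [hg1 hg2 hg3 hg4].
have [q [r [hqR hr ra e s_r]]] := pointeq_gen hQ hQx hg hf1 (hPQ _ hf3).
have pr : P r.[t] by apply: point_inmax.
have : P (q.[t] * g.[t]).
  have -> : q.[t] * g.[t] = f.[t] - r.[t] by rewrite e hornerD hornerM addrK.
  exact: (idB hB hP.1).
case/(hP.2.2 _ _ (ex_intro2 _ _ q hqR erefl) (ex_intro2 _ _ g hg1 erefl)) => hqg.
  exfalso; apply: (pointeq_nallm hf); rewrite e; apply: inmaxD => //.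
  apply: inmaxM => //; apply: hf4 => //.
  case: (eqVneq q 0) => [->|q0]; first by rewrite size_poly0; apply: leq_trans (pointeq_size hP hf).
  have g0 : g != 0 by rewrite -lead_coef_eq0; case: hg2.
  have sg := pointeq_size hQ hg; have s_q : (0 < size q)%N by rewrite size_poly_gt0.
  have sqg : (size (q * g)%R = (size q + size g).-1)%N by rewrite size_mul.
  rewrite e size_polyDl sqg; move: s_r sg s_q;
    set m := size r; set k := size g; set l := size q; clearbody m k l; lia.
move=> z hz; have [k hk ez] := idR hQ.1 hz.
have [|q' [r' [hq' hr' ra' e' _]]] := pointeq_gen hQ hQx hg hk; first by rewrite -ez.
rewrite ez e' hornerD hornerM; apply: (idD hP.1); last exact: point_inmax.
by apply: (idM hP.1) => //; exists q'.
Qed.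

(** A polynomial that is nonzero modulo the maximal ideal vanishes at finitely many points only. The
    conclusion gathers data [L], given at each such point, into one list, so that the points need
    not be enumerated. Dividing [g] by the equation of one zero lowers the degree. *)
Lemma point_fin (T : Type) (Rel : (F -> Prop) -> seq T -> Prop) g :
  (forall P L L', Rel P L -> Rel P (L ++ L') /\ Rel P (L' ++ L)) ->
  polyover R g -> ~ inmax R g ->
  (forall P, point R x y P -> P g.[t] -> exists L, Rel P L) ->
  exists L, forall P, point R x y P -> P g.[t] -> Rel P L.
Proof.
move=> hmono; have [n] := ubnP (size g); elim: n g => // n IH g hn hg ng hex.
case: (pselect (exists P, point R x y P /\ P g.[t])) => [[P0 [hp0 pg0]]|hno]; last first.
  by exists [::] => P h1 h2; case: hno; exists P.
have [f hf] := point_gen_ex hp0; have [L0 hL0] := hex _ hp0 pg0.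
case: (hp0) => hP0 hx0 _; case: (hf) => hf1 hf2 hf3 hf4.
have [q [r [hq hr ra e s_r]]] := pointeq_gen hP0 hx0 hf hg pg0.
have nq : ~ inmax R q by move=> qa; apply: ng; rewrite e; apply: inmaxD => //; apply: inmaxM.
have q0 : q != 0 by apply/eqP => q0; apply: nq; rewrite q0; apply: inmax0.
have f0 : f != 0 by rewrite -lead_coef_eq0; case: hf2.
have hsz : (size q < size g)%N.
  have s_f := pointeq_size hP0 hf; have s_q : (0 < size q)%N by rewrite size_poly_gt0.
  have sqg : (size (q * f)%R = (size q + size f).-1)%N by rewrite size_mul.
  rewrite e size_polyDl sqg; move: s_r s_f s_q;
    set m := size r; set k := size f; set l := size q; clearbody m k l; lia.
have hPr P : point R x y P -> P r.[t] by case=> hP hx _; apply: point_inmax.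
have hgq P : point R x y P -> P q.[t] -> P g.[t].
  move=> hp pq; rewrite e hornerD hornerM; case: (hp) => hP _ _.
  by apply: (idD hP.1); [apply: (idMr hP.1) => //; exists f | apply: hPr].
have [||||L1 hL1] := IH q => //.
- by rewrite ltnS in hn; apply: leq_trans hsz hn.
- by move=> P hp pq; apply: hex => //; apply: hgq.
exists (L0 ++ L1) => P hp pg; case: (hp) => hP hx _.
have : P (q.[t] * f.[t]).
  have -> : q.[t] * f.[t] = g.[t] - r.[t] by rewrite e hornerD hornerM addrK.
  by apply: (idB hB hP.1) => //; apply: hPr.
case/(hP.2.2 _ _ (ex_intro2 _ _ q hq erefl) (ex_intro2 _ _ f hf1 erefl)) => hqf.
  by apply: (hmono P L1 L0 _).2; apply: hL1.
have hi : incl P0 P.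
  move=> z hz; have [k hk ez] := idR hP0.1 hz.
  have [|q' [r' [hq' hr' ra' e' _]]] := pointeq_gen hP0 hx0 hf hk; first by rewrite -ez.
  rewrite ez e' hornerD hornerM; apply: (idD hP.1); last exact: point_inmax.
  by apply: (idM hP.1) => //; exists q'.
have -> : P = P0 by apply: incl_eq => //; apply: point_max.
exact: (hmono P0 L0 L1 hL0).1.
Qed.

(** Euclid's trick: [1 + T g] is nonconstant modulo the maximal ideal, so it vanishes at some point,
    where [g] cannot vanish. No assumption on the size of the residue field enters. *)
Lemma point_avoid g : polyover R g -> ~ inmax R g -> exists2 P, point R x y P & ~ P g.[t].
Proof.
move=> hg ng.
pose e : {poly F} := 1 + 'X * g.
have he : polyover R e.
  by apply: polyoverD => //; [apply: polyoverC => //; sr | apply: polyoverM => //; apply: polyoverX].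
have [i hi] := not_inmaxP hg ng.
have hei : isunit R e`_i.+1 by rewrite /e coefD coef1 /= add0r coefXM.
have ne : ~ inmax R e by apply: isunit_nallm hei.
have [d [hd hd']] := top_unit he ne.
have dpos : (0 < d)%N.
  rewrite lt0n; apply/eqP => d0; have hm := hd' i.+1; rewrite d0 in hm.
  exact: (max_isunit (hm isT)).
have hxB : B x by apply: adjoin_incl => //; apply: rlr_x h.
have heB : B e.[t] by exists e.
have hI : is_ideal B (idealadd B (divides B x) e.[t]) by apply: idealadd_ideal => //; apply: divides_ideal.
have [|P [hP hIP _]] := prime_avoiding hB (noeth_adjoin hR (rlr_noeth h)) hI (sr1 hB).
  move=> n; rewrite expr1n => -[_ [c hc ->] [_ [k hk ->] e1]].
  have ha : inmax R (1 - k * e).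
    apply/(adjoin_x h).
      by apply: polyoverB => //; [apply: polyoverC => //; sr | apply: polyoverM].
    by rewrite hornerD hornerN hornerM hornerC {1}e1 addrK; exists c.
  (* If [1 = k e] modulo the maximal ideal, the product of the highest unit coefficients of [k] and
     [e] would be a unit coefficient in the positive degree [l + d]. *)
  have nk : ~ inmax R k.
    move=> ka; apply: (inmax1 hL); rewrite -[1](subrK (k * e)); apply: inmaxD => //.
    exact: inmaxM.
  have [l [hl hl']] := top_unit hk nk.
  have : isunit R (k * e)`_(l + d).
    apply: coefM_unit => // m hm hml.
    case: (ltnP l m) => hlm; first by left; apply: hl'.
    by right; apply: hd'; lia.
  have := ha (l + d)%N; rewrite coefB coef1.
  have -> : (l + d == 0)%N = false by lia.
  rewrite sub0r => hm; have := idN hR (loc_id hL) hm; rewrite opprK; exact: max_isunit.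
have hPx : P x by apply/hIP/idealadd_l => //; apply: divides_refl.
have hPe : P e.[t] by apply/hIP/idealadd_r => //; apply: divides_ideal.
exists P; first by split=> //; exists e.
move=> hPg; apply: hP.2.1; have -> : 1 = e.[t] - t * g.[t] by rewrite /e hornerD hornerM hornerX hornerC addrK.
apply: (idB hB hP.1) => //; apply: (idM hP.1) => //; exact: adjoin_t.
Qed.

Lemma adjoin_frac : quotient_field_of R -> quotient_field_of B.
Proof. by move=> hF; apply: frac_incl hF (@adjoin_incl _ R t hR). Qed.

Lemma blowup_dvr : quotient_field_of R -> dvr (locp B x) x.
Proof.
move=> hF; apply: locp_dvr => //; [exact: noeth_adjoin (rlr_noeth h) | exact: adjoin_frac | exact: adjoin_primein].
Qed.

Lemma point_rlr P f : point R x y P -> pointeq R x y P f -> rlr (locat B P) x f.[t].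
Proof.
move=> [hP hPx hPf] hf; case: (hf) => hf1 hf2 hf3 hf4.
have hS := locat_subring hB hP; have hi := locat_incl hB hP.
have hxB : B x by apply: adjoin_incl => //; apply: rlr_x h.
have hfB : B f.[t] by exists f.
have hxp := adjoin_primein h; rewrite -/t -/B in hxp.
have PB : forall b, ~ P b -> ~ divides B x b by move=> b nb [c hc e]; apply: nb; rewrite e; apply: (idM hP.1).
have dvS a b : B a -> B b -> ~ P b -> divides (locat B P) x (a / b) -> divides B x a.
  move=> ha hb nb [_ [c [d [hc hd nd ->]]] e].
  have b0 := nP_neq0 hP nb; have d0 := nP_neq0 hP nd.
  have : divides B x (a * d).
    exists (c * b); first by sr.
    have : a = c / d * x * b by rewrite -e divfK.
    by move=> ->; field.
  by case: hxp => _ _ _ hpp /(hpp _ _ ha hd) [] // /(PB _ nd).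
have dvS1 a : B a -> divides (locat B P) x a -> divides B x a.
  by move=> ha hd; apply: (dvS a 1) => //; [sr | exact: hP.2.1 | rewrite divr1].
split.
- split; [exact: locat_local | apply: locat_noeth => // | exact: hi | exact: hi |].
    exact: noeth_adjoin (rlr_noeth h).
  move=> z; split.
    move=> hz; case: (hz) => -[a [b [ha hb nb e]]] _; move: hz; rewrite e => /(locat_max hP ha hb nb) pa.
    have [k hk ea] := ha.
    have [|q [r [hq hr ra ek _]]] := pointeq_gen hP hPx hf hk; first by rewrite -ea.
    have /(adjoin_x h hr) [c hc ec] := ra.
    exists (c / b), (q.[t] / b); split; first by exists c, b.
    split; first by exists q.[t], b; split=> //; exists q.
    by rewrite ea ek hornerD hornerM ec; ring.
  move=> [r [s [hr [hs ->]]]]; have hm := loc_id (locat_local hB hP).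
  by apply: (idD hm); apply: (idM hm) => //; apply/(locat_max1 hB hP).
- split; [exact: hi | exact: rlr_x0 h | |].
    by have /(locat_max1 hB hP hxB) [] := hPx.
  move=> _ _ [a [b [ha hb nb ->]]] [c [d [hc hd nd ->]]].
  have b0 := nP_neq0 hP nb; have d0 := nP_neq0 hP nd.
  have -> : a / b * (c / d) = (a * c) / (b * d) by field; rewrite b0 d0.
  move/dvS => hdv.
  have : divides B x (a * c) by apply: hdv; [sr | sr | exact: (nP_mul hP)].
  case: hxp => _ _ _ hpp /(hpp _ _ ha hc) [] [g hg ->]; [left | right].
    by exists (g / b); [exists g, b | ring].
  by exists (g / d); [exists g, d | ring].
- by move/(dvS1 _ hfB) => /(adjoin_x h hf1); apply: pointeq_nallm hf.
Qed.
End Points.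

(** * Regular local overrings *)

Section Successors.
Variable F : fieldType.
Implicit Types (A R I J P V S B : F -> Prop) (x y z a b c q t u v : F) (f g : {poly F}).

(* [maxpow R x y n] is the [n]-th power of the maximal ideal [(x, y)]: the form
   [\sum_i f_i x^(n - i) y^i] is written [x^n f(y / x)]. *)
Definition maxpow R x y n z := exists f, [/\ polyover R f, (size f <= n.+1)%N & z = x ^+ n * f.[y / x]].

(** A coefficient [r x + s y] equals [x (r + s t)], so one factor [x] comes out at the cost of one
    degree in [t]. *)
Lemma inmax_div R x y f k : rlr R x y -> inmax R f -> (size f <= k)%N ->
  exists g, [/\ polyover R g, (size g <= k.+1)%N & f.[y / x] = x * g.[y / x]].
Proof.
move=> h ha sf; have hR := rlr_sub h; have x0 := rlr_x0 h.
have hex i : exists rs : F * F, [/\ R rs.1, R rs.2 & f`_i = rs.1 * x + rs.2 * y].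
  by have /(rlr_gen h) [r [s [hr [hs e]]]] := ha i; exists (r, s).
have [rs hrs] := choice hex.
pose g1 := \poly_(i < k) (rs i).1; pose g2 := \poly_(i < k) (rs i).2.
have h1 : polyover R g1 by move=> i; rewrite coef_poly; case: ifP => _; [case: (hrs i) | sr].
have h2 : polyover R g2 by move=> i; rewrite coef_poly; case: ifP => _; [case: (hrs i) | sr].
exists (g1 + g2 * 'X); split.
- by apply: polyoverD => //; apply: polyoverM => //; apply: polyoverX.
- apply: leq_trans (size_polyD _ _) _; rewrite geq_max; apply/andP; split.
    exact: leq_trans (size_poly _ _) _.
  apply: leq_trans (size_polyMleq _ _) _; rewrite size_polyX.
  have : (size g2 <= k)%N by apply: size_poly.
  by set m := size g2; clearbody m; lia.
have ef : f = x%:P * g1 + y%:P * g2.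
  apply/polyP => i; rewrite coefD !coefCM !coef_poly.
  case: ifP => hi; first by case: (hrs i) => _ _ ->; rewrite mulrC [_ * y]mulrC.
  by rewrite !mulr0 addr0 nth_default // (leq_trans sf) // leqNgt hi.
rewrite [in LHS]ef !hornerD !hornerM !hornerC hornerX.
rewrite mulrDr; congr (_ + _); rewrite mulrCA [x * _]mulrC divfK // mulrC //.
Qed.

(** The order valuation measures powers of the maximal ideal: if [x^n f(t)] has value at least
    [n + 1], then [f] vanishes modulo the maximal ideal and another [x] can be extracted. *)
Lemma maxpow_inter R x y n z : rlr R x y -> R z ->
  (exists2 c, locp (adjoin R (y / x)) x c & z = x ^+ n * c) -> maxpow R x y n z.
Proof.
move=> h hz; have hR := rlr_sub h; have x0 := rlr_x0 h.
set t := y / x; set B := adjoin R t; have hB : is_subring B := adjoin_subring t hR.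
have hp := adjoin_primein h; have hW := locp_subring hB hp; rewrite -/t -/B in hp hW.
elim: n => [|n IH] [c hc e].
  exists z%:P; split; [exact: polyoverC | exact: size_polyC_leq1 | by rewrite expr0 mul1r hornerC].
have hxW : locp B x x by apply: locp_incl => //; case: hp.
have [|f [hf sf ef]] := IH.
  by exists (x * c); [sr | rewrite e exprSr mulrA].
have efc : f.[t] = x * c.
  by apply: (mulfI (expf_neq0 n x0)); rewrite -ef e exprSr mulrA.
have ha : inmax R f.
  apply/(adjoin_x h hf); apply/(locp_max hB hp); first by exists f.
  have hm : max_ideal (locp B x) x by apply/(locp_max hB hp); [case: hp | apply: divides_refl].
  have -> : f.[y / x] = x * c by [].
  split; first by sr.
  by move/(isunitMl hW hxW hc); apply: max_isunit.
have [g [hg sg eg]] := inmax_div h ha sf.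
exists g; split=> //; by rewrite ef eg exprSr mulrA.
Qed.

(** Every monomial of degree [k + m] in [x, y] is divisible by [x^k] or by [y^m]. This permits
    Krull's theorem to be applied to one parameter at a time. *)
Lemma maxpow_split R x y k m z : rlr R x y -> maxpow R x y (k + m) z ->
  exists a b, [/\ R a, R b & z = x ^+ k * a + y ^+ m * b].
Proof.
move=> h [f [hf sf ->]]; have hR := rlr_sub h; have x0 := rlr_x0 h.
have hxR := rlr_x h; have hyR := rlr_x (rlr_sym h).
rewrite (horner_coef_wide _ sf) big_distrr /=.
apply: (big_ind (fun z => exists a b, [/\ R a, R b & z = x ^+ k * a + y ^+ m * b])).
- by exists 0, 0; split; [sr | sr | ring].
- move=> _ _ [a [b [ha hb ->]]] [c [d [hc hd ->]]]; exists (a + c), (b + d); split; [sr | sr | ring].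
move=> i _; have hi := ltn_ord i; rewrite ltnS in hi.
have e : x ^+ (k + m) * (f`_i * (y / x) ^+ i) = f`_i * (x ^+ (k + m - i) * y ^+ i).
  have -> : x ^+ (k + m) = x ^+ (k + m - i) * x ^+ i by rewrite -exprD subnK.
  by rewrite expr_div_n; field; rewrite expf_neq0.
rewrite e; move: (hf i) => hfi.
case: (leqP m i) => hmi.
  exists 0, (f`_i * x ^+ (k + m - i) * y ^+ (i - m)); split; [sr | sr |].
  have -> : y ^+ i = y ^+ m * y ^+ (i - m) by rewrite -exprD subnKC.
  by ring.
have hki : (k <= k + m - i)%N by lia.
exists (f`_i * x ^+ (k + m - i - k) * y ^+ i), 0; split; [sr | sr |].
have -> : x ^+ (k + m - i) = x ^+ k * x ^+ (k + m - i - k) by rewrite -exprD subnKC.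
by ring.
Qed.

(* If neither quotient lies in [S], then [t = y / x] is transcendental over the residue field of
   [S], and [S] lies in the order valuation ring [W] of [R]. Comparing initial forms gives
   [S = R + m_S] and [m_S = (x, y) S], hence [S = R + x^n W \cap S] for all [n] and [S = R]. *)
Lemma rlr_overring R x y S u v : rlr R x y -> quotient_field_of R -> rlr S u v -> incl R S ->
  ~ incl S R -> S (y / x) \/ S (x / y).
Proof.
move=> h hF hS hi hn; have hR := rlr_sub h; have hSr := rlr_sub hS; have hSL := rlr_loc hS.
have hSm := loc_id hSL.
have [hxm hym] := rlr_dominated h hF hS hi.
have x0 := rlr_x0 h; have y0 := rlr_x0 (rlr_sym h).
have [hxS hyS] := (idR hSm hxm, idR hSm hym).
have [d [x' [y' [[hd hx' hy'] ex ey hc]]]] := coprime_rep hS hxS hyS x0.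
have d0 : d != 0 by apply: contraNneq x0 => d0; rewrite ex d0 mul0r.
have x'0 : x' != 0 by apply: contraNneq x0 => d1; rewrite ex d1 mulr0.
have y'0 : y' != 0 by apply: contraNneq y0 => d1; rewrite ey d1 mulr0.
have et : y / x = y' / x' by rewrite ex ey -mulf_div mulfV ?mul1r.
case: (maxP hx') => hx'm; last by left; rewrite et; case: hx'm => _ ?; sr.
case: (maxP hy') => hy'm.
  2: by right; have -> : x / y = x' / y' by [rewrite ex ey -mulf_div mulfV ?mul1r]; case: hy'm => _ ?; sr.
exfalso; apply: hn.
set t := y / x in et; set B := adjoin R t; have hB : is_subring B := adjoin_subring t hR.
have hkey f : polyover S f -> f.[t] = 0 -> inmax S f.
  rewrite et; apply: key_root => // n c hcS; elim: n => [|n IH]; first by rewrite expr0 mulr1.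
  rewrite exprSr mulrA => hdv; apply: IH; apply: (coprime_divides hS hx' hy' _ x'0 hc hdv); sr.
have hkey0 f : polyover S f -> ~ inmax S f -> f.[t] != 0 by move=> h1 h2; apply/eqP => /(hkey _ h1).
(* [T] is the localisation of [S[t]] at the extension of the maximal ideal of [S]. It contains the
   order valuation ring of [R] and omits the inverse of [x], hence equals it. *)
pose T z := exists f g, [/\ polyover S f, polyover S g, ~ inmax S g & z = f.[t] / g.[t]].
have hST : incl S T.
  move=> z hz; exists z%:P, 1%:P; split; rewrite ?hornerC ?divr1 //; try apply: polyoverC => //; try by sr.
  exact: (inmax1 hSL).
have hT : is_subring T.
  split; first by apply: hST; sr.
  split; first by apply: hST; sr.
  split=> _ _ [f [g [hf hg ng ->]]] [f' [g' [hf' hg' ng' ->]]];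
    have g0 := hkey0 _ hg ng; have g'0 := hkey0 _ hg' ng'.
    exists (f * g' - f' * g), (g * g'); split.
    - by apply: polyoverB => //; apply: polyoverM.
    - exact: polyoverM.
    - exact: gauss.
    by rewrite hornerD hornerN !hornerM; field; rewrite g0 g'0.
  exists (f * f'), (g * g'); split; [exact: polyoverM | exact: polyoverM | exact: gauss |].
  by rewrite !hornerM mulf_div.
have hTm w : max_ideal S w -> w != 0 -> ~ T w^-1.
  move=> hw w0 [f [g [hf hg ng e]]]; apply: ng; have g0 : g.[t] != 0.
    by apply/eqP => g0; move: e; rewrite g0 invr0 mulr0 => /eqP; rewrite invr_eq0 (negbTE w0).
  have hwf : inmax S (w%:P * f) by apply: inmaxM => //; apply: inmaxC.
  rewrite -[g](subrK (w%:P * f)); apply: inmaxD => //; apply: hkey.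
    by apply: polyoverB => //; apply: polyoverM => //; apply: polyoverC => //; case: hw.
  rewrite hornerD hornerN hornerM hornerC; apply/eqP; rewrite subr_eq0; apply/eqP.
  have : f.[t] = w^-1 * g.[t] by rewrite e divfK.
  by move=> ->; rewrite mulVKf.
have hWd := blowup_dvr h hF; rewrite -/t -/B in hWd.
have hW := dvr_sub hWd; have hp := adjoin_primein h; rewrite -/t -/B in hp.
have RS_nallm g : polyover R g -> ~ inmax R g -> ~ inmax S g.
  move=> hg /(not_inmaxP hg) [i [gi0 gi]]; apply: (@isunit_nallm _ S g i); split=> //; exact: hi.
have hWT : incl (locp B x) T.
  move=> _ [_ [_ [[f hf ->] [g hg ->] ng ->]]]; exists f, g; split=> //; [exact: polyoverS hf | exact: polyoverS hg |].
  by apply: RS_nallm => // ha; apply: ng; apply/(adjoin_x h hg).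
have hTW : incl T (locp B x) by apply: (dvr_over hWd hT hWT); apply: hTm.
have hSW : incl S (locp B x) by move=> z /hST /hTW.
have hmW z : max_ideal S z -> exists2 c, locp B x c & z = x * c.
  move=> hz; have : max_ideal (locp B x) z.
    split; first by apply: hSW; case: hz.
    by move=> [z0 /hWT]; apply: hTm.
  by move/(dvr_maxP _ hWd) => [c hcc ->]; exists c => //; rewrite mulrC.
have hres z : S z -> exists2 a, R a & max_ideal S (z - a).
  move=> hz; have [_ [_ [[f hf ->] [g hg ->] ng e]]] := hSW z hz.
  have {}ng : ~ inmax R g by move=> ha; apply: ng; apply/(adjoin_x h hg).
  have hgS := polyoverS hi hg; have hfS := polyoverS hi hf.
  have g0 : g.[t] != 0 by apply: hkey0 => //; apply: RS_nallm.
  have ha : inmax S (z%:P * g - f).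
    apply: hkey; first by apply: polyoverB => //; apply: polyoverM => //; apply: polyoverC.
    by rewrite hornerD hornerN hornerM hornerC e divfK // subrr.
  have [i [gi0 gi]] := not_inmaxP hg ng.
  exists (f`_i / g`_i); first by move: (hf i) => ?; sr.
  have := ha i; rewrite coefB coefCM => hai.
  have -> : z - f`_i / g`_i = (g`_i)^-1 * (z * g`_i - f`_i) by field.
  by apply: (idM hSm) => //; apply: hi.
(* If [d] were a nonunit, [x = d x'] would be divisible by [x^2] in the order valuation ring. *)
have du : isunit S d.
  case: (maxP hd) => // /hmW [c hcc ec].
  have [c' hcc' ec'] := hmW _ hx'm; exfalso.
  have e1 : 1 = x * (c * c').
    by apply: (mulfI x0); rewrite mulr1 {1}ex ec ec'; ring.
  have hm : max_ideal (locp B x) x by apply/(locp_max hB hp); [case: hp | apply: divides_refl].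
  apply: (max1 hW); rewrite e1; apply: (idMr (loc_id (dvr_loc hWd))) => //; sr.
have hmxy z : max_ideal S z -> exists r s, [/\ S r, S s & z = r * x + s * y].
  have [di0 hdi] := du.
  suff hm' : exists r1 s1 r2 s2, [/\ [/\ S r1, S s1, S r2 & S s2], u = r1 * x' + s1 * y' & v = r2 * x' + s2 * y'].
    move=> /(rlr_gen hS) [r [s [hr [hs ->]]]].
    case: hm' => r1 [s1 [r2 [s2 [[k1 k2 k3 k4] -> ->]]]].
    exists ((r * r1 + s * r2) / d), ((r * s1 + s * s2) / d); split; [sr | sr |].
    by rewrite ex ey; field.
  have /(rlr_gen hS) [a [b [ha [hb e1]]]] := hx'm.
  have /(rlr_gen hS) [c [e [hcS [he e2]]]] := hy'm.
  (* The determinant of the matrix that expresses [x', y'] by the parameters [u, v] of [S]. When it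
     is a unit, Cramer's rule shows that [x', y'] generate the maximal ideal. *)
  pose D := a * e - b * c; have hD : S D by rewrite /D; sr.
  case: (maxP hD) => hDm; last first.
    case: hDm => D0 hDi; exists (e / D), (- b / D), (- c / D), (a / D); split.
    - by split; sr.
    - have e3 : e * x' - b * y' = D * u by rewrite e1 e2 /D; ring.
      have -> : e / D * x' + - b / D * y' = (e * x' - b * y') / D by ring.
      by rewrite e3 mulrC mulKf.
    - have e3 : a * y' - c * x' = D * v by rewrite e1 e2 /D; ring.
      have -> : - c / D * x' + a / D * y' = (a * y' - c * x') / D by ring.
      by rewrite e3 mulrC mulKf.
  exfalso.
  (* A combination of [x'] and [y'] with a unit coefficient cannot lie in the square of the maximal
     ideal: divided by [x'] it is [r + s t], a unit of [T], but elements of the square have value at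
     least 2. *)
  have hrel r s p1 p2 : S r -> S s -> (isunit S r \/ isunit S s) -> max_ideal S p1 -> max_ideal S p2 ->
      r * x' + s * y' = p1 * u + p2 * v -> False.
    move=> hr hs hrs /hmW [c1 hc1 ec1] /hmW [c2 hc2 ec2] e3.
    have [c3 hc3 ec3] := hmW _ (rlr_mx hS); have [c4 hc4 ec4] := hmW _ (rlr_mx (rlr_sym hS)).
    pose g : {poly F} := r%:P + s%:P * 'X.
    have hg : polyover S g by apply: polyoverD; [|apply: polyoverC | apply: polyoverM; [|apply: polyoverC|apply: polyoverX]].
    have ng : ~ inmax S g.
      case: hrs => hu; [apply: (@isunit_nallm _ S g 0) | apply: (@isunit_nallm _ S g 1)];
        by rewrite /g coefD coefC coefCM coefX /= ?mulr0 ?mulr1 ?addr0 ?add0r.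
    have g0 := hkey0 _ hg ng.
    have egt : g.[t] = x * (d * (c1 * c3 + c2 * c4)).
      apply: (mulfI x'0); rewrite /g hornerD hornerM !hornerC hornerX.
      have -> : x' * (r + s * t) = r * x' + s * y' by rewrite et; field.
      have -> : x' * (x * (d * (c1 * c3 + c2 * c4))) = d * x' * x * (c1 * c3 + c2 * c4) by ring.
      by rewrite -ex e3 ec1 ec2 ec3 ec4; ring.
    have hgW : locp B x (g.[t])^-1.
      apply: hTW; exists 1%:P, g; split=> //; first by apply: polyoverC => //; sr.
      by rewrite hornerC mul1r.
    have hm : max_ideal (locp B x) x by apply/(locp_max hB hp); [case: hp | apply: divides_refl].
    apply: (max1 hW); rewrite -(mulVf g0) {2}egt.
    have := hSW _ hd => hdW.
    apply: (idM (loc_id (dvr_loc hWd))) => //; apply: (idMr (loc_id (dvr_loc hWd))) => //; sr.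
  (* A nonunit determinant gives such a combination: the second column of the adjugate if [a] is a
     unit, the first if [b] is a unit, and [x'] itself if neither is. *)
  have h0 : max_ideal S 0 := id0 hSm; have hND := idN hSr hSm hDm.
  case: (maxP ha) => [ham|ua]; last first.
    by apply: (hrel (- c) a 0 D) => //; [sr | right | rewrite e1 e2 /D; ring].
  case: (maxP hb) => [hbm|ub]; last first.
    by apply: (hrel (- e) b (- D) 0) => //; [sr | right | rewrite e1 e2 /D; ring].
  by apply: (hrel 1 0 a b) => //; [sr | sr | left; apply: isunit1 | rewrite e1; ring].
have happ n z : S z -> exists2 a, R a & exists2 c, locp B x c & z - a = x ^+ n * c.
  elim: n z => [|n IH] z hz.
    by exists 0; [sr | exists z; [apply: hSW | rewrite expr0 mul1r subr0]].
  have [a ha /hmxy [r [s [hr hs e]]]] := hres z hz.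
  have [a1 ha1 [c1 hc1 e1]] := IH r hr; have [a2 ha2 [c2 hc2 e2]] := IH s hs.
  have [hxR hyR] := (rlr_x h, rlr_x (rlr_sym h)).
  exists (a + a1 * x + a2 * y); first by sr.
  have htW : locp B x t by apply: locp_incl => //; apply: adjoin_t.
  exists (c1 + c2 * t); first by sr.
  have -> : z - (a + a1 * x + a2 * y) = (r - a1) * x + (s - a2) * y.
    by rewrite !mulrBl; have -> : z = a + (r * x + s * y) by [rewrite -e; ring]; ring.
  by rewrite e1 e2 exprSr /t; field.
move=> z hz; have [A [b [hA [hb [b0 ez]]]]] := hF z.
have [hxR hyR] := (rlr_x h, rlr_x (rlr_sym h)).
have hLR := rlr_loc h; have hNR := rlr_noeth h.
have hIb := divides_ideal hR hb.
(* With [z = A / b], the element [A - b a] of [R] has value at least [k + m], hence lies in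
   [(x^k, y^m)]. Krull's theorem removes [y^m] modulo [(b, x^k)] and then [x^k] modulo [b]. *)
suff [c hcR ec] : divides R b A by rewrite ez ec mulfK.
apply: (krull_inter hLR hNR hIb (rlr_mx h) hA) => k.
have hIk : is_ideal R (idealadd R (divides R b) (x ^+ k)) by apply: idealadd_ideal => //; sr.
suff [i hib [r hr e]] : idealadd R (divides R b) (x ^+ k) A.
  by exists r => //; rewrite e mulrC addrK.
apply: (krull_inter hLR hNR hIk (rlr_mx (rlr_sym h)) hA) => m.
have [a ha [c hcc e]] := happ (k + m)%N z hz.
have hbW : locp B x b by apply: hSW; apply: hi.
have [|a1 [b1 [ha1 hb1 e1]]] := @maxpow_split R x y k m (A - b * a) h.
  apply: maxpow_inter => //; first by sr.
  exists (b * c); first by sr.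
  by rewrite mulrCA -e mulrBr ez mulrCA mulfV ?mulr1.
exists b1 => //; exists (a * b); first by exists a.
exists a1 => //; have -> : A = b * a + (x ^+ k * a1 + y ^+ m * b1) by rewrite -e1; ring.
by ring.
Qed.
End Successors.

(** * Successors *)

Section Tree.
Variable F : fieldType.
Implicit Types (A R I J P V S B : F -> Prop) (x y z a b c q t u v : F) (f g : {poly F}).

Definition params R : F * F :=
  if pselect (exists xy : F * F, rlr R xy.1 xy.2) is left h then sval (cid h) else (0, 0).

Lemma params_rlr R x y : rlr R x y -> rlr R (params R).1 (params R).2.
Proof.
move=> h; rewrite /params; case: pselect => [h'|[]]; last by exists (x, y).
exact: (svalP (cid h')).
Qed.

(* The two charts of the blow-up of [R] use a fixed pair of parameters, so that the
   exceptional divisor of [R] is represented by two rings only. *)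
Definition successor R S := exists x y P, [/\ rlr R x y, params R = (x, y) \/ params R = (y, x), point R x y P &
  S = locat (adjoin R (y / x)) P].

Lemma successor_rlr R S : successor R S -> exists x y, rlr S x y.
Proof.
move=> [x [y [P [h _ hp ->]]]]; have [f hf] := point_gen_ex h hp.
by exists x, f.[y / x]; apply: point_rlr.
Qed.

Lemma successor_incl R S : successor R S -> incl R S.
Proof.
move=> [x [y [P [h _ [hP _ _] ->]]]] z hz; have hR := rlr_sub h.
by apply: (locat_incl (adjoin_subring _ hR) hP); apply: adjoin_incl.
Qed.

Lemma successor_ideal R S : successor R S -> exists w, [/\ w != 0, max_ideal R w, max_ideal S w &
  forall z, max_ideal R z -> divides S w z].
Proof.
move=> [x [y [P [h _ [hP hx _] ->]]]]; have hR := rlr_sub h; have hB := adjoin_subring (y / x) hR.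
exists x; split; [exact: rlr_x0 h | exact: rlr_mx h | |].
  by apply/(locat_max1 hB hP) => //; apply: adjoin_incl => //; apply: rlr_x h.
by move=> z /(adjoin_m h) [c hc ->]; exists c => //; apply: (locat_incl hB hP).
Qed.

Lemma successor_dominated R S : successor R S -> forall z, max_ideal R z -> max_ideal S z.
Proof.
move=> hs z hz; have [w [_ _ hw /(_ z hz) [c hc ->]]] := successor_ideal hs.
by have [x [y /rlr_loc/loc_id hm]] := successor_rlr hs; apply: (idM hm).
Qed.

(** Either some polynomial that is nonzero modulo the maximal ideal becomes a nonunit of [S], and
    the center of [S] on the chart is a closed point, or all of them become units and [S] contains
    the order valuation ring. *)
Lemma center_point R x y S : rlr R x y -> is_local_ring S -> incl R S -> S (y / x) ->
  max_ideal S x ->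
  (exists2 P, point R x y P & [/\ incl (locat (adjoin R (y / x)) P) S,
       forall z, max_ideal (locat (adjoin R (y / x)) P) z -> max_ideal S z &
       forall z, P z <-> adjoin R (y / x) z /\ max_ideal S z]) \/
  incl (locp (adjoin R (y / x)) x) S.
Proof.
move=> h hL hi ht hx; have hR := rlr_sub h; have hB := adjoin_subring (y / x) hR.
have hS := loc_sub hL; have hBS := adjoin_min hS hi ht; have hP := center_prime hB hL hBS.
case: (pselect (exists f, [/\ polyover R f, ~ inmax R f & max_ideal S f.[y / x]])) => [[f [hf nf hm]]|hno].
  left; exists (fun z => adjoin R (y / x) z /\ max_ideal S z).
    split=> //; first by split=> //; apply: adjoin_incl => //; apply: rlr_x h.
    by exists f; split=> //; split=> //; exists f.
  split=> //.
    move=> _ [a [b [ha hb nb ->]]]; apply: (srM hS); first exact: hBS.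
    by case: (maxP (hBS _ hb)) => [hm'|[]] //; case: nb.
  move=> z hz; case: (hz) => -[a [b [ha hb nb e]]] _; move: hz; rewrite e.
  move/(locat_max hP ha hb nb) => [_ ham]; apply: (idMr (loc_id hL)) => //.
  by case: (maxP (hBS _ hb)) => [hm'|[]] //; case: nb.
right=> _ [a [_ [ha [g hg ->] nb ->]]]; apply: (srM hS); first exact: hBS.
case: (@maxP _ S g.[y / x]); [by apply: hBS; exists g | | by case].
by move=> hm; case: hno; exists g; split=> // ga; apply: nb; apply/(adjoin_x h hg).
Qed.

(** By [rlr_overring] the ring [S] contains one of the two charts. It cannot contain the order
    valuation ring, since it would then be a valuation ring; so its center is a point. *)
Lemma successor_in R x y S u v : rlr R x y -> quotient_field_of R -> rlr S u v -> incl R S ->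
  ~ incl S R -> exists2 T, successor R T & incl T S.
Proof.
move=> /params_rlr h hF hS hi hn; have [hx hy] := rlr_dominated h hF hS hi.
have key x' y' : rlr R x' y' -> params R = (x', y') \/ params R = (y', x') ->
    S (y' / x') -> max_ideal S x' -> exists2 T, successor R T & incl T S.
  move=> h' hpar ht hx'; case: (center_point h' (rlr_loc hS) hi ht hx') => [[P hp [hinc _ _]]|hW].
    by exists (locat (adjoin R (y' / x')) P) => //; exists x', y', P.
  exfalso; apply: (val_not_rlr hS) => z z0.
  by case: (dvr_val (blowup_dvr h' hF) z0) => /hW; [left | right].
case: (rlr_overring h hF hS hi hn) => ht.
  by apply: (key (params R).1 (params R).2) => //; left; case: (params R).
by apply: (key (params R).2 (params R).1) => //; [apply: rlr_sym | right; case: (params R)].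
Qed.

(* The ideals [m_n S] are principal and become constant, equal to [w S]. For a prime factor [q] of
   [w], every step cancels an element of [q S] from a fraction, so the
   valuation ring of [q] would be the union of the chain and equal to [S]. *)
Lemma no_infinite_chain (C : nat -> F -> Prop) S u v : quotient_field_of (C 0%N) ->
  (forall n, successor (C n) (C n.+1)) -> rlr S u v -> (forall n, incl (C n) S) -> False.
Proof.
move=> hF hsucc hS hinc; have hSr := rlr_sub hS; have hSL := rlr_loc hS; have hN := rlr_noeth hS.
have hC n : exists x y, rlr (C n) x y.
  by have [x [y [P [h _ _ _]]]] := hsucc n; exists x, y.
have mono n m : (n <= m)%N -> incl (C n) (C m).
  move=> /subnK <-; elim: (m - n)%N => [|k IH] z hz //.
  by rewrite addSn; apply: (successor_incl (hsucc _)); apply: IH.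
have hFn n : quotient_field_of (C n) by apply: frac_incl hF _; apply: mono.
have [w hw] := choice (fun n => successor_ideal (hsucc n)).
have hwm n : max_ideal S (w n).
  have [x [y h]] := hC n; have hd := rlr_dominated h (hFn n) hS (hinc n).
  by apply: (dominated_max h hSL (hinc n) hd); case: (hw n).
have [N hNN] : exists N, forall n, incl (divides S (w n)) (divides S (w N)).
  apply: (noeth_acc hN) => n; first by apply: divides_ideal => //; case: (hwm n).
  move=> z [c hc ->]; case: (hw n) (hw n.+1) => _ _ h1 _ [_ _ _ /(_ _ h1) [d hd ->]].
  by exists (c * d); [have := hinc n.+2 _ hd => ?; sr | rewrite mulrA].
have [q hq hqw] := prime_divisor hS (idR (loc_id hSL) (hwm N)) (let: And4 a _ _ _ := hw N in a) (max_isunit (hwm N)).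
have hFS : quotient_field_of S by apply: frac_incl hF (hinc 0%N).
have hd := locp_dvr hSr hN hFS hq; have hiV := locp_incl hSr hq; have hV := dvr_sub hd.
have hqwn n : divides S q (w n) by apply: divides_trans hqw _ => //; apply: (hNN n); apply: divides_refl.
have hqm n z : max_ideal (C n) z -> divides S q z.
  by case: (hw n) => _ _ _ hh /hh [c hc ->]; apply: (idM (divides_ideal hSr _)) => //;
    [case: hq | apply: (hinc n.+1)].
(* The [q]-order of the denominator [g] is less than [k], and it drops each time [f] and [g] are
   divided by the generator [w n]. The numerator cannot become a unit before the denominator,
   because [f / g] lies in the valuation ring of [q]. *)
have key k n (f g : F) : C n f -> C n g -> g != 0 -> locp S q (f / g) -> ~ divides S (q ^+ k) g -> S (f / g).
  elim: k n f g => [|k IH] n f g hf hg g0 hfg hk.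
    by case: hk; exists g; [apply: (hinc n) | rewrite expr0 mulr1].
  have [x [y h]] := hC n; have hCn := rlr_sub h.
  case: (maxP hg) => [hgm|[_ hgi]]; last by apply: (hinc n); sr.
  case: (maxP hf) => [hfm|[f0 hfi]]; last first.
    exfalso; have hgf : C n (g / f) by sr.
    have hm : max_ideal (C n) (g / f) by apply: (idMr (loc_id (rlr_loc h))).
    have /(locp_max hSr hq (hinc n _ hgf)) [_] := hqm n _ hm; apply; split.
      by rewrite mulf_neq0 ?invr_neq0.
    by rewrite invf_div.
  case: (hw n) => w0 _ _ hwd.
  have [f1 hf1 ef] := hwd f hfm; have [g1 hg1 eg] := hwd g hgm.
  have g10 : g1 != 0 by apply: contraNneq g0 => e0; rewrite eg e0 mul0r.
  have e : f / g = f1 / g1 by rewrite ef eg -mulf_div mulfV // mulr1.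
  rewrite e; apply: (IH n.+1) => //; first by rewrite -e.
  move=> [c hc ec]; apply: hk; have [c' hc' ec'] := hqwn n.
  by exists (c * c'); [sr | rewrite eg ec ec' exprS; ring].
have hVS : incl (locp S q) S.
  move=> z hz; have [f [g [hf [hg [g0 e]]]]] := hF z.
  have [k [g' [hg' ng' eg]]] := primein_split hSr hN hq (hinc 0%N _ hg) g0.
  rewrite e; apply: (key k.+1 0%N) => //; first by rewrite -e.
  case: (hq) => _ q0 _ _ [c hc ec]; apply: ng'; exists c => //.
  by apply: (mulIf (expf_neq0 k q0)); rewrite -eg ec exprS mulrA.
by apply: (val_not_rlr hS) => z z0; case: (dvr_val hd z0) => /hVS; [left | right].
Qed.

(** If [t = y / x] lies in [S], the center of [S] on the chart is another point, and an element of
    [P] outside it is a unit of [S]. Otherwise [s = x / y] is a nonunit of [S]. If [t] vanishes at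
    the point, [s] has the required property; if not, the inverse of [s^n f(t)] has it, where [f] is
    the equation of the point and [n] its degree: the leading coefficient makes [s^n f(t)] a unit of
    [S]. *)
Lemma successor_separate R S T u v : successor R T -> quotient_field_of R -> rlr S u v -> incl R S ->
  ~ incl S R -> ~ incl T S -> exists h, [/\ h != 0, S h & max_ideal T h^-1].
Proof.
move=> hsT hF hS hi hn hTS; have [x [y [P [h _ hp eT]]]] := hsT.
have [hx hy] := rlr_dominated h hF hS hi; have hSL := rlr_loc hS; have hSr := rlr_sub hS.
have hR := rlr_sub h; have x0 := rlr_x0 h; have y0 := rlr_x0 (rlr_sym h).
set t := y / x in eT; have hB : is_subring (adjoin R t) := adjoin_subring t hR.
case: (hp) => hP hPx _; rewrite -/t in hP.
case: (pselect (S t)) => ht.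
  have hBS := adjoin_min hSr hi ht.
  case: (center_point h hSL hi ht hx) => [[Q hq [_ _ hQ]]|hW]; last first.
    exfalso; apply: (val_not_rlr hS) => z z0.
    by case: (dvr_val (blowup_dvr h hF) z0) => /hW; [left | right].
  have [b [hb hPb hQb]] : exists b, [/\ adjoin R t b, P b & ~ Q b].
    apply: contrapT => hno; apply: hTS.
    have hPQ : incl P Q.
      by move=> b hb; apply: contrapT => nb; apply: hno; exists b; split=> //; apply: (idR hP.1).
    have hQP := point_max h hp hq hPQ.
    rewrite eT => _ [a [b [ha hb nb ->]]]; apply: (srM hSr); first exact: hBS.
    by case: (maxP (hBS _ hb)) => [hm|[]] //; case: nb; apply: hQP; apply/hQ.
  have [b0 hbi] : isunit S b by case: (maxP (hBS _ hb)) => // hm; case: hQb; apply/hQ.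
  exists b^-1; split; [by rewrite invr_neq0 | by [] |].
  by rewrite invrK eT; apply/(locat_max1 hB hP).
have hs : S (x / y) by case: (rlr_overring h hF hS hi hn).
have s0 : x / y != 0 by rewrite mulf_neq0 ?invr_neq0.
have hsm : max_ideal S (x / y).
  by split=> // -[_]; rewrite invf_div.
case: (pselect (P t)) => hPt.
  exists (x / y); split=> //; rewrite invf_div eT; apply/(locat_max1 hB hP) => //; exact: adjoin_t.
have [f hf] := point_gen_ex h hp; case: (hf) => hf1 hf2 hf3 hf4.
have f0 : f != 0 by rewrite -lead_coef_eq0; case: hf2.
set n := (size f).-1; have sf : size f = n.+1 by rewrite /n prednK // size_poly_gt0.
pose b := (x / y) ^+ n * f.[t].
have hbu : isunit S b.
  rewrite /b horner_coef sf big_ord_recr /= mulrDr addrC.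
  have -> : (x / y) ^+ n * (f`_n * t ^+ n) = f`_n.
    by rewrite mulrCA -exprMn /t mulrA divfK // mulfV // expr1n mulr1.
  apply: isunit_addm => //; first by apply: hi.
    by case: hf2 => l0 hl; split=> //; apply: hi.
  rewrite big_distrr /=; apply: (id_sum (loc_id hSL)) => i _; have hin := ltn_ord i.
  have -> : (x / y) ^+ n * (f`_i * t ^+ i) = f`_i * (x / y) ^+ (n - i).-1 * (x / y).
    have -> : (x / y) ^+ n = (x / y) ^+ (n - i).-1 * (x / y) * (x / y) ^+ i.
      by rewrite -exprSr prednK ?subn_gt0 // -exprD subnK // ltnW.
    have e1 : (x / y) ^+ i * t ^+ i = 1 by rewrite -exprMn /t mulrA divfK // mulfV // expr1n.
    by rewrite -[RHS]mulr1 -e1; ring.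
  by apply: (idM (loc_id hSL)) => //; have := hi _ (hf1 i) => ?; sr.
case: hbu => b0 hbi; exists b^-1; split; [by rewrite invr_neq0 | by [] |].
rewrite invrK /b; have [x1 [y1 hT]] := successor_rlr hsT.
have hTr := rlr_sub hT; apply: (idM (loc_id (rlr_loc hT))).
  suff : T (x / y) by move=> ?; sr.
  have [_] := locat_inv hB hP (adjoin_t t hR) hPt; rewrite -eT.
  by rewrite /t invf_div.
by rewrite eT; apply/(locat_max1 hB hP) => //; exists f.
Qed.
End Tree.

(** * Valuation rings *)

Section Valuations.
Variable F : fieldType.
Implicit Types (A R I J P V S B : F -> Prop) (x y z a b c q t u v : F).

(** Reversing the coefficients passes from one chart to the other for a form of degree [n] in
    [x, y]. *)
Lemma horner_rev R x y n (f : {poly F}) : is_subring R -> x != 0 -> y != 0 -> polyover R f ->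
  (size f <= n.+1)%N ->
  exists g : {poly F}, [/\ polyover R g, (size g <= n.+1)%N, g`_0 = f`_n &
    x ^+ n * f.[y / x] = y ^+ n * g.[x / y]].
Proof.
move=> hR x0 y0 hf sf; exists (\poly_(i < n.+1) f`_(n - i)); split.
- by move=> i; rewrite coef_poly; case: ifP => _; [apply: hf | sr].
- exact: size_poly.
- by rewrite coef_poly /= subn0.
rewrite (horner_coef_wide _ sf) horner_poly !big_distrr /=.
rewrite (reindex_inj rev_ord_inj) /=; apply: eq_bigr => i _.
have hi := ltn_ord i; rewrite subSS.
have e (a b : F) k : a != 0 -> (k <= n)%N -> a ^+ n * (b / a) ^+ k = a ^+ (n - k) * b ^+ k.
  move=> a0 hk; have -> : a ^+ n = a ^+ (n - k) * a ^+ k by rewrite -exprD subnK.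
  by rewrite expr_div_n; field; rewrite expf_neq0.
rewrite ltnS in hi.
rewrite mulrCA e // ?leq_subr // [in RHS]mulrCA e // subKn //.
by rewrite [x ^+ i * _]mulrC.
Qed.

Lemma maxpow_sym R x y n z : rlr R x y -> maxpow R x y n z -> maxpow R y x n z.
Proof.
move=> h [f [hf sf ->]].
have [g [hg sg _ e]] := horner_rev (rlr_sub h) (rlr_x0 h) (rlr_x0 (rlr_sym h)) hf sf.
by exists g.
Qed.

Lemma maxpowM R x y n z c : rlr R x y -> R c -> maxpow R x y n z -> maxpow R x y n (c * z).
Proof.
move=> h hc [f [hf sf ->]]; have hR := rlr_sub h; exists (c%:P * f); split.
- by apply: polyoverM => //; apply: polyoverC.
- apply: leq_trans sf; apply: leq_trans (size_polyMleq _ _) _.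
  by have := size_polyC_leq1 c; set m := size _; set k := size _; clearbody m k; lia.
by rewrite hornerM hornerC mulrCA.
Qed.

Lemma maxpow1 R x y z : rlr R x y -> max_ideal R z -> maxpow R x y 1 z.
Proof.
move=> h hz; have hR := rlr_sub h; have x0 := rlr_x0 h.
have [||g [hg sg e]] := @inmax_div F R x y z%:P 1 h.
- by apply: inmaxC => //; apply: rlr_loc h.
- exact: size_polyC_leq1.
by exists g; split=> //; rewrite expr1 -e hornerC.
Qed.

Lemma maxpow_top R x y n (f : {poly F}) : rlr R x y -> polyover R f -> (size f <= n.+1)%N ->
  exists2 a, R a & x ^+ n * f.[y / x] = x * a + f`_n * y ^+ n.
Proof.
move=> h hf sf; have hR := rlr_sub h; have x0 := rlr_x0 h.
have hxR := rlr_x h; have hyR := rlr_x (rlr_sym h).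
rewrite (horner_coef_wide _ sf) big_ord_recr /= mulrDr.
have -> : x ^+ n * (f`_n * (y / x) ^+ n) = f`_n * y ^+ n.
  by rewrite mulrCA -exprMn mulrC [x * _]mulrC divfK // mulrC.
suff [a ha ->] : divides R x (x ^+ n * \sum_(i < n) f`_i * (y / x) ^+ i) by exists a => //; rewrite mulrC.
have hI := divides_ideal hR hxR.
rewrite big_distrr /=; apply: (id_sum hI) => i _; have hi := ltn_ord i.
exists (f`_i * x ^+ (n - i).-1 * y ^+ i); first by move: (hf i) => ?; sr.
have -> : x ^+ n = x ^+ (n - i).-1 * x * x ^+ i.
  by rewrite -exprSr prednK ?subn_gt0 // -exprD subnK // ltnW.
by rewrite expr_div_n; field; rewrite expf_neq0.
Qed.

(* The order of the strict transform does not increase, and if it stays equal to [r] then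
   the initial form is the [r]-th power of the equation [p] of the point. *)
Lemma strict_transform R x y P (p f : {poly F}) r : rlr R x y -> point R x y P -> pointeq R x y P p ->
  polyover R f -> ~ inmax R f -> (size f <= r.+1)%N -> (0 < r)%N ->
  maxpow (locat (adjoin R (y / x)) P) x p.[y / x] r f.[y / x] ->
  exists u c, [/\ R u, isunit R u, adjoin R (y / x) c & f.[y / x] = u * p.[y / x] ^+ r + x * c].
Proof.
move=> h hp hpg hf nf sf rpos; set t := y / x; set B := adjoin R t => -[g [hg sg e]].
have hR := rlr_sub h; have hL := rlr_loc h; have hB : is_subring B := adjoin_subring t hR.
have hb := point_rlr h hp hpg; case: (hp) => hP hPx _; rewrite -/t -/B in hP hb.
case: (hpg) => hp1 hp2 hp3 hp4.
have [a [a1 [s1 [ha1 hs1 ns1 ea]]] e1] := maxpow_top hb hg sg.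
have [b1 [s2 [hb1 hs2 ns2 eb]]] := hg r.
have s10 := nP_neq0 hP ns1; have s20 := nP_neq0 hP ns2.
(* If [S f'] agrees with [p^n k] modulo the maximal ideal and [S] does not vanish at the point, then
   [p^n] divides [f'] modulo the maximal ideal. *)
have key n (S f' k : {poly F}) : polyover R S -> polyover R f' -> polyover R k -> ~ P S.[t] ->
    inmax R (S * f' - p ^+ n * k) -> exists2 Q, polyover R Q & inmax R (f' - p ^+ n * Q).
  elim: n f' k => [|n IH] f' k hS hf' hk nS ha.
    by exists f' => //; rewrite expr0 mul1r subrr; apply: inmax0.
  have hpn : polyover R (p ^+ n * k).
    apply: polyoverM => //; elim: (n) => [|m IHm]; first by rewrite expr0; apply: polyoverC => //; sr.
    by rewrite exprS; apply: polyoverM.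
  have hPf' : P f'.[t].
    have : P (S.[t] * f'.[t]).
      have -> : S.[t] * f'.[t] = (S * f' - p ^+ n.+1 * k).[t] + p.[t] * (p ^+ n * k).[t].
        by rewrite !hornerE /=; rewrite exprS; ring.
      apply: (idD hP.1); first by apply: (point_inmax h) => //; apply: polyoverB; [|apply: polyoverM|rewrite exprS -mulrA; apply: polyoverM].
      by apply: (idMr hP.1) => //; exists (p ^+ n * k).
    by case/(hP.2.2 _ _ (ex_intro2 _ _ S hS erefl) (ex_intro2 _ _ f' hf' erefl)).
  have [q [rr [hq hrr ra ef' _]]] := pointeq_gen h hP hPx hpg hf' hPf'.
  have ha2 : inmax R (p * (S * q - p ^+ n * k)).
    have -> : p * (S * q - p ^+ n * k) = (S * f' - p ^+ n.+1 * k) - rr * S by rewrite ef' exprS; ring.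
    by apply: inmaxB => //; apply: inmaxM.
  have ha3 : inmax R (S * q - p ^+ n * k).
    apply: contrapT => nn; apply: (gauss hL hp1 _ (pointeq_nallm hpg) nn ha2).
    by apply: polyoverB => //; apply: polyoverM.
  have [Q hQ hQa] := IH q k hS hq hk nS ha3.
  exists Q => //; have -> : f' - p ^+ n.+1 * Q = (q - p ^+ n * Q) * p + rr by rewrite ef' exprS; ring.
  by apply: inmaxD => //; apply: inmaxM.
have [S hS eS] : B (s1 * s2) by sr.
have [K hK eK] : B (b1 * s1) by sr.
have hpr n : polyover R (p ^+ n).
  elim: n => [|m IHm]; first by rewrite expr0; apply: polyoverC => //; sr.
  by rewrite exprS; apply: polyoverM.
have [||Q hQ hQa] := key r S f K hS hf hK.
- by rewrite -eS; apply: (nP_mul hP).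
- apply/(adjoin_x h); first by apply: polyoverB => //; apply: polyoverM.
  have -> : (S * f - p ^+ r * K).[y / x] = a1 * s2 * x.
    rewrite hornerD hornerN !hornerM -/t -eS -eK horner_exp e e1 ea eb; field; by rewrite s10 s20.
  by exists (a1 * s2); [sr |].
have nQ : ~ inmax R Q.
  move=> qa; apply: nf; rewrite -(subrK (p ^+ r * Q) f); apply: inmaxD => //.
  by rewrite mulrC; apply: inmaxM.
have [j [hj hj']] := top_unit hQ nQ.
have ps := pointeq_size h hP hpg.
have p0 : p != 0 by rewrite -lead_coef_eq0; case: hp2.
(* Degree count: [p^r] has degree at least [r], while [f] has degree at most [r]; so the cofactor
   [Q] is a constant modulo the maximal ideal. *)
pose d := (size (p ^+ r)).-1.
have ed : d = ((size p).-1 * r)%N by rewrite /d size_exp.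
have hd : isunit R (p ^+ r)`_d by rewrite -lead_coefE lead_coef_exp; apply: isunitX.
have hu : isunit R (p ^+ r * Q)`_(d + j).
  apply: coefM_unit => // k hk hkd; case: (ltnP d k) => hdk.
    left; rewrite nth_default; first exact: (id0 (loc_id hL)).
    by rewrite -(prednK (n := size (p ^+ r))) // size_poly_gt0 expf_neq0.
  by right; apply: hj'; lia.
have hfdj : f`_(d + j) != 0.
  apply/eqP => f0; have := hQa (d + j)%N; rewrite coefB f0 sub0r => hm.
  by have := idN hR (loc_id hL) hm; rewrite opprK => hm'; apply: (max_isunit hm' hu).
have hdj : (d + j <= r)%N.
  rewrite leqNgt; apply/negP => hlt; move: hfdj; rewrite nth_default ?eqxx //.
  exact: leq_trans sf hlt.
have j0 : j = 0%N.
  move: hdj; rewrite ed; move: ps rpos; case: (size p) => [|[|m]] //= _ hr hh.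
  by rewrite mulSn in hh; move: hh; set mm := (m * r)%N; clearbody mm; lia.
rewrite j0 in hj hj'.
have hQ0 : inmax R (Q - (Q`_0)%:P).
  by move=> [|i]; rewrite coefB coefC /= ?subrr ?subr0; [apply: (id0 (loc_id hL)) | apply: hj'].
have hfin : inmax R (f - (Q`_0)%:P * p ^+ r).
  have -> : f - (Q`_0)%:P * p ^+ r = (f - p ^+ r * Q) + (Q - (Q`_0)%:P) * p ^+ r by ring.
  by apply: inmaxD => //; apply: inmaxM.
have [|c hc ec] := (adjoin_x h _).2 hfin; first by apply: polyoverB => //; apply: polyoverM => //; apply: polyoverC.
exists Q`_0, c; split=> //.
have e5 : f.[t] - Q`_0 * p.[t] ^+ r = c * x.
  by rewrite -ec hornerD hornerN hornerM hornerC horner_exp.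
by rewrite -[LHS](subrK (Q`_0 * p.[t] ^+ r)) e5; ring.
Qed.

Lemma common_den R x y (s : seq F) : rlr R x y ->
  (forall z, z \in s -> locp (adjoin R (y / x)) x z) ->
  exists g : {poly F}, [/\ polyover R g, ~ inmax R g & forall z, z \in s -> adjoin R (y / x) (z * g.[y / x])].
Proof.
move=> h; set t := y / x; have hR := rlr_sub h; have hL := rlr_loc h.
have hB : is_subring (adjoin R t) := adjoin_subring t hR.
elim: s => [|z s IH] hs.
  by exists 1%:P; split=> //; [apply: polyoverC => //; sr | apply: inmax1].
have [w hw|g [hg ng hgs]] := IH; first by apply: hs; rewrite in_cons hw orbT.
have [f [_ [hf [k hk ->] nk e]]] := hs z (mem_head _ _).
have nk' : ~ inmax R k by move=> ka; apply: nk; apply/(adjoin_x h hk).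
have k0 := ndv_neq0 hB nk.
exists (g * k); split; [exact: polyoverM | exact: gauss |].
have hgB : adjoin R t g.[t] by exists g.
have hkB : adjoin R t k.[t] by exists k.
move=> w; rewrite in_cons hornerM => /orP [/eqP ->|/hgs hw]; last by rewrite mulrA; sr.
have -> : z * (g.[t] * k.[t]) = f * g.[t] by rewrite e; field.
by sr.
Qed.

(** * Elimination of indeterminacies along a valuation ring *)

Definition dominated R W := incl R W /\ forall z, max_ideal R z -> max_ideal W z.

Section Elim.
Variable W : F -> Prop.
Hypotheses (hWL : is_local_ring W) (hWv : forall z, z != 0 -> W z \/ W z^-1).
Let hW := loc_sub hWL.

(** The third alternative is the end of the process: [W] contains the order valuation ring of [R'],
    so its center on the blow-up is not a closed point. *)
Definition resolved R z := exists R' x y, [/\ rlr R' x y, incl R R', dominated R' W &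
  [\/ R' z, R' z^-1 | incl (locp (adjoin R' (y / x)) x) W]].

Lemma resolvedV R z : resolved R z -> resolved R z^-1.
Proof.
move=> [R' [x [y [h1 h2 h3 h4]]]]; exists R', x, y; split=> //.
by case: h4 => hh; [constructor 2; rewrite invrK | constructor 1 | constructor 3].
Qed.

Lemma resolved_incl R S z : incl R S -> resolved S z -> resolved R z.
Proof.
move=> hi [R' [x [y [h1 h2 h3 h4]]]]; exists R', x, y; split=> // w hw; exact/h2/hi.
Qed.

(* A pair [f, g] is resolved by induction on the order [r] of [f]. When the order stays equal to
   [r], the parameter [x] is kept and the exponent [N] with [x^N] in [(f, g)] drops by [r]. *)
Definition low_ok r := forall R x y f g, rlr R x y -> dominated R W -> R f -> R g -> f != 0 -> g != 0 ->
  ~ maxpow R x y r f -> resolved R (f / g).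
Definition stable_ok r N := forall R x y f g u c a b, rlr R x y -> dominated R W -> R f -> R g ->
  f != 0 -> g != 0 -> R u -> isunit R u -> R c -> f = u * y ^+ r + x * c ->
  R a -> R b -> x ^+ N = a * f + b * g -> resolved R (f / g).

(** One blow-up, with [x^r] divided out of both members of the pair. Either the order of the first
    member falls below [r], or [strict_transform] supplies the shape required by [stable_ok], and
    the relation persists with [N - r] in place of [N]. *)
Lemma resolve_step r N R x y (f g : {poly F}) a b : (0 < r)%N -> low_ok r ->
  (forall M, (M < N)%N -> stable_ok r M) ->
  rlr R x y -> dominated R W -> W (y / x) -> polyover R f -> polyover R g -> (size f <= r.+1)%N -> (size g <= r.+1)%N ->
  ~ inmax R f -> f.[y / x] != 0 -> g.[y / x] != 0 ->
  R a -> R b -> x ^+ N = a * (x ^+ r * f.[y / x]) + b * (x ^+ r * g.[y / x]) ->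
  resolved R (f.[y / x] / g.[y / x]).
Proof.
move=> rpos hlow hst h [hi hdm] ht hf hg sf sg nf f0 g0 ha hb e.
have hR := rlr_sub h; set t := y / x in ht f0 g0 e *; have hB := adjoin_subring t hR.
have hBR := adjoin_incl t hR; have x0 := rlr_x0 h.
case: (center_point h hWL hi ht (hdm _ (rlr_mx h))) => [[P hp [hPW hPm _]]|hend]; last first.
  by exists R, x, y; split; [exact: h | by [] | by split | constructor 3].
have [p hpg] := point_gen_ex h hp; have hb' := point_rlr h hp hpg; rewrite -/t in hPW hPm hb'.
have hP : is_prime_ideal (adjoin R t) P by case: hp.
have hBS := locat_incl hB hP; set S := locat (adjoin R t) P in hPW hPm hb' hBS.
have hfS : S f.[t] by apply: hBS; exists f.
have hgS : S g.[t] by apply: hBS; exists g.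
have hRS : incl R S by move=> z hz; apply/hBS/hBR.
apply: (resolved_incl hRS).
have hdS : dominated S W by split.
case: (pselect (maxpow S x p.[t] r f.[t])) => hmp; last exact: (hlow S x p.[t]).
have [u [c [hu [u0 hui] hc ef]]] := strict_transform h hp hpg hf nf sf rpos hmp.
(* For [N < r] the relation, divided by [x^N], would make [x] a unit at the point. *)
have hNr : (r <= N)%N.
  rewrite leqNgt; apply/negP => hlt.
  have [_ _ hxu _] := rlr_primein hb'; apply: hxu; split=> //.
  have hSr := rlr_sub hb'; have hxS := rlr_x hb'; have haS := hRS _ ha; have hbS := hRS _ hb.
  have -> : x^-1 = x ^+ (r - N).-1 * (a * f.[t] + b * g.[t]); last by sr.
  apply: (mulfI (expf_neq0 N x0)); apply: (mulfI x0).
  have -> : x * (x ^+ N / x) = x ^+ N by rewrite mulrC divfK.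
  rewrite {1}e.
  have -> : x ^+ r = x * x ^+ (r - N).-1 * x ^+ N.
    by rewrite -exprS prednK ?subn_gt0 // -exprD subnK // ltnW.
  by ring.
have eN : x ^+ (N - r) = a * f.[t] + b * g.[t].
  apply: (mulfI (expf_neq0 r x0)); rewrite -exprD subnKC // e; ring.
apply: (hst (N - r)%N _ S x p.[t] f.[t] g.[t] u c a b) => //; try exact: hRS.
- by rewrite -subn_gt0 subKn.
- by split=> //; apply: hRS.
- exact: hBS.
Qed.

(** The shape of [f] makes the coefficient of [y^r] in its initial form a unit. In the chart of
    [y / x] the induction proceeds; if the center is in the other chart, where [x / y] is a nonunit
    of [W], the transform of [f] is a unit at that center and [g / f] is regular there. *)
Lemma stable_all r N : (0 < r)%N -> low_ok r -> stable_ok r N.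
Proof.
move=> rpos hlow; elim/ltn_ind: N => N IH R x y f g u c a b h hd hf hg f0 g0 hu iu hc ef ha hb e.
have hR := rlr_sub h; have x0 := rlr_x0 h; have y0 := rlr_x0 (rlr_sym h).
have [hi hdm] := hd.
case: (pselect (maxpow R x y r f)) => hmf; last exact: (hlow R x y).
case: (pselect (maxpow R x y r g)) => hmg; last first.
  by rewrite -[f / g]invrK invf_div; apply: resolvedV; apply: (hlow R x y).
case: hmf => f1 [hf1 sf1 e1]; case: hmg => g1 [hg1 sg1 e2].
have xr0 : x ^+ r != 0 by rewrite expf_neq0.
have f10 : f1.[y / x] != 0 by apply: contraNneq f0 => e0; rewrite e1 e0 mulr0.
have g10 : g1.[y / x] != 0 by apply: contraNneq g0 => e0; rewrite e2 e0 mulr0.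
have hl : isunit R f1`_r.
  have [a' ha' e3] := maxpow_top h hf1 sf1.
  have hdv : divides R x ((f1`_r - u) * y ^+ r).
    exists (c - a'); first by sr.
    have : u * y ^+ r + x * c = x * a' + f1`_r * y ^+ r by rewrite -ef e1 -e3.
    move=> e4; rewrite mulrBl mulrBl [c * x]mulrC [a' * x]mulrC.
    by apply/eqP; rewrite subr_eq addrAC eq_sym subr_eq [x * c + _]addrC e4 addrC.
  have hm : max_ideal R (f1`_r - u).
    case: (h) => -[_ _ _ hyR _] hxp hxy; have [_ _ _ hpp] := hxp.
    case: (hpp (f1`_r - u) (y ^+ r)) => //; first by move: (hf1 r) => ?; sr.
    - by sr.
    - by move=> [c' hc' ->]; apply: (idM (loc_id (rlr_loc h))) => //; apply: rlr_mx h.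
    - by move/(primein_exp hR hxp hyR).
  by rewrite -[f1`_r](subrK u) addrC; apply: isunit_addm => //; apply: rlr_loc h.
have t0 : y / x != 0 by rewrite mulf_neq0 ?invr_neq0.
case: (pselect (W (y / x))) => ht.
  have -> : f / g = f1.[y / x] / g1.[y / x] by rewrite e1 e2 -mulf_div mulfV // mul1r.
  apply: (resolve_step (r := r) (N := N) (a := a) (b := b)) => //; last by rewrite -e1 -e2.
  exact: isunit_nallm hl.
have hs : W (x / y) by case: (hWv t0) => //; rewrite invf_div.
have hsm : max_ideal W (x / y) by split=> // -[_]; rewrite invf_div.
have h' := rlr_sym h.
have [f2 [hf2 sf2 c2 e3]] := horner_rev hR x0 y0 hf1 sf1.
have [g2 [hg2 sg2 _ e4]] := horner_rev hR x0 y0 hg1 sg1.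
case: (center_point h' hWL hi hs (hdm _ (rlr_mx h'))) => [[P hp [hPW hPm hPP]]|hend]; last first.
  by exists R, y, x; split; [exact: h' | by [] | by split | constructor 3].
have [p hpg] := point_gen_ex h' hp; have hb' := point_rlr h' hp hpg.
have hP : is_prime_ideal (adjoin R (x / y)) P by case: hp.
have hB := adjoin_subring (x / y) hR; have hBS := locat_incl hB hP.
exists (locat (adjoin R (x / y)) P), y, p.[x / y]; split=> //.
  by move=> z hz; apply/hBS/adjoin_incl.
constructor 2; rewrite invf_div.
have -> : g / f = g2.[x / y] / f2.[x / y].
  by rewrite e1 e2 e3 e4 -mulf_div mulfV ?mul1r // expf_neq0.
exists g2.[x / y], f2.[x / y]; split=> //; [by exists g2 | by exists f2 |].
move=> hPf.
have : P f2`_0.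
  have hPs : P (x / y) by apply/hPP; split=> //; apply: adjoin_t.
  have -> : f2`_0 = f2.[x / y] - (f2 - (f2`_0)%:P).[x / y].
    by rewrite hornerD hornerN hornerC; ring.
  apply: (idB hB hP.1) => //.
  have -> : (f2 - (f2`_0)%:P).[x / y] = (x / y) * \sum_(i < r) f2`_i.+1 * (x / y) ^+ i.
    rewrite hornerD hornerN hornerC (horner_coef_wide _ sf2) big_ord_recl /= expr0 mulr1.
    rewrite [X in X - _]addrC addrK big_distrr /=; apply: eq_bigr => i _.
    by rewrite exprS mulrCA.
  apply: (idMr hP.1) => //; apply: (sr_sum hB) => i _.
  have := adjoin_incl (x / y) hR (hf2 i.+1); have := adjoin_t (x / y) hR => ? ?; sr.
rewrite c2 => hPc; apply: hP.2.1; case: hl => l0 hli.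
rewrite -(mulVf l0); apply: (idM hP.1) => //; exact: adjoin_incl.
Qed.

Lemma low_all r : low_ok r.
Proof.
elim: r => [|r IH] R x y f g h hd hf hg f0 g0 hn.
  case: hn; exists f%:P; split; [exact: polyoverC (rlr_sub h) _ | exact: size_polyC_leq1 |].
  by rewrite expr0 mul1r hornerC.
have hR := rlr_sub h.
(* Common factors are cancelled so that some power [x^N] lies in [(f, g)]; this exponent starts the
   inner induction. *)
wlog hc : f g hf hg f0 g0 hn / coprimein R f g.
  move=> hwlog; have [d [f' [g' [[hdd hf' hg'] e1 e2 hc]]]] := coprime_rep h hf hg f0.
  have d0 : d != 0 by apply: contraNneq f0 => d0; rewrite e1 d0 mul0r.
  have f'0 : f' != 0 by apply: contraNneq f0 => d1; rewrite e1 d1 mulr0.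
  have g'0 : g' != 0 by apply: contraNneq g0 => d1; rewrite e2 d1 mulr0.
  have -> : f / g = f' / g' by rewrite e1 e2 -mulf_div mulfV ?mul1r.
  by apply: hwlog => // hm; apply: hn; rewrite e1; apply: maxpowM.
case: (pselect (maxpow R x y r f)) => hmf; last exact: (IH R x y).
have [hi hdm] := hd.
case: (posnP r) => [r0|rpos].
  exists R, x, y; split=> //; constructor 2; rewrite invf_div.
  case: (maxP hf) => [hm|[_ hfi]]; last by sr.
  by case: hn; rewrite r0; apply: maxpow1.
case: (pselect (maxpow R x y r g)) => hmg; last first.
  by rewrite -[f / g]invrK invf_div; apply: resolvedV; apply: (IH R x y).
have x0 := rlr_x0 h; have y0 := rlr_x0 (rlr_sym h).
(* The orders do not depend on the order of the parameters, and [N] is chosen only after this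
   exchange. *)
wlog ht : x y h hn hmf hmg x0 y0 / W (y / x).
  move=> hwlog; have t0 : y / x != 0 by rewrite mulf_neq0 ?invr_neq0.
  case: (hWv t0) => ht; first exact: (hwlog x y).
  have h' := rlr_sym h; apply: (hwlog y x) => //; try exact: maxpow_sym.
    by move/(maxpow_sym h').
  by rewrite -invf_div.
case: hmf => f1 [hf1 sf1 e1]; case: hmg => g1 [hg1 sg1 e2].
have xr0 : x ^+ r != 0 by rewrite expf_neq0.
have f10 : f1.[y / x] != 0 by apply: contraNneq f0 => e0; rewrite e1 e0 mulr0.
have g10 : g1.[y / x] != 0 by apply: contraNneq g0 => e0; rewrite e2 e0 mulr0.
have nf1 : ~ inmax R f1.
  move=> ha; apply: hn; have [k [hk sk ek]] := inmax_div h ha sf1.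
  by exists k; split=> //; rewrite e1 ek exprSr mulrA.
have [N [a [b [ha hb e]]]] := coprime_pow h hf hg f0 hc (rlr_mx h).
have -> : f / g = f1.[y / x] / g1.[y / x] by rewrite e1 e2 -mulf_div mulfV // mul1r.
apply: (resolve_step (r := r) (N := N) (a := a) (b := b)) => //; last by rewrite -e1 -e2.
by move=> M _; apply: stable_all.
Qed.

Lemma resolve R x y z : rlr R x y -> quotient_field_of R -> dominated R W -> W z ->
  exists R' x' y', [/\ rlr R' x' y', incl R R', dominated R' W &
    R' z \/ incl (locp (adjoin R' (y' / x')) x') W].
Proof.
move=> h hF hd hz; have [f [g [hf [hg [g0 e]]]]] := hF z; have hR := rlr_sub h.
case: (eqVneq f 0) => [f0|f0].
  exists R, x, y; split=> //; left; rewrite e f0 mul0r; sr.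
have z0 : z != 0 by rewrite e mulf_neq0 ?invr_neq0.
have [r hr] : exists r, ~ maxpow R x y r f.
  apply: contrapT => hno; move/eqP: f0; apply.
  have hxR := rlr_x h; have hyR := rlr_x (rlr_sym h); have hL := rlr_loc h; have hN := rlr_noeth h.
  apply: (krull_inter hL hN (zero_ideal hR) (rlr_mx h) hf) => k.
  suff [b hb ->] : divides R (x ^+ k) f by exists b => //; rewrite mulrC subrr.
  apply: (krull_inter hL hN (divides_ideal hR _) (rlr_mx (rlr_sym h)) hf) => [|m]; first by sr.
  have [|a [b [ha hb eb]]] := @maxpow_split F R x y k m f h.
    by apply: contrapT => hn; apply: hno; exists (k + m)%N.
  by exists b => //; exists a => //; rewrite eb; ring.
have [R' [x' [y' [h1 h2 h3 h4]]]] := low_all h hd hf hg f0 g0 hr.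
exists R', x', y'; split=> //; rewrite -e in h4; case: h4 => hh; [by left | | by right].
left; have hR' := rlr_sub h1; case: (maxP hh) => [/(h3.2) [_ []] | [_]].
  by rewrite /isunit invrK invr_neq0.
by rewrite invrK.
Qed.

(** The elements of [s] are resolved one after another. If the process ends with [W] equal to the
    order valuation ring of [S], a point of the exceptional curve that avoids a common denominator
    has a local ring inside [W] containing all of [s]. *)
Lemma valuation_approx R x y (s : seq F) : rlr R x y -> quotient_field_of R -> dominated R W ->
  (forall z, z \in s -> W z) ->
  exists S u v, [/\ rlr S u v, incl R S, incl S W & forall z, z \in s -> S z].
Proof.
move=> h hF hd hs.
have [S [u [v [h1 h2 h3 h4]]]] : exists S u v, [/\ rlr S u v, incl R S, dominated S W &
    (forall z, z \in s -> S z) \/ incl (locp (adjoin S (v / u)) u) W].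
  elim: s hs => [|z s IH] hs; first by exists R, x, y; split=> //; left.
  have [w hw|S [u [v [h1 h2 h3 [h4|h4]]]]] := IH; last by exists S, u, v; split=> //; right.
    by apply: hs; rewrite in_cons hw orbT.
  have [S' [u' [v' [k1 k2 k3 k4]]]] := resolve h1 (frac_incl hF h2) h3 (hs z (mem_head _ _)).
  exists S', u', v'; split=> //; first by move=> w /h2 /k2.
  case: k4 => k4; [left | by right].
  by move=> w; rewrite in_cons => /orP [/eqP -> //|/h4 /k2].
case: h4 => h4; first by exists S, u, v; split=> //; case: h3.
have hS := rlr_sub h1; have hL := rlr_loc h1; set t := v / u in h4.
have hFS := frac_incl hF h2; have hdv := blowup_dvr h1 hFS; rewrite -/t in hdv.
have hB : is_subring (adjoin S t) := adjoin_subring t hS.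
have hWin : incl W (locp (adjoin S t) u).
  apply: (dvr_over hdv hW h4) => hh.
  have [_] := h3.2 _ (rlr_mx h1); apply; split=> //; exact: rlr_x0 h1.
have [g [hg ng hgs]] := common_den h1 (fun z hz => hWin _ (hs z hz)).
have [P hp nP] := point_avoid h1 hg ng; have [p hpg] := point_gen_ex h1 hp.
have hP : is_prime_ideal (adjoin S t) P by case: hp.
exists (locat (adjoin S t) P), u, p.[t]; split.
- exact: (point_rlr h1).
- by move=> w /h2 hw; apply: (locat_incl hB hP); apply: adjoin_incl.
- move=> _ [a [b [ha hb nb ->]]]; apply: h4; exists a, b; split=> //.
  by move=> [c hc e]; apply: nb; rewrite e; apply: (idM hP.1) => //; case: hp.
- move=> z hz; exists (z * g.[t]), g.[t]; split=> //; [exact: hgs | by exists g |].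
  by rewrite mulfK //; apply: (nP_neq0 hP).
Qed.
End Elim.
End Valuations.

(** * Length and finite generation *)

Section Length.
Variable F : fieldType.
Implicit Types (A D M N P X L J : F -> Prop) (x y z a b c u : F).

Definition submod D M := [/\ M 0, forall x y, M x -> M y -> M (x + y) & forall r x, D r -> M x -> M (r * x)].

Lemma submod0 D M : submod D M -> M 0. Proof. by case. Qed.
Lemma submodD D M : submod D M -> forall x y, M x -> M y -> M (x + y). Proof. by case. Qed.
Lemma submodM D M : submod D M -> forall r x, D r -> M x -> M (r * x). Proof. by case. Qed.
Lemma submodB D M : is_subring D -> submod D M -> forall x y, M x -> M y -> M (x - y).
Proof.
move=> hD [_ hA hM] x y hx hy; apply: hA => //; rewrite -mulN1r; apply: hM => //; sr.
Qed.
Lemma submod_sub D A M : incl D A -> submod A M -> submod D M.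
Proof. by move=> hi [h0 hA hM]; split=> // r x /hi; apply: hM. Qed.
Lemma submod_ideal D A : is_ideal D A -> submod D A.
Proof. by case=> _ [h0 [h1 h2]]. Qed.
Lemma submod_ring D A : is_subring A -> incl D A -> submod D A.
Proof. by move=> hA hi; split; [sr | move=> x y ? ?; sr | move=> r x /hi ? ?; sr]. Qed.

Definition scaleadd u N X : F -> Prop := fun z => exists n x, [/\ N n, X x & z = u * n + x].
Definition cap M N : F -> Prop := fun z => M z /\ N z.

Lemma scaleadd_submod D u N X : submod D N -> submod D X -> submod D (scaleadd u N X).
Proof.
move=> hN hX; split.
- by exists 0, 0; split; [apply: submod0 hN | apply: submod0 hX | rewrite mulr0 addr0].
- move=> _ _ [n [x [hn hx ->]]] [n' [x' [hn' hx' ->]]]; exists (n + n'), (x + x').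
  by split; [apply: (submodD hN) | apply: (submodD hX) | ring].
- move=> r _ hr [n [x [hn hx ->]]]; exists (r * n), (r * x).
  by split; [apply: (submodM hN) | apply: (submodM hX) | ring].
Qed.
Lemma cap_submod D M N : submod D M -> submod D N -> submod D (cap M N).
Proof.
move=> hM hN; split; first by split; [apply: submod0 hM | apply: submod0 hN].
  by move=> x y [? ?] [? ?]; split; [apply: (submodD hM) | apply: (submodD hN)].
by move=> r x hr [? ?]; split; [apply: (submodM hM) | apply: (submodM hN)].
Qed.
Lemma scaleadd_r u N X : N 0 -> incl X (scaleadd u N X).
Proof. by move=> h z hz; exists 0, z; split=> //; rewrite mulr0 add0r. Qed.

Fixpoint chain D N M m : Prop :=
  if m is m'.+1 then exists P, [/\ submod D P, chain D N P m', incl P M & ~ incl M P] else incl N M.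
(** For [N] inside [M], this bounds the length of the [D]-module [M / N] by [n]. *)
Definition lenle D N M n := forall m, chain D N M m -> (m <= n)%N.

Lemma incl_trans A B C : incl A B -> incl B C -> @incl F A C.
Proof. by move=> h1 h2 z /h1 /h2. Qed.

Lemma chain_incl D N M m : chain D N M m -> incl N M.
Proof. by elim: m M => [|m IH] M //= [P [_ /IH h1 h2 _]]; apply: incl_trans h2. Qed.
Lemma chain_top D N M M' m : incl M M' -> chain D N M m -> chain D N M' m.
Proof.
case: m => [|m] /= hi; first by move/incl_trans; apply.
move=> [P [h1 h2 h3 h4]]; exists P; split=> //; first exact: incl_trans hi.
by move=> h; apply: h4; apply: incl_trans h.
Qed.
Lemma chain_bot D N N' M m : incl N' N -> chain D N M m -> chain D N' M m.
Proof.
move=> hi; elim: m M => [|m IH] M /=; first exact: incl_trans.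
by move=> [P [h1 h2 h3 h4]]; exists P; split=> //; apply: IH.
Qed.
Lemma chain_cat D N P M (a b : nat) : chain D N P a -> chain D P M b -> chain D N M (a + b)%N.
Proof.
move=> h1; elim: b M => [|b IH] M /=; first by rewrite addn0 => h; apply: chain_top h1.
by rewrite addnS => -[Q [h2 h3 h4 h5]]; exists Q; split=> //; apply: IH.
Qed.
Lemma lenle_mono D N N' M M' n n' : incl N N' -> incl M' M -> (n <= n')%N ->
  lenle D N M n -> lenle D N' M' n'.
Proof.
move=> h1 h2 h3 hl m hm; apply: leq_trans h3; apply: hl.
by apply: chain_top h2 _; apply: chain_bot hm.
Qed.

(** By the modular law, a strict step stays strict either after intersection with [M1] or after
    adding [M1]. *)
Lemma chain_split D N M M1 m : is_subring D -> submod D M -> submod D M1 -> chain D N M m ->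
  exists a b : nat, [/\ (m <= a + b)%N, chain D (cap N M1) (cap M M1) a & chain D (scaleadd 1 N M1) (scaleadd 1 M M1) b].
Proof.
move=> hD + hM1; elim: m M => [|m IH] M hM /=.
  move=> h; exists 0%N, 0%N; split=> //; first by move=> z [/h ? ?].
  by move=> z [n [x [/h hn hx ->]]]; exists n, x.
move=> [P [hP hl hPM hMP]]; have [a [b [h1 h2 h3]]] := IH P hP hl.
have hc : incl (cap P M1) (cap M M1) by move=> z [/hPM ? ?].
have hs : incl (scaleadd 1 P M1) (scaleadd 1 M M1) by move=> z [n [x [/hPM hn hx ->]]]; exists n, x.
case: (pselect (incl (cap M M1) (cap P M1))) => h4; last first.
  exists a.+1, b; split; [by rewrite addSn | | exact: chain_top h3].
  by exists (cap P M1); split=> //; apply: cap_submod.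
exists a, b.+1; split; [by rewrite addnS | exact: chain_top h2 |].
exists (scaleadd 1 P M1); split=> //; first exact: scaleadd_submod.
move=> h5; apply: hMP => z hz.
have [|p [x [hp hx e]]] := h5 z; first by exists z, 0; split=> //; [apply: submod0 hM1 | ring].
have [|hxP _] := h4 x; last by rewrite e mul1r; apply: (submodD hP).
split=> //; have -> : x = z - p by rewrite e; ring.
by apply: (submodB hD hM) => //; apply: hPM.
Qed.

Lemma lenle_add D N M M1 (a b : nat) : is_subring D -> submod D M -> submod D M1 -> N 0 -> incl N M1 -> incl M1 M ->
  lenle D N M1 a -> lenle D M1 M b -> lenle D N M (a + b)%N.
Proof.
move=> hD hM hM1 h0 h1 h2 ha hb m hm; have [a' [b' [e1 e2 e3]]] := chain_split hD hM hM1 hm.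
apply: leq_trans e1 _; apply: leq_add.
  apply: ha; apply: (@chain_top _ _ (cap M M1)); first by move=> z [].
  by apply: chain_bot e2 => z hz; split=> //; apply: h1.
apply: hb; apply: (@chain_top _ _ (scaleadd 1 M M1)).
  by move=> z [n [x [hn hx ->]]]; rewrite mul1r; apply: (submodD hM) => //; apply: h2.
apply: chain_bot e3 => z hz; exists 0, z; split=> //; by ring.
Qed.

Lemma lenle0 D N M : incl M N -> lenle D N M 0.
Proof.
move=> h [|m] //= [P [_ /chain_incl h1 _ h3]]; case: h3; exact: incl_trans h1.
Qed.

(** Chains are pulled back along multiplication by [u], which maps [M / N] onto the quotient of
    [u M + X] by [u N + X]. *)
Lemma chain_scaleadd D N M X m u : is_subring D -> u != 0 -> submod D X -> submod D M -> incl N M -> N 0 ->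
  forall M', submod D M' -> incl M' (scaleadd u M X) ->
  chain D (scaleadd u N X) M' m -> chain D N (fun z => M z /\ M' (u * z)) m.
Proof.
move=> hD u0 hX hM hNM hN0; elim: m => [|m IH] M' hM' hi /=.
  move=> h z hz; split; first exact: hNM.
  by apply: h; exists z, 0; split=> //; [apply: submod0 hX | rewrite addr0].
move=> [P [hP hl hPM hMP]]; exists (fun z => M z /\ P (u * z)); split.
- split; first by rewrite mulr0; split; [apply: submod0 hM | apply: submod0 hP].
    by move=> x y [? ?] [? ?]; rewrite mulrDr; split; [apply: (submodD hM) | apply: (submodD hP)].
  by move=> r x hr [? ?]; rewrite mulrCA; split; [apply: (submodM hM) | apply: (submodM hP)].
- by apply: IH => //; apply: incl_trans hi.
- by move=> z [? /hPM].
move=> h; apply: hMP => z hz; have [n [x [hn hx e]]] := hi z hz.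
have hxP : P x by apply: (chain_incl hl); apply: scaleadd_r.
have [|_ hun] := h n; last by rewrite e; apply: (submodD hP).
split=> //; have -> : u * n = z - x by rewrite e; ring.
by apply: (submodB hD hM') => //; apply: hPM.
Qed.

Lemma lenle_scaleadd D N M X n u : is_subring D -> u != 0 -> submod D X -> submod D M -> incl N M -> N 0 ->
  lenle D N M n -> lenle D (scaleadd u N X) (scaleadd u M X) n.
Proof.
move=> hD u0 hX hM hNM hN0 hl m hm; apply: hl.
have h := chain_scaleadd hD u0 hX hM hNM hN0 (scaleadd_submod u hM hX) (fun z h => h) hm.
by apply: chain_top h => z [].
Qed.

Lemma lenle_cyc D N M z : is_local_ring D -> submod D N ->
  (forall w, M w -> exists n d, [/\ N n, D d & w = n + d * z]) ->
  (forall r, max_ideal D r -> N (r * z)) -> lenle D N M 1.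
Proof.
move=> hL hN hM hz [|[|m]] //= [P [hP [Q [hQ /chain_incl hNQ hQP hPQ]] hPM hMP]].
have hD := loc_sub hL; exfalso.
have [e [heP heQ]] : exists e, P e /\ ~ Q e.
  by apply: contrapT => hno; apply: hPQ => w hw; apply: contrapT => nw; apply: hno; exists w.
have [n [d [hn hd ee]]] := hM _ (hPM _ heP).
have hNP : incl N P by apply: incl_trans hNQ hQP.
case: (maxP hd) => [hm|[d0 hdi]].
  by apply: heQ; apply: hNQ; rewrite ee; apply: (submodD hN) => //; apply: hz.
apply: hMP => w /hM [n' [d' [hn' hd' ->]]]; apply: (submodD hP); first exact: hNP.
apply: (submodM hP) => //.
have -> : z = d^-1 * (e - n) by rewrite ee; field.
apply: (submodM hP) => //; apply: (submodB hD hP) => //; exact: hNP.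
Qed.

(* the quotient [M / N] is a Noetherian [A]-module *)
Definition noethquot A N M := forall P, submod A P -> incl N P -> incl P M ->
  exists2 s : seq F, (forall a, a \in s -> P a) & forall z, P z -> span A N s z.

Lemma span_cat A N s s' : span A N (s ++ s') = span A (span A N s') s.
Proof. by elim: s => //= a s ->. Qed.
Lemma span_mono A N N' s z : incl N N' -> span A N s z -> span A N' s z.
Proof.
by move=> h; elim: s z => [|a s IH] z //=; [apply: h | move=> [i /IH hi hr]; exists i].
Qed.
Lemma span_dec A N s z : span A N s z <-> exists2 n, N n & span A (fun z => z = 0) s (z - n).
Proof.
elim: s z => [|a s IH] z /=.
  split; first by move=> h; exists z => //; rewrite subrr.
  by move=> [n hn /eqP]; rewrite subr_eq0 => /eqP ->.
split.
  move=> [i /IH [n hn hi] [r hr ->]]; exists n => //; exists (i - n) => //; exists r => //; ring.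
move=> [n hn [i hi [r hr e]]]; exists (i + n); first by apply/IH; exists n => //; rewrite addrK.
by exists r => //; rewrite -[z](subrK n) e; ring.
Qed.
Lemma span_submod A N s : is_subring A -> submod A N -> submod A (span A N s).
Proof.
move=> hA hN; elim: s => [|a s IH] //=; split.
- by exists 0; [apply: submod0 IH | exists 0; [sr | ring]].
- move=> x y [i hi [r hr ->]] [j hj [r' hr' ->]]; exists (i + j); first exact: (submodD IH).
  by exists (r + r'); [sr | ring].
- move=> c x hc [i hi [r hr ->]]; exists (c * i); first exact: (submodM IH).
  by exists (c * r); [sr | ring].
Qed.
Lemma span_incl A N s P : submod A P -> incl N P -> (forall a, a \in s -> P a) -> incl (span A N s) P.
Proof.
move=> hP hN; elim: s => [|a s IH] hs //= z [i hi [r hr ->]].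
apply: (submodD hP); first by apply: IH => // b hb; apply: hs; rewrite in_cons hb orbT.
by apply: (submodM hP) => //; apply: hs; rewrite mem_head.
Qed.
Lemma span_rep A N Q s : is_subring A -> submod A N ->
  (forall a, a \in s -> exists2 b, Q b & N (a - b)) ->
  exists2 s', (forall a, a \in s' -> Q a) & forall z, span A N s z -> span A N s' z.
Proof.
move=> hA hN; elim: s => [|a s IH] hs; first by exists [::].
have [b hb|s' hs' hz] := IH; first by apply: hs; rewrite in_cons hb orbT.
have [b hb hab] := hs a (mem_head _ _); exists (b :: s').
  by move=> c; rewrite in_cons => /orP [/eqP -> //|/hs'].
move=> z /= [i /hz hi [r hr ->]]; exists (i + r * (a - b)); last by exists r => //; ring.
have hm := span_submod s' hA hN; apply: (submodD hm) => //; apply: (submodM hm) => //.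
by apply/span_dec; exists (a - b) => //; rewrite subrr; apply: submod0 (span_submod _ hA _);
  split=> // [x y -> ->|r' x _ ->]; rewrite ?addr0 ?mulr0.
Qed.

Lemma noethquot_triv A N M : incl M N -> noethquot A N M.
Proof. by move=> h P _ _ hPM; exists [::] => // z /hPM /h. Qed.
Lemma noethquot_mono A N N' M M' : incl N N' -> incl M' M -> noethquot A N M -> noethquot A N' M'.
Proof.
move=> h1 h2 hf P hP hNP hPM; have [||s hs hz] := hf P hP.
- exact: incl_trans hNP.
- exact: incl_trans h2.
by exists s => // z /hz; apply: span_mono.
Qed.

Lemma noethquot_trans A N0 N1 N2 : is_subring A -> submod A N1 -> incl N1 N2 -> submod A N2 ->
  incl N0 N1 -> noethquot A N0 N1 -> noethquot A N1 N2 -> noethquot A N0 N2.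
Proof.
move=> hA hN1 hi hN2 hi0 h1 h2 P hP hNP hPN.
have [||s1 hs1 hz1] := h1 (cap P N1) (cap_submod hP hN1).
- by move=> z hz; split; [apply: hNP | apply: hi0].
- by move=> z [].
have [||s2 hs2 hz2] := h2 (scaleadd 1 P N1) (scaleadd_submod 1 hP hN1).
- by apply: scaleadd_r; apply: submod0 hP.
- by move=> z [n [x [/hPN hn /hi hx ->]]]; rewrite mul1r; apply: (submodD hN2).
have [|s3 hs3 hz3] := @span_rep A N1 P s2 hA hN1.
  move=> a /hs2 [n [x [hn hx ->]]]; exists n => //.
  by have -> : 1 * n + x - n = x by ring.
exists (s3 ++ s1); first by move=> a; rewrite mem_cat => /orP [/hs3 | /hs1 []].
move=> z hz; rewrite span_cat; have /hz3 /span_dec [n hn hzn] : span A N1 s2 z.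
  by apply: hz2; exists z, 0; split=> //; [apply: submod0 hN1 | ring].
apply/span_dec; exists n => //; apply: hz1; split=> //.
have -> : n = z - (z - n) by ring.
apply: (submodB hA hP) => //; apply: (span_incl hP _ hs3 hzn) => w ->; exact: submod0 hP.
Qed.

(** Multiplication by [u] embeds the quotient of [J] in [A / p], and generators found there are
    divided by [u]. *)
Lemma noethquot_scale A p J u : is_subring A -> submod A p -> u != 0 -> submod A J ->
  (forall z, J z -> A (u * z)) -> incl p A -> noethquot A p A ->
  noethquot A (fun z => J z /\ p (u * z)) J.
Proof.
move=> hA hp u0 hJ huJ hpA hf P hP hNP hPJ.
have [||s hs hz] := hf (scaleadd u P p) (scaleadd_submod u hP hp).
- by apply: scaleadd_r; apply: submod0 hP.
- by move=> z [n [x [/hPJ /huJ hn /hpA hx ->]]]; sr.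
have [|s' hs' hz'] := @span_rep A p (fun w => P (w / u)) s hA hp.
  move=> a /hs [n [x [hn hx ->]]]; exists (u * n); first by rewrite mulrC mulKf.
  by have -> : u * n + x - u * n = x by ring.
exists [seq w / u | w <- s']; first by move=> a /mapP [w /hs' hw ->].
move=> z hPz; have /hz' /span_dec [n hn hzn] : span A p s (u * z).
  by apply: hz; exists z, 0; split=> //; [apply: submod0 hp | ring].
have hsc w : span A (fun z => z = 0) s' w -> span A (fun z => z = 0) [seq w / u | w <- s'] (w / u).
  elim: (s') w => [|a s0 IH] w /=; first by move=> ->; rewrite mul0r.
  by move=> [i /IH hi [r hr ->]]; exists (i / u) => //; exists r => //; ring.
have {}hzn : span A (fun z => z = 0) [seq w / u | w <- s'] (z - n / u).
  by have := hsc _ hzn; rewrite mulrBl [u * z]mulrC mulfK.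
apply/span_dec; exists (n / u) => //; split; last by rewrite mulrC divfK.
apply: hPJ; have -> : n / u = z - (z - n / u) by ring.
apply: (submodB hA hP) => //; apply: (span_incl hP _ _ hzn) => [w ->|]; first exact: submod0 hP.
by move=> a /mapP [w /hs' hw ->].
Qed.

Lemma lenle_noethquot D A N M n : is_subring A -> incl D A -> submod A N -> incl N M -> submod A M ->
  lenle D N M n -> noethquot A N M.
Proof.
move=> hA hDA + + hM; elim: n N => [|n IH] N hN hNM hl P hP hNP hPM.
  exists [::] => //= z hz; apply: contrapT => nz.
  have : chain D N M 1.
    by exists N; split=> //; [apply: submod_sub hN | move=> h; apply: nz; apply/h/hPM].
  by move/hl.
case: (pselect (incl P N)) => h; first by exists [::].
have [z [hzP nz]] : exists z, P z /\ ~ N z.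
  by apply: contrapT => hno; apply: h => w hw; apply: contrapT => nw; apply: hno; exists w.
have hN' : submod A (idealadd A N z) := span_submod [:: z] hA hN.
have hi : incl N (idealadd A N z) by move=> w hw; apply: idealadd_l.
have hzN : idealadd A N z z by exists 0; [apply: submod0 hN | exists 1; [sr | ring]].
have hN'P : incl (idealadd A N z) P.
  by move=> _ [i /hNP hi' [r hr ->]]; apply: (submodD hP) => //; apply: (submodM hP).
have [||||s hs hz] := IH (idealadd A N z) hN' _ _ P hP => //.
- exact: incl_trans hPM.
- move=> m hm; rewrite -ltnS -add1n; apply: hl; apply: (chain_cat (P := idealadd A N z)) => //.
  exists N; split=> //; [exact: submod_sub hN | by move=> hh; apply/nz/hh].
exists (s ++ [:: z]); last by move=> w /hz; rewrite span_cat.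
by move=> a; rewrite mem_cat => /orP [/hs //|]; rewrite inE => /eqP ->.
Qed.

Lemma noeth_of_noethquot A : is_subring A -> (forall a, A a -> a != 0 -> noethquot A (divides A a) A) ->
  noetherian_ring A.
Proof.
move=> hA h I hI; case: (pselect (exists2 a, I a & a != 0)) => [[a ha a0]|hno]; last first.
  apply: (fg_of_span (s := [::]) hA) => //= z hz.
  by apply/eqP; apply: contrapT => z0; apply: hno; exists z => //; apply/negP.
have haA := idR hI ha.
have [||s hs hz] := h a haA a0 I (submod_ideal hI).
- by move=> _ [c hc ->]; apply: (idM hI).
- by move=> z; apply: (idR hI).
apply: (fg_of_span (s := s ++ [:: a]) hA).
  by move=> b; rewrite mem_cat => /orP [/hs //|]; rewrite inE => /eqP ->.
move=> z /hz; rewrite span_cat; apply: span_mono => _ [c hc ->] /=.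
by exists 0 => //; exists c => //; rewrite add0r.
Qed.

(** One witness for each strict step suffices: after multiplication by [u], the chain stays strict
    inside every module [L] that contains the multiples of these finitely many elements. *)
Lemma chain_lift D N M m : is_subring D -> submod D M -> N 0 -> chain D N M m ->
  exists2 bs : seq F, (forall b, b \in bs -> M b) &
  forall u X L, submod D X -> submod D L -> (forall z, M z -> X (u * z) -> N z) ->
  (forall b, b \in bs -> L (u * b)) ->
  chain D (cap (scaleadd u N X) L) (cap (scaleadd u M X) L) m.
Proof.
move=> hD + hN0; elim: m M => [|m IH] M hM /=.
  move=> h; exists [::] => // u X L _ _ _ _ z [[n [x [/h hn hx ->]]] hL]; split=> //.
  by exists n, x.
move=> [P [hP hl hPM hMP]]; have [bs hbs hlift] := IH P hP hl.
have [b [hb nb]] : exists b, M b /\ ~ P b.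
  by apply: contrapT => hno; apply: hMP => w hw; apply: contrapT => nw; apply: hno; exists w.
exists (b :: bs).
  by move=> c; rewrite in_cons => /orP [/eqP -> //|/hbs /hPM].
move=> u X L hX hL hc hbL; exists (cap (scaleadd u P X) L); split.
- by apply: cap_submod => //; apply: scaleadd_submod.
- apply: hlift => //; first by move=> z /hPM; apply: hc.
  by move=> c hcs; apply: hbL; rewrite in_cons hcs orbT.
- by move=> z [[n [x [/hPM hn hx ->]]] hL']; split=> //; exists n, x.
move=> h; have [] := h (u * b).
  split; last by apply: hbL; rewrite mem_head.
  by exists b, 0; split=> //; [apply: submod0 hX | rewrite addr0].
move=> [p [x [hp hx e]]] _; apply: nb.
have : N (b - p).
  apply: hc; first by apply: (submodB hD hM) => //; apply: hPM.
  by have -> : u * (b - p) = x by rewrite mulrBr e; ring.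
by move/(chain_incl hl) => hbp; rewrite -(subrK p b); apply: (submodD hP).
Qed.

(* Krull-Akizuki by counting: if the [m] strict steps of a chain from [cA + p] to [A] are
   multiplied by [1, c, ..., c^(n-1)] one gets [n m] strict steps inside a module [L]. *)
Lemma krull_akizuki D A m c (l : nat) : is_subring D -> is_subring A -> incl D A ->
  submod D m -> A c -> (forall k z, m (c ^+ k * z) -> m z) ->
  (forall k z, m z -> m (c ^+ k * z)) ->
  (forall bs : seq F, (forall b, b \in bs -> A b) -> exists M0 : nat, forall n, exists L,
    [/\ submod D L, forall b j, b \in bs -> (j < n)%N -> L (c ^+ j * b) &
     lenle D (cap (scaleadd (c ^+ n) A m) L) L (M0 + n * l)]) ->
  lenle D (idealadd A (cap A m) c) A l.
Proof.
move=> hD hA hDA hm hc hcu hcm H k hk.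
have hAm := submod_ring hA hDA; set N := idealadd A (cap A m) c in hk.
have hm0 : cap A m 0 by split; [sr | apply: submod0 hm].
have hN0 : N 0 by exists 0 => //; exists 0; [sr | ring].
have [bs hbs hlift] := chain_lift hD hAm hN0 hk.
have [M0 hM0] := H bs hbs.
have key n L : submod D L -> (forall b j, b \in bs -> (j < n)%N -> L (c ^+ j * b)) ->
    chain D (cap (scaleadd (c ^+ n) A m) L) L (n * k).
  move=> hL; elim: n => [|n IH] hb /=; first by move=> z [].
  rewrite mulSn; apply: (chain_cat (P := cap (scaleadd (c ^+ n) A m) L)); last first.
    by apply: IH => b j hb' hj; apply: hb => //; apply: ltnW.
  apply: (chain_bot (N := cap (scaleadd (c ^+ n) N m) L)); last first.
    apply: hlift => //; last by move=> b hb'; apply: hb.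
    move=> z hz /hcu hz'; exists z; first by split.
    by exists 0; [sr | ring].
  move=> z [[a [x [ha hx ->]]] hLz]; split=> //; exists (a * c), x; split=> //.
    by exists 0 => //; exists a => //; rewrite add0r.
  by rewrite exprSr; ring.
(* With [n = M0 + 1], the inequality [n k <= M0 + n l] forces [k <= l]. *)
have [L [hL hbL hlen]] := hM0 M0.+1.
have := hlen _ (key _ L hL hbL).
case: (leqP k l) => // hkl; nia.
Qed.
End Length.

(** * Residue rings at the centers of divisors *)

Section KrullAkizuki.
Variable F : fieldType.
Implicit Types (A D M N P X L J R S V : F -> Prop) (x y z a b c u t w q : F).

(** When [R] dominates [D], this says that the residue field of [R] is a finite extension of that of
    [D], of degree at most [e]. *)
Definition finres D R := exists e, lenle D (max_ideal R) R e.

Lemma finres_refl D : is_local_ring D -> finres D D.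
Proof.
move=> hL; have hD := loc_sub hL; exists 1%N; apply: (lenle_cyc (z := 1) hL).
- exact: submod_ideal (loc_id hL).
- by move=> w hw; exists 0, w; split=> //; [apply: (id0 (loc_id hL)) | ring].
- by move=> r; rewrite mulr1.
Qed.

(** Modulo [M], these are the fractions with fixed denominator [w] whose numerator has degree less
    than [d] in [t]. Each further degree adds at most one copy of the residue field of [R], which is
    the content of [lenle_poly]. *)
Definition polymults R t w M d : F -> Prop :=
  fun z => exists (f : {poly F}) v, [/\ polyover R f, (size f <= d)%N, M v & z = f.[t] / w + v].

Section Poly.
Variables (D R M : F -> Prop) (t w : F) (e : nat).
Hypotheses (hD : is_subring D) (hL : is_local_ring R) (hDR : incl D R) (t0 : t != 0) (w0 : w != 0).
Hypotheses (hM : submod D M) (hRM : forall k j, max_ideal R k -> M (k * (t ^+ j / w))).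
Hypothesis he : lenle D (max_ideal R) R e.
Let hR := loc_sub hL.

Lemma polymults_submod d : submod D (polymults R t w M d).
Proof.
split.
- exists 0, 0; split; [by move=> i; rewrite coef0; sr | by rewrite size_poly0 | exact: submod0 hM |].
  by rewrite horner0 mul0r addr0.
- move=> _ _ [f [v [hf sf hv ->]]] [g [v' [hg sg hv' ->]]]; exists (f + g), (v + v'); split.
  + exact: polyoverD.
  + by apply: leq_trans (size_polyD _ _) _; rewrite geq_max sf.
  + exact: (submodD hM).
  + by rewrite hornerD; ring.
- move=> r _ hr [f [v [hf sf hv ->]]]; exists (r *: f), (r * v); split.
  + by move=> i; rewrite coefZ; have := hDR hr => ?; move: (hf i) => ?; sr.
  + exact: leq_trans (size_scale_leq _ _) sf.
  + exact: (submodM hM).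
  + by rewrite hornerZ; ring.
Qed.
Lemma polymults_base d : incl M (polymults R t w M d).
Proof.
move=> v hv; exists 0, v; split=> //; [by move=> i; rewrite coef0; sr | by rewrite size_poly0 |].
by rewrite horner0 mul0r add0r.
Qed.

Lemma lenle_poly d : lenle D M (polymults R t w M d) (d * e).
Proof.
elim: d => [|d IH].
  apply: lenle0 => _ [f [v [_ sf hv ->]]].
  by move: sf; rewrite leqn0 size_poly_eq0 => /eqP ->; rewrite horner0 mul0r add0r.
rewrite mulSn addnC; have hLd := polymults_submod d.
have hRm := submod_ring hR hDR.
apply: (lenle_add hD (polymults_submod d.+1) hLd _ _ _ IH).
- exact: submod0 hM.
- exact: polymults_base.
- by move=> _ [f [v [hf sf hv ->]]]; exists f, v; split=> //; apply: leqW.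
have u0 : t ^+ d / w != 0 by rewrite mulf_neq0 ?invr_neq0 ?expf_neq0.
have hmR : incl (max_ideal R) R by move=> z [].
have := lenle_scaleadd hD u0 hLd hRm hmR (id0 (loc_id hL)) he; apply: lenle_mono => //.
  move=> _ [n [v [hn hv ->]]]; apply: (submodD hLd) => //; apply: polymults_base.
  by rewrite mulrC; apply: hRM.
move=> _ [f [v [hf sf hv ->]]].
exists f`_d, ((f - f`_d *: 'X^d).[t] / w + v); split=> //.
  exists (f - f`_d *: 'X^d), v; split=> //.
    apply: polyoverB => // i; rewrite coefZ; move: (hf d) (polyoverXn d hR i) => ? ?; sr.
  apply/leq_sizeP => j hj; rewrite coefB coefZ coefXn.
  case: eqP => [->|ne]; first by rewrite mulr1 subrr.
  rewrite mulr0 subr0 nth_default // (leq_trans sf) // ltn_neqAle hj andbT.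
  by apply/eqP => ee; apply: ne.
by rewrite hornerD hornerN hornerZ hornerXn; ring.
Qed.
End Poly.

(** A prime above [P] and [b] would again be a point, so it would equal [P] by [point_max]; hence
    [P] is maximal and [b] is invertible modulo [P]. *)
Lemma point_inv R x y P b : rlr R x y -> point R x y P -> adjoin R (y / x) b -> ~ P b ->
  exists2 c, adjoin R (y / x) c & P (1 - c * b).
Proof.
move=> h hp hb nb; have hR := rlr_sub h; have hB := adjoin_subring (y / x) hR.
case: (hp) => hP hPx [f [hf nf pf]].
have hI : is_ideal (adjoin R (y / x)) (idealadd (adjoin R (y / x)) P b) by apply: idealadd_ideal => //; case: hP.
case: (pselect (idealadd (adjoin R (y / x)) P b 1)) => [[i hi [c hc e]]|hn].
  by exists c => //; rewrite e addrK.
have [|Q [hQ hIQ _]] := prime_avoiding hB (noeth_adjoin hR (rlr_noeth h)) hI (sr1 hB).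
  by move=> n; rewrite expr1n.
have hPQ : incl P Q by move=> z hz; apply/hIQ/idealadd_l.
have hq : point R x y Q by split=> //; [apply: hPQ | exists f; split=> //; apply: hPQ].
by case: nb; apply: (point_max h hp hq hPQ); apply/hIQ/idealadd_r => //; case: hP.
Qed.

(** The residue field of [S] is spanned over that of [R] by the powers of [t] below the degree of
    the equation of the point; this degree multiplies the bound. *)
Lemma finres_successor D R S : is_subring D -> incl D R -> successor R S -> finres D R -> finres D S.
Proof.
move=> hD hDR hs [e he]; have [x [y [P [h _ hp eS]]]] := hs.
have hR := rlr_sub h; have hRL := rlr_loc h; set t := y / x in eS.
have hB : is_subring (adjoin R t) := adjoin_subring t hR.
have x0 := rlr_x0 h; have y0 := rlr_x0 (rlr_sym h).
have t0 : t != 0 by rewrite mulf_neq0 ?invr_neq0.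
have [u [v hSr]] := successor_rlr hs; have hSL := rlr_loc hSr; have hSS := rlr_sub hSr.
have hm := loc_id hSL; have hi := successor_incl hs.
have hP : is_prime_ideal (adjoin R t) P by case: hp.
have hBS : incl (adjoin R t) S by rewrite eS; apply: locat_incl.
have htS : S t by apply: hBS; apply: adjoin_t.
have hsm : submod D (max_ideal S) by apply: submod_sub (submod_ideal hm) => z /hDR /hi.
have [p hpg] := point_gen_ex h hp; case: (hpg) => hp1 hp2 hp3 _.
exists ((size p).-1 * e)%N.
have hkj k j : max_ideal R k -> max_ideal S (k * (t ^+ j / 1)).
  by move=> hk; rewrite divr1; apply: (idMr hm); [sr | apply: (successor_dominated hs)].
have := lenle_poly hD hRL hDR t0 (oner_neq0 _) hsm hkj he (d := (size p).-1); apply: lenle_mono => //.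
move=> z hz; move: (hz); rewrite {1}eS => -[a [b [ha hb nb e1]]].
  have b0 := nP_neq0 hP nb.
  have [c hc hcb] := point_inv h hp hb nb.
  have [f hf ef] : adjoin R t (a * c) by sr.
  have [q [r [hq hr e2 sr]]] := polyover_div h hp1 hp2 hf.
  exists r, (q.[t] * p.[t] + z * (1 - c * b)); split=> //.
  - by rewrite -ltnS prednK // size_poly_gt0 -lead_coef_eq0; case: hp2.
  - apply: (idD hm); apply: (idM hm) => //; first by apply: hBS; exists q.
      by rewrite eS; apply/(locat_max1 hB hP) => //; exists p.
    by rewrite eS; apply/(locat_max1 hB hP) => //; rewrite -/t in hc; sr.
  - have -> : r.[t] = a * c - q.[t] * p.[t] by rewrite ef e2 hornerD hornerM; ring.
    by rewrite e1 divr1; field.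
Qed.

(** A nonzero ideal of the residue ring contains the class of some [c] that is a unit of [V], and
    modulo [c] only a finite length remains. *)
Lemma noethquot_center D A V : is_subring D -> is_subring A -> incl D A -> incl A V -> is_local_ring V ->
  (forall c, A c -> isunit V c -> exists n, lenle D (idealadd A (cap A (max_ideal V)) c) A n) ->
  noethquot A (cap A (max_ideal V)) A.
Proof.
move=> hD hA hDA hAV hL H P hP hNP hPA.
have hVm : submod A (max_ideal V) by apply: submod_sub (submod_ideal (loc_id hL)).
have hp : submod A (cap A (max_ideal V)) by apply: cap_submod => //; apply: submod_ring.
case: (pselect (incl P (cap A (max_ideal V)))) => hi; first by exists [::].
have [c [hc nc]] : exists c, P c /\ ~ cap A (max_ideal V) c.
  by apply: contrapT => hno; apply: hi => w hw; apply: contrapT => nw; apply: hno; exists w.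
have hcA := hPA _ hc.
have hcu : isunit V c by case: (maxP (hAV _ hcA)) => // hm; case: nc.
have [n hn] := H c hcA hcu.
have hid : submod A (idealadd A (cap A (max_ideal V)) c) := span_submod [:: c] hA hp.
have [||s hs hz] := lenle_noethquot hA hDA hid _ (submod_ring hA (fun z h => h)) hn hP _ hPA.
- by move=> _ [i [hi' _] [r hr ->]]; sr.
- by move=> _ [i /hNP hi' [r hr ->]]; apply: (submodD hP) => //; apply: (submodM hP).
exists (s ++ [:: c]); last by move=> w /hz; rewrite span_cat.
by move=> a; rewrite mem_cat => /orP [/hs //|]; rewrite inE => /eqP ->.
Qed.

(** Quantifying over all rings between [D] and [V] makes this a property of the divisor alone, which
    can be recorded along the tree before it is applied to [O_U]. *)
Definition noethcenter D V := (exists p, dvr V p) /\ forall A, is_subring A -> incl D A -> incl A V ->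
  noethquot A (cap A (max_ideal V)) A.

Lemma isunit_exp_max V c : is_local_ring V -> V c -> isunit V c ->
  (forall k z, max_ideal V (c ^+ k * z) -> max_ideal V z) /\
  (forall k z, max_ideal V z -> max_ideal V (c ^+ k * z)).
Proof.
move=> hL hc [c0 hci]; have hV := loc_sub hL; have hm := loc_id hL; split=> k z hz.
  have -> : z = (c^-1) ^+ k * (c ^+ k * z) by rewrite exprVn mulKf // expf_neq0.
  by apply: (idM hm) => //; sr.
by apply: (idM hm) => //; sr.
Qed.

(** Let [c = C1(t) / C0(t)] and let [G] be a common denominator of the elements [bs]. For [j < n]
    the products [c^j b] are fractions with denominator [G C0^n] and numerator of size at most
    [d0 + n dl]. The module of such fractions has length at most [(d0 + n dl) e] modulo the maximal
    ideal of [V], so the slope in [n] is [dl e]. *)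
Lemma noethcenter_blowup D R x y : is_subring D -> incl D R -> rlr R x y -> quotient_field_of R ->
  finres D R -> noethcenter D (locp (adjoin R (y / x)) x).
Proof.
move=> hD hDR h hF [e he]; have hdv := blowup_dvr h hF; split; first by exists x.
move=> A hA hDA hAV; set t := y / x in hdv hAV *; set V := locp _ _ in hdv hAV *.
have hVL := dvr_loc hdv; have hV := loc_sub hVL; have hm := loc_id hVL.
apply: (noethquot_center hD hA hDA hAV hVL) => c hc hcu.
have hR := rlr_sub h; have hRL := rlr_loc h; have hB : is_subring (adjoin R t) := adjoin_subring t hR.
have hcV := hAV _ hc; have [_ [_ [[C1 hC1 ->] [C0 hC0 ->] nC0 ec]]] := hcV.
have c00 := ndv_neq0 hB nC0.
have hpx := adjoin_primein h; rewrite -/t in hpx.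
have hBV : incl (adjoin R t) V by apply: locp_incl.
have hRB : incl R (adjoin R t) by apply: adjoin_incl.
have hmsm : submod D (max_ideal V) by apply: submod_sub (submod_ideal hm) => z /hDA /hAV.
have [h1 h2] := isunit_exp_max hVL hcV hcu.
have t0 : t != 0 by rewrite mulf_neq0 ?invr_neq0 //; [apply: rlr_x0 (rlr_sym h) | apply: rlr_x0 h].
pose dl := maxn (size C0) (size C1).
exists (dl * e)%N; apply: krull_akizuki => // bs hbs.
have hVu (g : {poly F}) : polyover R g -> ~ divides (adjoin R t) x g.[t] -> V (g.[t])^-1.
  by move=> hg ng; have [] := @locp_isunit F (adjoin R t) x g.[t] (sr1 hB) ng (ex_intro2 _ _ g hg erefl) (ndv_neq0 hB ng).
have [G [d0 [hG nG hGb]]] : exists (G : {poly F}) d0, [/\ polyover R G, ~ divides (adjoin R t) x G.[t] &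
    forall b, b \in bs -> exists f : {poly F}, [/\ polyover R f, (size f <= d0)%N & b * G.[t] = f.[t]]].
  elim: bs hbs => [|b bs IH] hbs.
    exists 1%:P, 0%N; split=> //; first by apply: polyoverC => //; sr.
    by rewrite hornerC; have [_ []] := primein_prime hB hpx.
  have [w hw|G [d0 [hG nG hGb]]] := IH; first by apply: hbs; rewrite in_cons hw orbT.
  have [_ [_ [[f hf ->] [k hk ->] nk eb]]] := hAV _ (hbs b (mem_head _ _)).
  have k0 := ndv_neq0 hB nk.
  exists (G * k), (maxn (size (f * G)%R) (d0 + size k)); split; first exact: polyoverM.
    rewrite hornerM; case: hpx => _ _ _ hpp /hpp [] //; [by exists G | by exists k].
  move=> w; rewrite in_cons => /orP [/eqP ->|/hGb [g [hg sg eg]]].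
    exists (f * G); split; [exact: polyoverM | by rewrite leq_maxl |].
    by rewrite eb !hornerM; field.
  exists (g * k); split; [exact: polyoverM | | by rewrite !hornerM -eg mulrA].
  apply: leq_trans (leq_maxr _ _); apply: leq_trans (size_polyMleq _ _) _.
  by apply: leq_trans (leq_pred _) _; rewrite leq_add2r.
have G0 := ndv_neq0 hB nG.
exists (d0 * e)%N => n; pose w := G.[t] * C0.[t] ^+ n.
have w0 : w != 0 by rewrite mulf_neq0 ?expf_neq0.
have hwi : V w^-1.
  by rewrite /w invfM -exprVn; have := hVu _ hG nG; have := hVu _ hC0 nC0 => ? ?; sr.
have hRM k j : max_ideal R k -> max_ideal V (k * (t ^+ j / w)).
  move=> hk; apply: (idMr hm).
    by have : V t by [apply/hBV/adjoin_t]; move=> ?; sr.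
  have hkB : adjoin R t k by apply: hRB; case: hk.
  by apply/(locp_max hB hpx hkB); apply: adjoin_m.
exists (polymults R t w (max_ideal V) (d0 + n * dl)); split.
- exact: polymults_submod.
- move=> b j /hGb [f [hf sf ef]] hj.
  have hpw (g : {poly F}) k : polyover R g -> polyover R (g ^+ k).
    by move=> hg; elim: k => [|k IHk]; rewrite ?expr0 ?exprS; [apply: polyoverC => //; sr | apply: polyoverM].
  have spw (g : {poly F}) k : (size g <= dl)%N -> (size (g ^+ k)%R <= (k * dl).+1)%N.
    move=> sg; apply: leq_trans (size_poly_exp_leq _ _) _; rewrite ltnS mulnC leq_mul2l.
    by apply/orP; right; apply: leq_trans (leq_pred _) sg.
  exists (f * (C1 ^+ j * C0 ^+ (n - j))), 0; split.
  + by apply: polyoverM => //; apply: polyoverM; [|apply: hpw|apply: hpw].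
  + apply: leq_trans (size_polyMleq _ _) _.
    have s1 : (size (C1 ^+ j)%R <= (j * dl).+1)%N by apply: spw; apply: leq_maxr.
    have s2 : (size (C0 ^+ (n - j))%R <= ((n - j) * dl).+1)%N by apply: spw; apply: leq_maxl.
    have s3 := size_polyMleq (C1 ^+ j) (C0 ^+ (n - j)).
    have e3 : (n * dl = j * dl + (n - j) * dl)%N by rewrite -mulnDl subnKC // ltnW.
    move: s1 s2 s3 sf; rewrite e3.
    set k1 := size _; set k2 := size _; set k3 := size _; set k4 := size _.
    set k5 := (_ * dl)%N; set k6 := (_ * dl)%N; clearbody k1 k2 k3 k4 k5 k6; lia.
  + exact: submod0 hmsm.
  + rewrite !hornerM !horner_exp -ef addr0 ec /w.
    have -> : C0.[t] ^+ n = C0.[t] ^+ (n - j) * C0.[t] ^+ j by rewrite -exprD subnK // ltnW.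
    by rewrite expr_div_n; field; rewrite G0 !expf_neq0.
- have := lenle_poly hD hRL hDR t0 w0 hmsm hRM he (d := (d0 + n * dl)%N).
  apply: lenle_mono => //; last by rewrite mulnDl mulnA.
  move=> z hz; split; last exact: polymults_base.
  by apply: scaleadd_r => //; sr.
Qed.

Lemma lenle_yz D x N z k : is_local_ring D -> submod D N -> D x -> forall y, genby D x y ->
  D y -> D z -> N (x * z) -> N (y ^+ k * z) ->
  lenle D N (idealadd D N z) k.
Proof.
move=> hL hN hx y hg hy; have hD := loc_sub hL; elim: k N hN z => [|k IH] N hN z hz hxz hyz.
  apply: lenle0 => _ [i hi [r hr ->]]; apply: (submodD hN) => //; apply: (submodM hN) => //.
  by move: hyz; rewrite expr0 mul1r.
pose N' := idealadd D N (y ^+ k * z).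
have hN' : submod D N' := span_submod [:: y ^+ k * z] hD hN.
have hNN : incl N N' by move=> w hw; apply: idealadd_l.
have hyN : N' (y ^+ k * z) by exists 0; [apply: submod0 hN | exists 1; [sr | ring]].
rewrite -add1n.
apply: (lenle_mono (N := N) (M := idealadd D N' z) (n := (1 + k)%N)) => //.
  by move=> _ [i hi [r hr ->]]; exists i; [apply: hNN | exists r].
apply: (lenle_add hD (span_submod [:: z] hD hN') hN').
- exact: submod0 hN.
- exact: hNN.
- by move=> w hw; apply: idealadd_l.
- apply: (lenle_cyc (z := y ^+ k * z) hL hN).
    by move=> _ [i hi [r hr ->]]; exists i, r.
  move=> r /hg [r1 [r2 [h1 [h2 ->]]]].
  have -> : (r1 * x + r2 * y) * (y ^+ k * z) = (r1 * y ^+ k) * (x * z) + r2 * (y ^+ k.+1 * z).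
    by rewrite exprS; ring.
  by apply: (submodD hN); apply: (submodM hN) => //; sr.
- by apply: IH => //; apply: hNN.
Qed.

(** Filtering by powers of [x], each layer is cyclic and annihilated by [x] and [y^m], hence of
    length at most [m] by [lenle_yz]. *)
Lemma lenle_artin D x y I n m : rlr D x y -> is_ideal D I -> I (x ^+ n) -> I (y ^+ m) ->
  exists k, lenle D I D k.
Proof.
move=> h hI; have hD := rlr_sub h; have hL := rlr_loc h; have hx := rlr_x h.
have hy := rlr_x (rlr_sym h).
elim: n I hI => [|n IH] I hI hIx hIy.
  exists 0%N; apply: lenle0 => z hz; rewrite -[z]mulr1; exact: (idM hI hz hIx).
have hxn : D (x ^+ n) by sr.
have hI' := idealadd_ideal hD hI hxn.
have [||k hk] := IH (idealadd D I (x ^+ n)) hI'; first exact: idealadd_r.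
  by apply: idealadd_l.
exists (m + k)%N; apply: (lenle_add hD _ (submod_ideal hI')) hk.
- by apply: submod_ring.
- exact: id0 hI.
- by move=> z hz; apply: idealadd_l.
- by move=> z; apply: (idR hI').
apply: (lenle_yz hL (submod_ideal hI) hx (rlr_gen h) hy) => //; first by rewrite -exprS.
by apply: (idMr hI).
Qed.

Lemma lenle_primein D x y q c : rlr D x y -> primein D q -> D c -> ~ divides D q c ->
  exists k, lenle D (idealadd D (divides D q) c) D k.
Proof.
move=> h hq hc nc; have hD := rlr_sub h; case: (hq) => hqD q0 hqu hqp.
have hcop : coprimein D q c.
  move=> p [hpD p0 hpu hpp] [s hs e] hpc.
  case: (hqp s p hs hpD); first by rewrite -e; apply: divides_refl.
    move=> [r hr er]; apply: hpu; split=> //.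
    have e1 : r * p = 1 by apply: (mulIf q0); rewrite mul1r {2}e er; ring.
    by have -> : p^-1 = r by rewrite -[r](mulfK p0) e1 mul1r.
  by move=> hqp'; apply: nc; apply: divides_trans hqp' hpc.
have [N [r [s [hr hs e]]]] := coprime_pow h hqD hc q0 hcop (rlr_mx h).
have [N' [r' [s' [hr' hs' e']]]] := coprime_pow h hqD hc q0 hcop (rlr_mx (rlr_sym h)).
apply: (lenle_artin (n := N) (m := N') h); first by apply: idealadd_ideal => //; apply: divides_ideal.
  by exists (r * q); [exists r | exists s].
by exists (r' * q); [exists r' | exists s'].
Qed.

(** The classical case of Krull-Akizuki, over the one-dimensional domain [D / qD]. If [g] is a
    common denominator of the chosen elements, [L] is generated by the inverse of [g] over [D],
    modulo the maximal ideal of [V]; the constant [k] is a length modulo [(q, g)] and the slope [l]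
    a length modulo [(q, c)]. *)
Lemma noethcenter_locp D x y q : rlr D x y -> quotient_field_of D -> primein D q -> noethcenter D (locp D q).
Proof.
move=> h hF hq; have hD := rlr_sub h; have hdv := locp_dvr hD (rlr_noeth h) hF hq.
split; first by exists q.
move=> A hA hDA hAV; set V := locp _ _ in hdv hAV *.
have hVL := dvr_loc hdv; have hV := loc_sub hVL; have hm := loc_id hVL.
apply: (noethquot_center hD hA hDA hAV hVL) => c' hc' hcu'.
have [c [c0 [hc hc0 nc0 ec]]] := hAV _ hc'.
have c00 := ndv_neq0 hD nc0; case: (hcu') => c'0 hci'.
have hDV : incl D V by apply: locp_incl.
have nc : ~ divides D q c.
  move/(locp_max hD hq hc) => -[_]; apply.
  have c_0 : c != 0 by apply: contraNneq c'0 => e; rewrite ec e mul0r.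
  split=> //; have -> : c^-1 = c'^-1 * c0^-1.
    by rewrite ec invf_div mulrAC mulfV // mul1r.
  by have [_ ?] := locp_isunit (sr1 hD) nc0 hc0 c00; sr.
have c_0 := ndv_neq0 hD nc.
have [l hl] := lenle_primein h hq hc nc; exists l.
(* The element [c'] is replaced by its numerator [c = c' c0] in [D], which generates a smaller ideal
   of [A]. *)
apply: (lenle_mono (N := idealadd A (cap A (max_ideal V)) c) (M := A) (n := l)) => //.
  move=> _ [i hi [r hr ->]]; exists i => //; exists (r * c0); first by have := hDA _ hc0 => ?; sr.
  by rewrite ec; field.
have hcu : isunit V c by apply: locp_isunit => //; sr.
have [h1 h2] := isunit_exp_max hVL (hDV _ hc) hcu.
have hmsm : submod D (max_ideal V) by apply: submod_sub (submod_ideal hm).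
apply: krull_akizuki => //; first exact: hDA.
move=> bs hbs.
have [g [hg ng hgb]] : exists g, [/\ D g, ~ divides D q g & forall b, b \in bs -> D (g * b)].
  elim: bs hbs => [|b bs IH] hbs.
    by exists 1; split=> //; [sr | have [_ []] := primein_prime hD hq].
  have [w hw|g [hg ng hgb]] := IH; first by apply: hbs; rewrite in_cons hw orbT.
  have [f [k [hf hk nk eb]]] := hAV _ (hbs b (mem_head _ _)).
  have k0 := ndv_neq0 hD nk.
  exists (g * k); split; first by sr.
    by case: hq => _ _ _ hpp /(hpp _ _ hg hk) [].
  move=> w; rewrite in_cons => /orP [/eqP ->|/hgb hw]; last by rewrite mulrAC; sr.
  by have -> : g * k * b = g * f by [rewrite eb; field]; sr.
have g0 := ndv_neq0 hD ng.
have [_ hgi] : isunit V g by apply: locp_isunit => //; sr.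
have [k hk] := lenle_primein h hq hg ng.
have hDD : submod D D := submod_ring hD (fun z h => h).
have hqid : is_ideal D (divides D q) by apply: divides_ideal => //; case: hq.
have hqV z : divides D q z -> max_ideal V z by move=> hz; apply/(locp_max hD hq) => //; apply: (idR hqid).
have hid a : D a -> incl (idealadd D (divides D q) a) D /\ idealadd D (divides D q) a 0.
  move=> ha; have hh := idealadd_ideal hD hqid ha; split; first by move=> z; apply: (idR hh).
  exact: id0 hh.
exists k => n; exists (scaleadd g^-1 D (max_ideal V)); split.
- exact: scaleadd_submod.
- move=> b j /hgb hb _; exists (c ^+ j * (g * b)), 0; split; [sr | exact: submod0 hmsm |].
  by field.
have hpow m : lenle D (scaleadd (c ^+ m) D (max_ideal V)) (scaleadd 1 D (max_ideal V)) (m * l).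
  elim: m => [|m IH]; first by apply: lenle0; rewrite expr0.
  rewrite mulSn; apply: (lenle_add hD (scaleadd_submod 1 hDD hmsm) (scaleadd_submod (c ^+ m) hDD hmsm)) IH.
  - by apply: scaleadd_r => //; [sr | apply: submod0 hmsm].
  - move=> _ [a [v [ha hv ->]]]; exists (c * a), v; split=> //; first by sr.
    by rewrite exprSr; ring.
  - move=> _ [a [v [ha hv ->]]]; exists (c ^+ m * a), v; split=> //; first by sr.
    by ring.
  - have [i1 i2] := hid c hc.
    have := lenle_scaleadd hD (expf_neq0 m c_0) hmsm hDD i1 i2 hl; apply: lenle_mono => //.
    move=> _ [_ [v [[i hi [r hr ->]] hv ->]]]; exists r, (c ^+ m * i + v); split=> //.
      by apply: (idD hm) => //; apply: h2; apply: hqV.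
    by rewrite exprSr; ring.
have hfirst : lenle D (scaleadd 1 D (max_ideal V)) (scaleadd g^-1 D (max_ideal V)) k.
  have [i1 i2] := hid g hg.
  have := lenle_scaleadd hD (invr_neq0 g0) hmsm hDD i1 i2 hk; apply: lenle_mono => //.
  move=> _ [_ [v [[i hi [r hr ->]] hv ->]]]; exists r, (g^-1 * i + v); split=> //.
    by apply: (idD hm) => //; apply: (idM hm) => //; apply: hqV.
  by field.
rewrite addnC.
apply: (lenle_mono (N := scaleadd (c ^+ n) D (max_ideal V)) (M := scaleadd g^-1 D (max_ideal V)) (n := (n * l + k)%N)) => //.
  move=> _ [a [v [ha hv ->]]]; split; first by exists a, v; split=> //; apply: hDA.
  exists (g * c ^+ n * a), v; split=> //; first by sr.
  by field.
apply: (lenle_add hD (scaleadd_submod _ hDD hmsm) (scaleadd_submod 1 hDD hmsm)) (hpow n) hfirst.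
- by apply: scaleadd_r => //; [sr | apply: submod0 hmsm].
- move=> _ [a [v [ha hv ->]]]; exists (c ^+ n * a), v; split=> //; first by sr.
  by ring.
- move=> _ [a [v [ha hv ->]]]; exists (g * a), v; split=> //; first by sr.
  by field.
Qed.
End KrullAkizuki.

(** * Intersections of discrete valuation rings *)

Section MoriNishimura.
Variable F : fieldType.
Implicit Types (A B J V : F -> Prop) (x y z a p u w f : F) (L : seq (F -> Prop)).

Lemma In_cat (T : Type) (v : T) (s1 s2 : seq T) :
  List.In v (s1 ++ s2) <-> List.In v s1 \/ List.In v s2.
Proof. by elim: s1 => [|a s IH] /=; [tauto | rewrite IH; tauto]. Qed.
Lemma In_split (T : Type) (v : T) (s : seq T) : List.In v s -> exists s1 s2, s = s1 ++ v :: s2.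
Proof.
elim: s => [|a s IH] //= [->|/IH [s1 [s2 ->]]]; first by exists [::], s.
by exists (a :: s1), s2.
Qed.
Lemma In_mid (T : Type) (v w : T) (s1 s2 : seq T) :
  List.In w (s1 ++ v :: s2) <-> w = v \/ List.In w (s1 ++ s2).
Proof. by rewrite !In_cat /=; split; [case; [|case] | case; [|case]]; auto. Qed.

Lemma dvr_zero_form V p z : dvr V p -> max_ideal V z -> z != 0 ->
  exists k n, [/\ V k, isunit V k & z = k * p ^+ n.+1].
Proof.
move=> hd hz z0; case: (hd) => hV hp p0 hpi /(_ z z0) [k [n [hk [k0 hki] e]]].
case: n e => [|n] e.
  by case: hz => _; case; split=> //; case: e => ->; rewrite expr0 ?mulr1 ?divr1.
case: e => e; first by exists k, n.
case: hpi; have -> : p^-1 = z * k^-1 * p ^+ n.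
  by rewrite e exprS; field; rewrite p0 k0 expf_neq0.
by have := idR (loc_id (dvr_loc hd)) hz => ?; sr.
Qed.
Lemma dvr_pole_form V p z : dvr V p -> ~ V z ->
  exists k n, [/\ V k, isunit V k & z = k / p ^+ n.+1].
Proof.
case=> hV hp p0 hpi h nz.
have z0 : z != 0 by apply/eqP => z0; apply: nz; rewrite z0; sr.
have [k [n [hk iu [e|e]]]] := h z z0; first by case: nz; rewrite e; sr.
by case: n e => [|n] e; [case: nz; rewrite e expr0 divr1 | exists k, n].
Qed.

Lemma dvr_absorb V p w f : dvr V p -> max_ideal V w -> exists N, forall n, (N <= n)%N -> V (w ^+ n * f).
Proof.
move=> hd /(dvr_maxP _ hd) [c hc ew]; case: (hd) => hV hp p0 _ h.
have hw : V w by rewrite ew; sr.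
case: (eqVneq f 0) => [->|f0]; first by exists 0%N => n _; rewrite mulr0; sr.
have [k [m [hk _ [->|->]]]] := h f f0; first by exists 0%N => n _; sr.
exists m => n hmn.
have -> : w ^+ n * (k / p ^+ m) = w ^+ (n - m) * c ^+ m * k.
  rewrite -{1}(subnK hmn) exprD {2}ew exprMn; field; by rewrite expf_neq0.
sr.
Qed.

Lemma dvr_absorb_list L w f : (forall V, List.In V L -> (exists p, dvr V p) /\ max_ideal V w) ->
  exists N, forall V, List.In V L -> V (w ^+ N * f).
Proof.
move=> h; suff [N hN] : exists N, forall n, (N <= n)%N -> forall V, List.In V L -> V (w ^+ n * f).
  by exists N; apply: hN.
elim: L h => [|V L IH] h; first by exists 0%N.
have [V' hV'|N hN] := IH; first by apply: h; right.
have [[p hd] hm] := h V (or_introl erefl); have [M hM] := dvr_absorb f hd hm.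
exists (maxn N M) => n; rewrite geq_max => /andP [h1 h2] V' [<-|hV']; [exact: hM | exact: hN].
Qed.

Section Irredundant.
Variables (A B V : F -> Prop) (p a u0 : F) (L : seq (F -> Prop)).
Hypotheses (hA : is_subring A) (hF : quotient_field_of A) (hB : is_subring B).
Hypotheses (ha : A a) (a0 : a != 0) (hai : B a^-1) (hd : dvr V p).
Hypothesis hAP : forall z, A z <-> [/\ B z, V z & forall V', List.In V' L -> V' z].
Hypothesis hVa : max_ideal V a.
Hypothesis hLa : forall V', List.In V' L -> (exists p, dvr V' p) /\ max_ideal V' a.
Hypotheses (hu0 : B u0) (hu1 : forall V', List.In V' L -> V' u0) (hu2 : ~ V u0).

(* [w = a^(d+1) u0^(l+1)] is a unit at [V] and vanishes at the other valuations, so a power of it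
   removes their poles from the element [f] of [B], whose value at [V] is [-e]. *)
Lemma exact_pole e : exists u k, [/\ B u, forall V', List.In V' L -> V' u, V k, isunit V k & u = k / p ^+ e].
Proof.
case: (hd) => hV hp p0 hpi _.
have [al [l [hal ial ea]]] := dvr_zero_form hd hVa a0.
have [mu [d [hmu imu eu]]] := dvr_pole_form hd hu2.
have haB : B a by case/hAP: ha.
have pn n : p ^+ n != 0 by rewrite expf_neq0.
pose w := a ^+ d.+1 * u0 ^+ l.+1.
have hwB : B w by rewrite /w; sr.
have ew : w = al ^+ d.+1 * mu ^+ l.+1.
  rewrite /w ea eu exprMn expr_div_n -!exprM [(d.+1 * l.+1)%N]mulnC; field; exact: pn.
have hwV : V w by rewrite ew; sr.
have iw : isunit V w by rewrite ew; apply: isunitM => //; apply: isunitX.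
have [d1 [d2 [hd1 [hd2 [d20 ep]]]]] := hF p.
have hd2m : max_ideal V (d2 * a).
  by apply: (idM (loc_id (dvr_loc hd))) => //; case/hAP: hd2.
have [be [k [hbe ibe e2]]] := dvr_zero_form hd hd2m (mulf_neq0 d20 a0).
have e1 : d1 * a = be * p ^+ k.+2.
  by rewrite exprSr mulrA -e2 ep; field.
pose K := k.+1.
(* At [V] the elements [d1 a] and [d2 a] have the consecutive values [k + 2] and [k + 1], and [a]
   has value [l + 1]. Since [k (k + 2) - (k + 1)^2 = -1], these exponents give [f] the value [-e].
   Only [a], which is invertible in [B], is inverted. *)
pose f := (d1 * a) ^+ (e * k) * (d2 * a) ^+ (e * K * l) * a^-1 ^+ (e * K * K).
have hfB : B f.
  have : B d1 by case/hAP: hd1.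
  have : B d2 by case/hAP: hd2.
  by move=> ? ?; rewrite /f; sr.
pose g := be ^+ (e * k) * be ^+ (e * K * l) * al^-1 ^+ (e * K * K).
have hal0 : al != 0 by case: ial.
have ef : f = g / p ^+ e.
  have q1 : (be * p ^+ k.+2) ^+ (e * k) = be ^+ (e * k) * p ^+ (k.+2 * (e * k)) by rewrite exprMn -exprM.
  have q2 : (be * p ^+ k.+1) ^+ (e * K * l) = be ^+ (e * K * l) * p ^+ (k.+1 * (e * K * l)) by rewrite exprMn -exprM.
  have q3 : (al * p ^+ l.+1)^-1 ^+ (e * K * K) = al^-1 ^+ (e * K * K) * p ^- (l.+1 * (e * K * K)).
    by rewrite invfM exprMn; congr (_ * _); rewrite exprVn -exprM.
  have ex1 : (k.+2 * (e * k) + k.+1 * (e * K * l) + e = l.+1 * (e * K * K))%N by rewrite /K; ring.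
  have ex2 : p ^+ (k.+2 * (e * k)) * p ^+ (k.+1 * (e * K * l)) * p ^- (l.+1 * (e * K * K)) = p ^- e.
    by rewrite -ex1 !exprD; field; rewrite !pn.
  rewrite /f /g e1 e2 ea q1 q2 q3 -ex2; ring.
have hg : V g by case: ial => _ ?; rewrite /g; sr.
have ig : isunit V g.
  by rewrite /g; apply: isunitM; [|apply: isunitM; [|apply: isunitX|apply: isunitX]|apply: isunitX; [|apply: isunitV]].
have [N hN] : exists N, forall V', List.In V' L -> V' (w ^+ N * f).
  apply: dvr_absorb_list => V' hV'; have [[p' hd'] hm] := hLa hV'; split; first by exists p'.
  have hV'r := dvr_sub hd'; have haV' : V' a by case: hm.
  have := hu1 hV' => hu'; rewrite /w exprSr; have hmi := loc_id (dvr_loc hd').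
  apply: (idMr hmi); first by sr.
  by apply: (idM hmi) => //; sr.
exists (w ^+ N * f), (w ^+ N * g); split=> //; [sr | sr | | by rewrite ef mulrA].
by apply: isunitM => //; apply: isunitX.
Qed.

(** Filter [J] by the value at [V]. An element of [A]-regular behaviour elsewhere and value exactly
    [-e] at [V], supplied by [exact_pole], embeds the layer of value [e] in the residue ring of [A]
    at the center of [V]. *)
Lemma noethquot_pole J e : submod A J -> incl J A -> noethquot A (cap A (max_ideal V)) A ->
  noethquot A (cap J (divides V (p ^+ e))) J.
Proof.
move=> hJ hJA hfg; case: (hd) => hV hp p0 hpi _.
have hAV : incl A V by move=> z /hAP [].
have hVid n : is_ideal V (divides V (p ^+ n)) by apply: divides_ideal => //; sr.
have hVm n : submod A (divides V (p ^+ n)) by apply: submod_sub hAV (submod_ideal (hVid n)).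
have hmid := loc_id (dvr_loc hd).
elim: e => [|e IH].
  by apply: noethquot_triv => z hz; split=> //; exists z; [apply/hAV/hJA | rewrite expr0 mulr1].
have [u [k [hu1' hu2' hk [k0 hki] eu]]] := exact_pole e.
have hJ' := cap_submod hJ (hVm e).
have u_0 : u != 0 by rewrite eu mulf_neq0 ?invr_neq0 ?expf_neq0.
apply: (noethquot_trans hA hJ' _ hJ _ _ IH).
- by move=> z [].
- move=> z [hz [c hc ec]]; split=> //; exists (c * p); first by sr.
  by rewrite ec exprS mulrA.
have hsp : submod A (cap A (max_ideal V)).
  by apply: cap_submod; [apply: submod_ring | apply: submod_sub hAV (submod_ideal hmid)].
have hsc : forall z, cap J (divides V (p ^+ e)) z -> A (u * z).
  move=> z [hz [c hc ec]]; have /hAP [h1 h2 h3] := hJA _ hz; apply/hAP; split; first by sr.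
    have -> : u * z = k * c by rewrite eu ec; field; rewrite expf_neq0.
    by sr.
  move=> V' hV'; have := hu2' V' hV'; have := h3 V' hV'.
  by have [[p' /dvr_sub hs] _] := hLa hV' => ? ?; sr.
have hpA : incl (cap A (max_ideal V)) A by move=> z [].
have := noethquot_scale hA hsp u_0 hJ' hsc hpA hfg; apply: noethquot_mono => // z [[hz _] [_ /(dvr_maxP _ hd) [c hc ec]]].
split=> //; exists (c / k); first by sr.
have -> : z = u^-1 * (u * z) by rewrite mulKf.
by rewrite ec eu exprS; field; rewrite k0 expf_neq0.
Qed.
End Irredundant.

(** Redundant members of [L] are discarded by induction on its size. In an irredundant list each [V]
    admits an element of [B] with a pole at [V] and at no other member, as [exact_pole] requires.
    Membership of [z / a] is then imposed for one [V] after another, and each step has a Noetherian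
    quotient by [noethquot_pole]. *)
Lemma mori_nishimura A B L a : is_subring A -> quotient_field_of A -> is_subring B ->
  A a -> a != 0 -> B a^-1 ->
  (forall z, A z <-> B z /\ forall V, List.In V L -> V z) ->
  (forall V, List.In V L -> [/\ exists p, dvr V p, max_ideal V a & noethquot A (cap A (max_ideal V)) A]) ->
  noethquot A (divides A a) A.
Proof.
move=> hA hF hB ha a0 hai; have [n] := ubnP (size L); elim: n L => // n IH L hn hAP hL.
case: (pselect (exists L1 V L2, L = L1 ++ V :: L2 /\
    forall z, B z -> (forall V', List.In V' (L1 ++ L2) -> V' z) -> V z)) => [[L1 [V [L2 [eL hred]]]]|hirr].
  have hin V' : List.In V' L <-> V' = V \/ List.In V' (L1 ++ L2).
    by rewrite eL; apply: In_mid.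
  apply: (IH (L1 ++ L2)).
  - by move: hn; rewrite eL !size_cat /= addnS ltnS.
  - move=> z; split=> [/hAP [hz h]|[hz h]].
      by split=> // V' hV'; apply: h; apply/hin; right.
    by apply/hAP; split=> // V' /hin [->|]; [apply: hred | apply: h].
  - by move=> V' hV'; apply: hL; apply/hin; right.
have key L' : (forall V, List.In V L' -> List.In V L) ->
    noethquot A (fun z => A z /\ forall V, List.In V L' -> V (z / a)) A.
  elim: L' => [|V L' IHL] hL'; first by apply: noethquot_triv.
  have hVL : List.In V L by apply: hL'; left.
  have {}IHL : noethquot A (fun z => A z /\ forall V, List.In V L' -> V (z / a)) A.
    by apply: IHL => V' hV'; apply: hL'; right.
  set J := fun z => _ in IHL.
  have hJ : submod A J.
    have hs V' : List.In V' L' -> is_subring V' /\ incl A V'.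
      move=> hV'; have hV'' := hL' V' (or_intror hV'); have [[p /dvr_sub hs] _ _] := hL V' hV''.
      by split=> // z /hAP [_]; apply.
    split.
    - by split; [sr | move=> V' /hs [hs' _]; rewrite mul0r; sr].
    - move=> x y [hx hx'] [hy hy']; split; first by sr.
      by move=> V' hV'; have [hs' _] := hs V' hV'; have := hx' V' hV'; have := hy' V' hV'; rewrite mulrDl => ? ?; sr.
    - move=> r x hr [hx hx']; split; first by sr.
      by move=> V' hV'; have [hs' hi] := hs V' hV'; have := hx' V' hV'; have := hi r hr; rewrite -mulrA => ? ?; sr.
  have hJA : incl J A by move=> z [].
  have [[p hd] hVa hfg] := hL V hVL.
  have [L1 [L2 eL]] := In_split hVL.
  have [u0 [hu0 hu1 hu2]] : exists u0, [/\ B u0, forall V', List.In V' (L1 ++ L2) -> V' u0 & ~ V u0].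
    apply: contrapT => hno; apply: hirr; exists L1, V, L2; split=> // z hz h.
    by apply: contrapT => nz; apply: hno; exists z.
  have hin V' : List.In V' L <-> V' = V \/ List.In V' (L1 ++ L2).
    by rewrite eL; apply: In_mid.
  have hAP' z : A z <-> [/\ B z, V z & forall V', List.In V' (L1 ++ L2) -> V' z].
    split=> [/hAP [hz h]|[hz hV h]].
      by split=> //; [apply: h | move=> V' hV'; apply: h; apply/hin; right].
    by apply/hAP; split=> // V' /hin [->|] //; apply: h.
  have hLa V' : List.In V' (L1 ++ L2) -> (exists p, dvr V' p) /\ max_ideal V' a.
    by move=> hV'; have [] := hL V'; [apply/hin; right | split].
  have [al [l [hal [al0 hali] ea]]] := dvr_zero_form hd hVa a0.
  have hV := dvr_sub hd; have p0 : p != 0 by case: hd.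
  apply: (noethquot_trans hA hJ hJA (submod_ring hA (fun z h => h)) _ _ IHL).
    by move=> z [hz h]; split=> // V' hV'; apply: h; right.
  have := noethquot_pole hA hF hB ha a0 hai hd hAP' hVa hLa hu0 hu1 hu2 (e := l.+1) hJ hJA hfg.
  apply: noethquot_mono => // z [[hz hz'] [c hc ec]]; split=> // V' [<-|]; last exact: hz'.
  have -> : z / a = c / al by rewrite ec ea; field; rewrite al0 expf_neq0.
  by sr.
apply: noethquot_mono (key L (fun V h => h)) => // z [hz h].
exists (z / a); last by rewrite divfK.
apply/hAP; split; last exact: h.
by case/hAP: hz => ? _; sr.
Qed.
End MoriNishimura.

(** * The tree of successors and the theorem *)

Section Final.
Variable F : fieldType.
Implicit Types (A R S T P Q W : F -> Prop) (x y z a b q : F) (f g p : {poly F}).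

Lemma dep_chain (T : Type) (Bad : T -> Prop) (rel : T -> T -> Prop) c0 :
  (forall c, Bad c -> exists2 d, rel c d & Bad d) -> Bad c0 ->
  exists C : nat -> T, [/\ C 0%N = c0, forall n, rel (C n) (C n.+1) & forall n, Bad (C n)].
Proof.
move=> h h0.
have hn (u : {c | Bad c}) : exists v : {c | Bad c}, rel (sval u) (sval v).
  by case: u => c hc /=; have [d hd hb] := h c hc; exists (exist _ d hb).
have [f hf] := choice hn.
pose g n := iter n f (exist _ c0 h0).
exists (fun n => sval (g n)); split=> [|n|n]; [by [] | exact: (hf (g n)) | exact: (svalP (g n))].
Qed.

Lemma primein_assoc R q r : is_subring R -> primein R q -> primein R r -> divides R q r -> locp R q = locp R r.
Proof.
move=> hR [hq q0 hqu hqp] [hr r0 hru hrp] [s hs e].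
have hrq : divides R r q.
  case: (hrp s q hs hq) => //; first by rewrite -e; apply: divides_refl.
  move=> [c hc ec]; case: hqu; split=> //.
  have e1 : c * q = 1 by apply: (mulIf r0); rewrite mul1r {2}e ec; ring.
  by have -> : q^-1 = c by rewrite -[c](mulfK q0) e1 mul1r.
apply: incl_eq => _ [a [b [ha hb nb ->]]]; exists a, b; split=> // hd; apply: nb.
  by apply: divides_trans hd => //; exists s.
exact: divides_trans hrq hd.
Qed.

(** The order valuation ring of [R] can be read off at any point of the curve: its center there
    contains [x] but not the equation of the point, so it is the prime ideal generated by [x]. *)
Lemma locp_point R x y P : rlr R x y -> quotient_field_of R -> point R x y P ->
  locp (locat (adjoin R (y / x)) P) x = locp (adjoin R (y / x)) x.
Proof.
move=> h hF hp; have hR := rlr_sub h; have hB := adjoin_subring (y / x) hR.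
have [p hpg] := point_gen_ex h hp; have hS := point_rlr h hp hpg; case: (hp) => hP hPx _.
have hd := blowup_dvr h hF; have hpx := adjoin_primein h.
have hSV : incl (locat (adjoin R (y / x)) P) (locp (adjoin R (y / x)) x).
  move=> _ [a [b [ha hb nb ->]]]; exists a, b; split=> // -[c hc e]; apply: nb.
  by rewrite e; apply: (idM hP.1).
have hFS : quotient_field_of (locat (adjoin R (y / x)) P).
  by apply: frac_incl hF _ => z hz; apply: locat_incl => //; apply: adjoin_incl.
have hxm : max_ideal (locp (adjoin R (y / x)) x) x.
  by apply/(locp_max hB hpx); [case: hpx | apply: divides_refl].
case: (hpg) => hp1 _ _ _.
have [|q hq eq] := locp_center hS hFS hd hSV.
  move=> [_ hm]; have hpB : adjoin R (y / x) p.[y / x] by exists p.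
  have /(adjoin_x h hp1) := (locp_max hB hpx hpB).1 hm; exact: pointeq_nallm hpg.
rewrite eq; symmetry; apply: primein_assoc => //; [exact: rlr_sub hS | exact: rlr_primein hS |].
by apply/(locp_max (rlr_sub hS) hq (rlr_x hS)); rewrite -eq.
Qed.

Lemma pow_divides R x y a b : rlr R x y -> R a -> R b -> a != 0 ->
  (forall r, primein R r -> divides R r a -> divides R r b) -> exists k, divides R a (b ^+ k).
Proof.
move=> h ha hb a0; have hR := rlr_sub h; move: a ha a0.
apply: (div_ind hR (rlr_noeth h)) => a ha a0 IH hall.
case: (pselect (isunit R a)) => hau; first by exists 0%N; apply: isunit_divides => //; rewrite expr0; sr.
have [r hr hra] := prime_divisor h ha a0 hau; case: (hra) => a1 ha1 ea.
case: (hr) => hrR r0 hru _; have [b1 hb1 eb] := hall r hr hra.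
have [||k [c hc ec]] := IH a1 r ha1 hrR hru; first by rewrite mulrC.
  move=> r' hr' [c hc ec]; apply: hall => //; exists (c * r); first by sr.
  by rewrite ea ec; ring.
exists k.+1, (c * b1); first by sr.
by rewrite exprSr ec ea eb; ring.
Qed.

Lemma primein_list R x y a : rlr R x y -> R a -> a != 0 ->
  exists L : seq (F -> Prop), forall q, primein R q -> divides R q a -> List.In (locp R q) L.
Proof.
move=> h; have hR := rlr_sub h; move: a; apply: (div_ind hR (rlr_noeth h)) => a ha a0 IH.
case: (pselect (isunit R a)) => hau.
  exists [::] => q [hq q0 hqu _] [c hc e]; case: hqu.
  by apply: (@isunitMl _ R q c) => //; rewrite mulrC -e.
have [r hr [a1 ha1 ea]] := prime_divisor h ha a0 hau; case: (hr) => hrR r0 hru _.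
have [|L hL] := IH a1 r ha1 hrR hru; first by rewrite mulrC.
exists (locp R r :: L) => q hq; rewrite ea; case: (hq) => _ _ _ hqp /(hqp _ _ ha1 hrR) [hd|hd].
  by right; apply: hL.
by left; symmetry; apply: primein_assoc.
Qed.

Lemma filter_In (T : Type) (L : seq T) (Q : T -> Prop) :
  exists L', forall v, List.In v L' <-> List.In v L /\ Q v.
Proof.
elim: L => [|a L [L' hL']]; first by exists [::] => v; split=> // -[].
case: (pselect (Q a)) => ha.
  exists (a :: L') => v /=; rewrite hL'; split; last by tauto.
  by case=> [<-|[]]; tauto.
exists L' => v /=; rewrite hL'; split; first by tauto.
by case=> -[e|hv] hQ //; case: ha; rewrite e.
Qed.

Variables (D : F -> Prop) (V U : (F -> Prop) -> Prop) (x0 y0 : F).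
Hypotheses (hD : rlr D x0 y0) (hF : quotient_field_of D).
Hypotheses (hdown : is_downset D V) (hnoeth : noetherian_space V) (hU : zariski_open_in V U).
Let hDr := rlr_sub hD.

(** The Noetherian hypothesis is applied here, to the increasing open sets of rings in [V] that
    contain one of the first [n + 1] elements [h k]: each new ring [R n] lies in none of the earlier
    sets. *)
Lemma no_escape (R : nat -> F -> Prop) (h : nat -> F) : (forall n, V (R n)) ->
  (forall n, R n (h n)) -> (forall i j, (i < j)%N -> ~ R j (h i)) -> False.
Proof.
move=> hV hR hn.
have [|| N hN] := hnoeth (U := fun n S => V S /\ exists2 k, (k <= n)%N & S (h k)).
- move=> n; split; first by move=> S [].
  move=> S [_ [k hk hS]]; exists [:: h k]; split.
    by move=> z; rewrite inE => /eqP ->.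
  by move=> S' hS' hz; split=> //; exists k => //; apply: hz; rewrite inE.
- by move=> n S [hS [k hk hSk]]; split=> //; exists k => //; apply: leqW.
have [|_ [k hk hRk]] := (hN N.+1 (leqnSn N) (R N.+1)).1; first by split=> //; exists N.+1.
by apply: (hn k N.+1).
Qed.

Inductive reach : (F -> Prop) -> (F -> Prop) -> Prop :=
| reach_here R : U R -> reach R R
| reach_step R S T : ~ U R -> successor R S -> reach S T -> reach R T.

Lemma reach_props R T : reach R T -> (exists x y, rlr R x y) ->
  [/\ U T, incl R T & exists x y, rlr T x y].
Proof.
elim=> {R T} [R hR hr|R S T nU hs _ IH hr]; first by split.
have [h1 h2 h3] := IH (successor_rlr hs); split=> // z hz; apply: h2; exact: (successor_incl hs).
Qed.

Lemma reachP R T : reach R T ->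
  (U R /\ T = R) \/ (~ U R /\ exists2 S, successor R S & reach S T).
Proof. by case=> [S hS|R1 S T' nU hs hT]; [left | right; split=> //; exists S]. Qed.

Lemma U_V R : U R -> V R. Proof. by case: hU => h _; apply: h. Qed.

Lemma V_below S T : (exists x y, rlr S x y) -> incl D S -> incl S T -> V T -> V S.
Proof.
move=> [x [y h]] hi hST hT; case: hdown => _; apply; last exact: hT; last exact: hST.
by left; split=> //; apply: reg_of_rlr h.
Qed.

(** Otherwise, starting from [D], one could always pass to a further successor inside [R], against
    [no_infinite_chain]. *)
Lemma reach_below R u v : rlr R u v -> U R -> incl D R -> exists2 T, reach D T & incl T R.
Proof.
move=> hR hUR hDR; apply: contrapT => hno.
pose Bad S := [/\ exists x y, rlr S x y, incl D S, incl S R & ~ exists2 T, reach S T & incl T R].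
have [||C [e0 hsucc hbad]] := @dep_chain _ Bad (@successor F) D.
- move=> S [[x [y h]] hDS hSR hn].
  have nU : ~ U S by move=> hUS; apply: hn; exists S => //; apply: reach_here.
  have [|T hT hTR] := successor_in h (frac_incl hF hDS) hR hSR.
    by move=> hRS; apply: nU; rewrite (incl_eq hSR hRS).
  exists T => //; split=> //; [exact: successor_rlr hT | |].
    by move=> z /hDS; apply: (successor_incl hT).
  by move=> [T' h1 h2]; apply: hn; exists T' => //; apply: reach_step hT h1.
- by split=> //; exists x0, y0.
by apply: (no_infinite_chain (C := C) _ hsucc hR) => [|n]; [rewrite e0 | case: (hbad n)].
Qed.

Definition node R := [/\ exists x y, rlr R x y, incl D R & finres D R].

Lemma node_successor R S : node R -> successor R S -> node S.
Proof.
move=> [h1 h2 h3] hs; split; [exact: successor_rlr hs | | exact: finres_successor hs h3].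
by move=> z /h2; apply: (successor_incl hs).
Qed.

(** The divisors are compared with those of [R] rather than of [D], so that the property passes from
    the successors of [R] to [R]. *)
Definition exceptional_in (L : seq (F -> Prop)) R := forall T q, reach R T -> primein T q ->
  (List.In (locp T q) L /\ noethcenter D (locp T q)) \/ exists2 q', primein R q' & locp T q = locp R q'.

Definition bad R := ~ U R /\ exists T, reach R T.

(** A ring [T] reached from [C n] cannot contain the whole branch, so it leaves it at some step
    after [n]. There [successor_separate] gives an element of [T] whose inverse is a nonunit of the
    next ring of the branch; no regular ring above that ring contains the element. *)
Lemma no_infinite_branch (C : nat -> F -> Prop) : C 0%N = D -> (forall n, successor (C n) (C n.+1)) ->
  (forall n, bad (C n)) -> False.
Proof.
move=> e0 hs hbad.
have hC n : exists x y, rlr (C n) x y by have [x [y [P [h _ _ _]]]] := hs n; exists x, y.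
have mono n m : (n <= m)%N -> incl (C n) (C m).
  move=> /subnK <-; elim: (m - n)%N => [|k IH] z hz //.
  by rewrite addSn; apply: (successor_incl (hs _)); apply: IH.
have hDC n : incl D (C n) by rewrite -e0; apply: mono.
have hFC n : quotient_field_of (C n) by apply: frac_incl hF (hDC n).
have hstep n : exists d : nat * (F -> Prop) * F,
    [/\ [/\ (n <= d.1.1)%N, V d.1.2, exists x y, rlr d.1.2 x y & incl (C n) d.1.2],
      d.2 != 0, d.1.2 d.2 & max_ideal (C d.1.1.+1) d.2^-1].
  have [nU [T hT]] := hbad n; have [hUT hiT [u [v hTr]]] := reach_props hT (hC n).
  have /ex_minnP [m hm hmin] : exists m, `[< ~ incl (C m) T >].
    apply: contrapT => hno; apply: (no_infinite_chain (C := C) _ hs hTr); first by rewrite e0.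
    by move=> m; apply: contrapT => nm; apply: hno; exists m; apply/asboolP.
  have hnm : (n < m)%N.
    by rewrite ltnNge; apply/negP => hle; move/asboolP: hm; apply => z hz; apply: hiT; apply: (mono m n).
  case: m hm hmin hnm => [|m] // /asboolP hm hmin hnm.
  have hmT : incl (C m) T.
    by apply: contrapT => nm; have := hmin m (asboolT nm); rewrite ltnn.
  have [x [y hCm]] := hC m.
  have [|h [h1 h2 h3]] := successor_separate (hs m) (hFC m) hTr hmT _ hm.
    by move=> hTm; have [nUm _] := hbad m; apply: nUm; rewrite (incl_eq hmT hTm).
  by exists (m, T, h); split=> //=; split=> //; [apply: U_V | exists u, v].
have [d hd] := choice hstep.
(* The next choice starts beyond the step at which the present ring leaves the branch. *)
pose ns := fix ns k := if k is k'.+1 then (d (ns k')).1.1.+1 else 0%N.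
have ns_mono i j : (i < j)%N -> ((d (ns i)).1.1.+1 <= ns j)%N.
  move=> /subnK <-; elim: (j - i.+1)%N => [|k IH]; first by rewrite add0n.
  rewrite addSn /=; apply: leq_trans IH _; apply: leqW; by case: (hd (ns (k + i.+1)%N)) => -[].
apply: (@no_escape (fun k => (d (ns k)).1.2) (fun k => (d (ns k)).2)).
- by move=> k; case: (hd (ns k)) => -[].
- by move=> k; case: (hd (ns k)).
move=> i j hij hR; case: (hd (ns i)) => _ h0 _ hm.
case: (hd (ns j)) => -[_ _ [u [v hTr]] hCT] _ _ _.
have hi := incl_trans (mono _ _ (ns_mono _ _ hij)) hCT.
have [x [y hC']] := hC (d (ns i)).1.1.+1.
have hdm := rlr_dominated hC' (hFC _) hTr hi.
have [_] := dominated_max hC' (rlr_loc hTr) hi hdm hm; apply; split; first by rewrite invr_neq0.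
by rewrite invrK.
Qed.

(* Otherwise choose bad points one after another, with [T] in [U] above each. As [U] is open, [T]
   does not lie in the order valuation ring of [R], so [p^k / x] is in [T] for the equation [p] of
   the point; this element is in no [T] chosen later, where [p] is a unit. *)
Lemma bad_points_finite R x y : rlr R x y -> incl D R ->
  exists g, [/\ polyover R g, ~ inmax R g &
    forall P, point R x y P -> bad (locat (adjoin R (y / x)) P) -> P g.[y / x]].
Proof.
move=> h hDR; apply: contrapT => hno.
have hR := rlr_sub h; have hL := rlr_loc h; have hFR := frac_incl hF hDR.
set t := y / x in hno; set B := adjoin R t in hno; have hB : is_subring B := adjoin_subring t hR.
have hinf g : polyover R g -> ~ inmax R g -> exists P, [/\ point R x y P, bad (locat B P) & ~ P g.[t]].
  move=> hg ng; apply: contrapT => hn; apply: hno; exists g; split=> // P hp hb.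
  by apply: contrapT => nP; apply: hn; exists P.
have hBF P : point R x y P -> incl B (locat B P).
  by case=> hP _ _; apply: locat_incl.
have hDS P : point R x y P -> incl D (locat B P).
  by move=> hp z /hDR hz; apply: hBF => //; apply: adjoin_incl.
have hSr P : point R x y P -> exists u v, rlr (locat B P) u v.
  by move=> hp; have [p hpg] := point_gen_ex h hp; exists x, p.[t]; apply: point_rlr.
have hxT P T u v : point R x y P -> incl (locat B P) T -> rlr T u v -> max_ideal T x.
  move=> hp hi hT; have [p hpg] := point_gen_ex h hp; have hS := point_rlr h hp hpg.
  by have [] := rlr_dominated hS (frac_incl hF (hDS P hp)) hT hi.
(* Otherwise a neighbourhood of [T] inside [U] is defined by elements of the order valuation ring.
   At another bad point, off the zeros of a common denominator, they all lie in the local ring,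
   which would then belong to [U]. *)
have notW P T : point R x y P -> bad (locat B P) -> reach (locat B P) T -> ~ incl T (locp B x).
  move=> hp _ hreach hTW.
  have [hUT hiT _] := reach_props hreach (hSr P hp).
  case: hU => _ /(_ T hUT) [xs [hxs hopen]].
  have [g [hg ng hgs]] := common_den h (fun z hz => hTW _ (hxs z hz)).
  have [Q [hq [nUQ [T' hT']] nQ]] := hinf g hg ng; apply: nUQ; apply: hopen.
    have [hUT' hiT' _] := reach_props hT' (hSr Q hq).
    by apply: (V_below (hSr Q hq) (hDS Q hq) hiT'); apply: U_V.
  move=> z hz; exists (z * g.[t]), g.[t]; case: (hq) => hQ _ _; split=> //.
  - exact: hgs.
  - by exists g.
  by rewrite mulfK //; apply: (nP_neq0 hQ).
have hstep (g : {g | polyover R g /\ ~ inmax R g}) : exists d : {g | polyover R g /\ ~ inmax R g} * (F -> Prop) * F,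
    [/\ [/\ V d.1.2, d.1.2 d.2, exists u v, rlr d.1.2 u v &
          exists2 P, point R x y P & ~ P (sval g).[t] /\ incl (locat B P) d.1.2],
      forall Q T u v, point R x y Q -> rlr T u v -> incl (locat B Q) T -> ~ Q (sval d.1.1).[t] -> ~ T d.2 &
      forall Q, point R x y Q -> Q (sval g).[t] -> Q (sval d.1.1).[t]].
  case: g => g [hg ng] /=.
  have [P [hp hb nP]] := hinf g hg ng; have [p hpg] := point_gen_ex h hp.
  have [_ [T hT]] := hb; have [hUT hiT [u [v hTr]]] := reach_props hT (hSr P hp).
  have hS := point_rlr h hp hpg; rewrite -/t -/B in hS; case: (hpg) => hp1 hp2 hp3 hp4.
  have hxm := hxT P T u v hp hiT hTr; have hxT' : T x by case: hxm.
  have hpB : B p.[t] by exists p.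
  have hpT : T p.[t] by apply: hiT; apply: hBF.
  have x_0 := rlr_x0 h; have hTs := rlr_sub hTr.
  (* A prime divisor of [x] in [T] that does not divide [p] would have the order valuation ring as
     its localisation, and that ring does not contain [T]. *)
  have [|k [c hc ec]] := pow_divides hTr hxT' hpT x_0.
    move=> r hr hrx; apply: contrapT => hrp.
    have hFT := frac_incl hF (fun z hz => hiT z (hDS P hp z hz)).
    have hd := locp_dvr hTs (rlr_noeth hTr) hFT hr.
    have hSV : incl (locat B P) (locp T r) by move=> z /hiT; apply: locp_incl.
    have [|q hq eq] := locp_center hS (frac_incl hF (hDS P hp)) hd hSV.
      by move=> [_ /(locp_max hTs hr hpT)].
    apply: (notW P T hp hb hT); rewrite -(locp_point h hFR hp) -/t -/B.
    have <- : locp (locat B P) q = locp (locat B P) x.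
      apply: primein_assoc => //; [exact: rlr_sub hS | exact: rlr_primein hS |].
      by apply/(locp_max (rlr_sub hS) hq (rlr_x hS)); rewrite -eq; apply/(locp_max hTs hr).
    by rewrite -eq; apply: locp_incl.
  (* The product of the equations used so far is carried along, so that later points avoid all
     earlier ones. *)
  have hg' : polyover R (g * p) /\ ~ inmax R (g * p).
    by split; [apply: polyoverM | apply: gauss => //; apply: pointeq_nallm hpg].
  exists (exist _ (g * p) hg', T, c); split=> /=.
  - by split=> //; [apply: U_V | exists u, v | exists P].
  - move=> Q T2 u2 v2 hq hT2 hi2 nQ hcT.
    have hx2 := hxT Q T2 u2 v2 hq hi2 hT2; have hT2s := rlr_sub hT2.
    case: (hq) => hQ _ _.
    have nQp : ~ Q p.[t] by move=> hQp; apply: nQ; rewrite hornerM; apply: (idM hQ.1) => //; exists g.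
    have [p_0 hpi] := locat_inv hB hQ hpB nQp.
    have hpi2 := hi2 _ hpi; have hp2' := hi2 _ (hBF Q hq _ hpB).
    case: hx2 => _; apply; split=> //.
    have -> : x^-1 = c * p.[t]^-1 ^+ k; last by sr.
    have pk : p.[t] ^+ k != 0 by rewrite expf_neq0.
    by apply: (mulIf x_0); rewrite mulVf // mulrAC -ec exprVn mulfV.
  - by move=> Q [hQ _ _] hQg; rewrite hornerM; apply: (idMr hQ.1) => //; exists p.
have [d hd] := choice hstep.
have h1 : polyover R 1 /\ ~ inmax R 1 by split; [apply: polyoverC => //; sr | apply: inmax1].
pose gs := fix gs k := if k is k'.+1 then (d (gs k')).1.1 else exist _ 1 h1.
have gs_mono i j Q : (i <= j)%N -> point R x y Q -> Q (sval (gs i)).[t] -> Q (sval (gs j)).[t].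
  move=> /subnK <- hq hi; elim: (j - i)%N => [|k IH] //.
  by rewrite addSn /=; case: (hd (gs (k + i)%N)) => _ _; apply.
apply: (@no_escape (fun k => (d (gs k)).1.2) (fun k => (d (gs k)).2)).
- by move=> k; case: (hd (gs k)) => -[].
- by move=> k; case: (hd (gs k)) => -[].
move=> i j hij; case: (hd (gs i)) => _ hsep _.
case: (hd (gs j)) => -[_ _ [u [v hT]] [P hp [nP hi]]] _ _.
apply: (hsep P _ u v) => // hP; apply: nP; exact: (gs_mono i.+1 j).
Qed.

(** A divisor of a successor either has a nonmaximal center on [R], and is a divisor of [R], or
    contains [x] in its maximal ideal, and is the exceptional divisor of [R]. Beyond a point that is
    not bad no other ring is reached; the finitely many bad points contribute their own lists. *)
Lemma exceptional_step R : node R -> ~ U R -> (forall S, successor R S -> bad S -> exists L, exceptional_in L S) ->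
  exists L, exceptional_in L R.
Proof.
move=> [[x' [y' h']] hDR hlen] nU hS; have hFR := frac_incl hF hDR; have h := params_rlr h'.
have key x y : rlr R x y -> params R = (x, y) \/ params R = (y, x) -> exists L, forall P, point R x y P ->
    forall T q, reach (locat (adjoin R (y / x)) P) T -> primein T q ->
    (List.In (locp T q) L /\ noethcenter D (locp T q)) \/ exists2 q', primein R q' & locp T q = locp R q'.
  move=> hr hpar; set t := y / x; set B := adjoin R t.
  have hsc P : point R x y P -> successor R (locat B P) by exists x, y, P.
  have [g [hg ng hbad]] := bad_points_finite hr hDR.
  pose Rel P L := bad (locat B P) -> exceptional_in L (locat B P).
  have [|P hp _|L hL] := @point_fin F R x y hr _ Rel g _ hg ng.
  - move=> P L L' hL; split=> /hL hh T q h1 h2; case: (hh T q h1 h2) => [[h3 h4]|]; try (by right);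
      left; split=> //; apply/In_cat; by [left | right].
  - case: (pselect (bad (locat B P))) => hb; last by exists [::].
    by have [L hL] := hS _ (hsc P hp) hb; exists L.
  have hR := rlr_sub hr; have hB : is_subring B := adjoin_subring t hR.
  exists (locp B x :: L) => P hp T q hT hq.
  have [p hpg] := point_gen_ex hr hp; have hSr := point_rlr hr hp hpg; rewrite -/t -/B in hSr.
  have hi := successor_incl (hsc P hp).
  have exc q' : primein (locat B P) q' -> locp T q = locp (locat B P) q' ->
      (List.In (locp T q) (locp B x :: L) /\ noethcenter D (locp T q)) \/ exists2 q', primein R q' & locp T q = locp R q'.
    move=> hq' ->.
    have hd := locp_dvr (rlr_sub hSr) (rlr_noeth hSr) (frac_incl hFR hi) hq'.
    have hRV : incl R (locp (locat B P) q') by move=> z /hi; apply: locp_incl => //; apply: rlr_sub hSr.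
    case: (pselect (max_ideal (locp (locat B P) q') x /\ max_ideal (locp (locat B P) q') y)) => hxy; last first.
      by right; apply: (locp_center hr hFR hd hRV hxy).
    left; have -> : locp (locat B P) q' = locp B x.
      rewrite -(locp_point hr hFR hp); apply: primein_assoc => //; [exact: rlr_sub hSr | exact: rlr_primein hSr |].
      by apply/(locp_max (rlr_sub hSr) hq' (rlr_x hSr)); case: hxy.
    by split; [left | apply: noethcenter_blowup].
  case: (pselect (U (locat B P))) => hUP.
    case: (reachP hT) => [[_ eT]|[]] //; apply: (exc q); last by rewrite eT.
    by rewrite -eT.
  have hb : bad (locat B P) by split=> //; exists T.
  case: (hL P hp (hbad P hp hb) hb T q hT hq) => [[h1 h2]|[q' h1 h2]]; last exact: (exc q').
  by left; split=> //; right.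
have [|L1 hL1] := key _ _ h; first by left; case: (params R).
have [|L2 hL2] := key _ _ (rlr_sym h); first by right; case: (params R).
exists (L1 ++ L2) => T q hT hq.
case: (reachP hT) => [[] //|[_ [S [x [y [P [hr hpar hp ->]]]] hST]]].
have [e|e] : (x, y) = params R \/ (y, x) = params R by case: hpar => <-; [left | right].
  rewrite -e /= in hL1; case: (hL1 P hp T q hST hq) => [[h1 h2]|]; last by right.
  by left; split=> //; apply/In_cat; left.
rewrite -e /= in hL2; case: (hL2 P hp T q hST hq) => [[h1 h2]|]; last by right.
by left; split=> //; apply/In_cat; right.
Qed.

(** As in the lemma of König, a failure at [D] would propagate to a bad successor at each stage and
    produce an infinite bad branch. *)
Lemma exceptional_finite : exists L, exceptional_in L D.
Proof.
apply: contrapT => hno.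
pose Bad R := [/\ node R, bad R & ~ exists L, exceptional_in L R].
have mkbad R : node R -> ~ (exists L, exceptional_in L R) -> Bad R.
  move=> hn hL; split=> //; split.
    move=> hUR; apply: hL; exists [::] => T q hT hq; right.
    by case: (reachP hT) => [[_ e]|[]] //; exists q; rewrite ?e // -e.
  by apply: contrapT => hT; apply: hL; exists [::] => T q h1; case: hT; exists T.
have hnD : node D by split=> //; [exists x0, y0 | apply: finres_refl; apply: rlr_loc hD].
have [|C [e0 hs hb]] := @dep_chain _ Bad (@successor F) D _ (mkbad _ hnD hno).
  move=> R [hn [nU hT] hL]; apply: contrapT => hno'; apply: hL; apply: exceptional_step => // S hS hbS.
  apply: contrapT => hLS; apply: hno'; exists S => //; apply: mkbad => //; exact: node_successor hS.
by apply: (no_infinite_branch e0 hs) => n; case: (hb n).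
Qed.

Lemma OU_reach z : OU U z <-> forall T, reach D T -> T z.
Proof.
have hDx : exists x y, rlr D x y by exists x0, y0.
have hreg R u v : rlr R u v -> U R -> incl D R -> (forall T, reach D T -> T z) -> R z.
  by move=> h1 h2 h3 hz; have [T hT] := reach_below h1 h2 h3; apply; apply: hz.
split; first by move=> hz T hT; apply: hz; case: (reach_props hT hDx).
move=> hz R hR; have hVR := U_V hR; case: (hdown.1 R hVR) => [[hreg2 hDR]|[[_ hval] [hRL [hDR hm]]]].
  by have [u [v h]] := rlr_of_reg hreg2; apply: (hreg R u v).
case: hU => _ /(_ R hR) [xs [hxs hopen]].
have hdom : dominated D R by split=> // w hw; case/hm: hw.
have [S [u [v [h1 h2 h3 h4]]]] := valuation_approx hRL hval hD hF hdom hxs.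
apply: (h3); apply: (hreg S u v) => //; apply: hopen => //.
by apply: V_below h3 hVR => //; exists u, v.
Qed.

Lemma OU_normal_noeth : noetherian_normal_domain (OU U).
Proof.
have hDx : exists x y, rlr D x y by exists x0, y0.
have hT T : reach D T -> [/\ exists x y, rlr T x y, incl D T & quotient_field_of T].
  by move=> h; have [h1 h2 h3] := reach_props h hDx; split=> //; apply: frac_incl hF h2.
have hTs T : reach D T -> is_subring T by move=> /hT [[x [y /rlr_sub h]] _ _].
have hA : is_subring (OU U).
  split; first by apply/OU_reach => T /hTs h; sr.
  split; first by apply/OU_reach => T /hTs h; sr.
  split=> a b /OU_reach ha /OU_reach hb; apply/OU_reach => T hr;
    by have h := hTs T hr; have := ha T hr; have := hb T hr => ? ?; sr.
have hDA : incl D (OU U) by move=> z hz; apply/OU_reach => T /hT [_ hi _]; apply: hi.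
have hFA := frac_incl hF hDA.
split=> //; split; last first.
  move=> z _ [p [h1 [h2 h3]]]; apply/OU_reach => T hr; have [[x [y h]] hDT hFT] := hT T hr.
  apply: (rlr_normal h); first exact: hFT.
  by exists p; split=> //; split=> // i; have /OU_reach := h2 i; apply.
have [L hL] := exceptional_finite.
apply: noeth_of_noethquot => // a ha a0.
(* The element [a] is replaced by a multiple [d] in [D], so that the nonexceptional divisors at
   which it vanishes come from its prime factors in [D]. *)
have [d [b [hd [hb [b0 e]]]]] := hF a.
have d0 : d != 0 by apply: contraNneq a0 => d0; rewrite e d0 mul0r.
apply: (noethquot_mono (N := divides (OU U) d) (M := OU U)) => //.
  move=> _ [c hc ->]; exists (c * b); first by have := hDA _ hb => ?; sr.
  by rewrite e; field.
have [L2 hL2] := primein_list hD hd d0.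
pose Qd W := exists T q, [/\ reach D T, primein T q, W = locp T q, noethcenter D W & max_ideal W d].
have [L' hL'] := filter_In (L ++ L2) Qd.
have hin T q : reach D T -> primein T q -> max_ideal (locp T q) d -> List.In (locp T q) L'.
  move=> hr hq hm; apply/hL'; rewrite In_cat; case: (hL T q hr hq) => [[h1 h2]|[q' h1 h2]].
    by split; [left | exists T, q].
  split; last by exists T, q; split=> //; rewrite h2; apply: (noethcenter_locp hD hF h1).
  by right; rewrite h2; apply: hL2 => //; apply/(locp_max hDr h1 hd); rewrite -h2.
(* [B] collects the conditions at the divisors where [d] is a unit; the remaining divisors form the
   finite list [L']. *)
pose B z := forall T q, reach D T -> primein T q -> ~ max_ideal (locp T q) d -> locp T q z.
have hTlq T q : reach D T -> primein T q -> incl T (locp T q) by move=> hr hq; apply: locp_incl => //; apply: hTs.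
apply: (mori_nishimura (B := B) (L := L')) => //.
- have hs T q : reach D T -> primein T q -> is_subring (locp T q) by move=> hr hq; apply: locp_subring => //; apply: hTs.
  split; first by move=> T q hr hq _; have h := hs T q hr hq; sr.
  split; first by move=> T q hr hq _; have h := hs T q hr hq; sr.
  split=> u v hu hv T q hr hq hm; have h := hs T q hr hq; have := hu T q hr hq hm;
    by have := hv T q hr hq hm => ? ?; sr.
- exact: hDA.
- move=> T q hr hq hm; have [_ hDT _] := hT T hr.
  by case: (maxP (hTlq T q hr hq _ (hDT _ hd))) => // -[].
- move=> z; split.
    move=> /OU_reach hz; split; first by move=> T q hr hq _; apply: hTlq => //; apply: hz.
    by move=> W /hL' [_ [T [q [hr hq -> _ _]]]]; apply: hTlq => //; apply: hz.
  move=> [hBz hLz]; apply/OU_reach => T hr; have [[x [y h]] hDT hFT] := hT T hr.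
  apply: (locp_inter h hFT) => q hq.
  case: (pselect (max_ideal (locp T q) d)) => hm; last exact: hBz.
  by apply: hLz; apply: hin.
- move=> W /hL' [_ [T [q [hr hq eW [hdv hfg] hm]]]]; split=> //; apply: hfg => //.
  by move=> z /OU_reach hz; rewrite eW; apply: hTlq => //; apply: hz.
Qed.
End Final.

Theorem theorem5p10 (F : fieldType) (D : F -> Prop)
  (V : (F -> Prop) -> Prop) :
  is_regular_local_2 D -> quotient_field_of D ->
  is_downset D V -> noetherian_space V ->
  forall U : (F -> Prop) -> Prop, zariski_open_in V U ->
    noetherian_normal_domain (OU U).
Proof.
move=> hreg hF hdown hnoeth U hU; have [x [y h]] := rlr_of_reg hreg.
exact: OU_normal_noeth h hF hdown hnoeth hU.
Qed.
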